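(* Graph Isomorphism is polynomial-time solvable on $(\overline{2P_1+P_3},P_5)$-free graphs.
   Context: Graph Isomorphism is the problem of deciding, given two graphs $G$ and $H$, whether there is an isomorphism from $G$ to $H$. A graph is $(H_1,H_2)$-free if it contains no induced subgraph isomorphic to $H_1$ or $H_2$. $P_r$ denotes the path on $r$ vertices, $G+H$ denotes disjoint union, $tG$ denotes $t$ disjoint copies of $G$, and $\overline{G}$ denotes the complement of $G$. *)

(* Defs.v *)
From mathcomp Require Import all_boot.
Set Implicit Arguments. Unset Strict Implicit. Unset Printing Implicit Defensive.

Record graph := Graph { nv : nat; adj : 'I_nv -> 'I_nv -> bool }.
Arguments adj : clear implicits.

Definition simple (G : graph) : Prop :=
  (forall x y, adj G x y = adj G y x) /\ (forall x, adj G x x = false).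

Definition induced_sub (H G : graph) : Prop :=
  exists f : 'I_(nv H) -> 'I_(nv G),
    injective f /\ forall x y, adj H x y = adj G (f x) (f y).

Definition free2 (H1 H2 G : graph) : Prop :=
  ~ induced_sub H1 G /\ ~ induced_sub H2 G.

Definition isomorphic (G H : graph) : Prop :=
  exists f : 'I_(nv G) -> 'I_(nv H),
    bijective f /\ forall x y, adj G x y = adj H (f x) (f y).

Definition path_graph (r : nat) : graph :=
  @Graph r (fun i j => (i.+1 == j :> nat) || (j.+1 == i :> nat)).

Definition gunion (G H : graph) : graph :=
  @Graph (nv G + nv H) (fun x y =>
    match split x, split y with
    | inl a, inl b => adj G a b
    | inr a, inr b => adj H a b
    | _, _ => false
    end).

Definition gcompl (G : graph) : graph :=
  @Graph (nv G) (fun x y => (x != y) && ~~ adj G x y).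

Fixpoint copies (t : nat) (G : graph) : graph :=
  match t with
  | 0 => @Graph 0 (fun _ _ => false)
  | 1 => G
  | t'.+1 => gunion (copies t' G) G
  end.

Definition co_2P1_P3 : graph := gcompl (gunion (copies 2 (path_graph 1)) (path_graph 3)).

Inductive sym := S0 | S1 | Sep.

Definition bit (b : bool) : sym := if b then S1 else S0.

Definition enc_graph (G : graph) : seq sym :=
  [seq bit (adj G i j) | i <- enum 'I_(nv G), j <- enum 'I_(nv G)].

Definition enc_pair (G H : graph) : seq sym := enc_graph G ++ Sep :: enc_graph H.

Inductive move := MoveL | MoveR | Stay.

Record TM (Q Gam : finType) := {
  blank : Gam;
  inp   : sym -> Gam;
  q0    : Q;
  qacc  : Q;
  qrej  : Q;
  delta : Q -> Gam -> Q * Gam * move }.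

(* configuration: state, tape left of head (nearest first), head symbol,
   tape right of head; the tape is blank beyond the lists (two-way infinite). *)
Record config (Q Gam : Type) : Type := Config { st : Q; lft : seq Gam; cur : Gam; rgt : seq Gam }.

Section TMSem.
Variables (Q Gam : finType) (M : TM Q Gam).

Definition halted (c : config Q Gam) : bool := (st c == qacc M) || (st c == qrej M).

Definition step (c : config Q Gam) : config Q Gam :=
  if halted c then c else
  let: (q', a, m) := delta M (st c) (cur c) in
  match m with
  | Stay => Config q' (lft c) a (rgt c)
  | MoveL => match lft c with
             | [::] => Config q' [::] (blank M) (a :: rgt c)
             | b :: l => Config q' l b (a :: rgt c)
             end
  | MoveR => match rgt c with
             | [::] => Config q' (a :: lft c) (blank M) [::]
             | b :: r => Config q' (a :: lft c) b r
             end
  end.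

Definition init (w : seq sym) : config Q Gam :=
  match w with
  | [::] => Config (q0 M) [::] (blank M) [::]
  | x :: w' => Config (q0 M) [::] (inp M x) (map (inp M) w')
  end.

Definition run (t : nat) (w : seq sym) : config Q Gam := iter t step (init w).
End TMSem.

Definition GI_poly_time_on (P : graph -> Prop) : Prop :=
  exists (Q Gam : finType) (M : TM Q Gam) (c k : nat),
    forall G H : graph, P G -> P H ->
      exists t, t <= c * (size (enc_pair G H)).+1 ^ k /\
        halted M (run M t (enc_pair G H)) /\
        (st (run M t (enc_pair G H)) = qacc M <-> isomorphic G H).

(* Main.v *)
Require Import Defs.
From mathcomp Require Import all_boot zify.
From mathcomp Require Import boolp.
Set Implicit Arguments. Unset Strict Implicit. Unset Printing Implicit Defensive.

(** The decision procedure is Weisfeiler-Leman refinement on 11-tuples, run on both graphs at once: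
    a pair of tuples is discarded when its atomic types differ, or when for some coordinate the
    replacements of that coordinate in the two tuples cannot be matched along surviving pairs. There
    are n^22 pairs, so more than n^22 rounds give a stable relation ([wl_stable]). An isomorphism
    always preserves a pair ([isomorphic_wl]). The substance is the converse, [wl_decides]: for
    graphs of the class a surviving pair forces an isomorphism.

    A stable relation is a winning strategy for Duplicator in the bijective 11-pebble game,
    abstracted as [bisim] ([wl_bisimP]). That such a strategy yields an isomorphism is [bisim_iso],
    by induction on the vertex set. Three tools carry it. [decomposition]: if an equivalence is
    invariant under the game and adjacency across its classes depends only on types (what one pebble
    can tell), the classes may be treated separately. [quotient_iso]: for classes that are modules
    it suffices to treat the quotient, at the cost of one pebble, and the classes. [pebbled_iso]:
    fixing some pebbles refines the types.

    A graph that is disconnected, or whose complement is, splits into components or co-components.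
    Otherwise the maximal proper modules partition it, the quotient is prime and connected, and
    three cases remain.

    (1) There is a K4. The excluded graph is K4 plus a vertex with exactly two neighbours in it, so
    the vertices with at least three neighbours in the K4 form a complete multipartite set, a
    [blob], and every outside vertex sees at most one of its parts. With the K4 pebbled the graph
    splits into bipartite pieces ([k4_prime_iso]).

    (2) There is neither K4 nor induced 2K2. Six pebbles make every type an independent set
    ([two_k2_free_iso]).

    (3) There is an induced 2K2 but no K4. Take a minimum set S whose removal leaves two edges in
    different components. Primality makes the nontrivial components triangle-free and 2K2-free. If
    there are two of them, an edge pebbled in each makes the types independent ([sep_two_iso]); if
    there are more, three pebbles make S recognizable and the graph splits along the components
    ([sep_three_iso]).

    All cases end in [independent_types_iso], about P5-free, K4-free graphs in which vertices of the
    same type are nonadjacent. If two vertices share a type, a maximal disconnected union of types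
    Y, each of whose components meets that type, yields a proper decomposition: every component of Y
    together with the outside vertices mixed on it, and the rest. P5-freeness drives the adjacency
    arguments.

    For the running time, the refinement is written in a small language of counters and bit arrays,
    whose counters cannot exceed a cap polynomial in the input length, and this language is compiled
    to Turing machines ([cmd_machine]). [decide_encoding] identifies the outcome of the program with
    the outcome of the refinement. *)

(** * Perfect matchings along difunctional relations *)

Section Matching.
Variables U W : finType.

Definition bij_on (A : {set U}) (B : {set W}) (f : U -> W) :=
  {in A &, injective f} /\ f @: A = B.

Lemma bij_on_mem A B f x : bij_on A B f -> x \in A -> f x \in B.
Proof. by case=> _ <- xA; apply: imset_f. Qed.

Lemma bij_on_surj A B f y : bij_on A B f -> y \in B -> exists2 x, x \in A & y = f x.
Proof. by case=> _ <- /imsetP. Qed.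

(** A difunctional relation is a disjoint union of bicliques, and [cnt] says that these are
    balanced. Removing a related pair keeps them balanced, since each biclique contains both members
    of the pair or neither. *)
Lemma difunctional_matching (w0 : W) (M : U -> W -> bool) (A : {set U}) (B : {set W}) :
  (forall x u y v, x \in A -> u \in A -> y \in B -> v \in B ->
     M x y -> M u y -> M u v -> M x v) ->
  (forall x y, x \in A -> y \in B -> M x y ->
     #|[set u in A | M u y]| = #|[set v in B | M x v]|) ->
  (forall x, x \in A -> exists2 y, y \in B & M x y) ->
  (forall y, y \in B -> exists2 x, x \in A & M x y) ->
  exists f, bij_on A B f /\ {in A, forall x, M x (f x)}.
Proof.
have [n] := ubnP #|A|; elim: n A B => // n IH A B /ltnSE leAn dif cnt totA totB.
have [/eqP A0|/set0Pn [x xA]] := boolP (A == set0).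
  exists (fun=> w0); split; last by move=> x; rewrite A0 inE.
  split=> [x y|]; first by rewrite A0 inE.
  rewrite A0 imset0; apply/esym/eqP; rewrite -subset0; apply/subsetP => y yB.
  by have [x] := totB _ yB; rewrite A0 inE.
have [y yB Mxy] := totA _ xA.
have setD1s (T : finType) (C : {set T}) (p : pred T) z :
    [set u in C :\ z | p u] = [set u in C | p u] :\ z.
  by apply/setP => u; rewrite !inE andbA.
have cnt' u v : u \in A :\ x -> v \in B :\ y -> M u v ->
    #|[set w in A :\ x | M w v]| = #|[set w in B :\ y | M u w]|.
  rewrite !inE => /andP[_ uA] /andP[_ vB] Muv; rewrite !setD1s.
  have h1 := cardsD1 x [set w in A | M w v]; have h2 := cardsD1 y [set w in B | M u w].
  have h3 := cnt _ _ uA vB Muv; rewrite !inE xA yB /= in h1 h2.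
  have e : M x v = M u y.
    by apply/idP/idP => h; [apply: (dif u x v y) | apply: (dif x u y v)].
  by move: h3; rewrite h1 h2 e => /addnI.
case: (IH (A :\ x) (B :\ y)).
- by move: leAn; rewrite (cardsD1 x A) xA.
- by move=> ? ? ? ? /setD1P[_ ?] /setD1P[_ ?] /setD1P[_ ?] /setD1P[_ ?]; apply: dif.
- exact: cnt'.
- move=> u /setD1P[ux uA]; have [v vB Muv] := totA _ uA.
  (* If the partner found is the removed [y], then [x] and [u] lie in its biclique, so by balance
     the other side has a second vertex for [u]. *)
  have [vy|] := eqVneq v y; last by move=> vy; exists v => //; rewrite !inE vy.
  subst v; have h := cnt _ _ uA yB Muv.
  have : 1 < #|[set v in B | M u v]|.
    rewrite -h; apply/card_gt1P; exists x, u; rewrite !inE ?xA ?uA //; split=> //.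
    by rewrite eq_sym.
  case/card_gt1P => a [b []]; rewrite !inE => /andP[aB Ma] /andP[bB Mb] ab.
  have [ay|ay] := eqVneq a y; last by exists a => //; rewrite !inE ay.
  by exists b => //; rewrite !inE bB andbT -ay eq_sym.
- move=> v /setD1P[vy vB]; have [u uA Muv] := totB _ vB.
  have [ux|] := eqVneq u x; last by move=> ux; exists u => //; rewrite !inE ux.
  subst u; have h := cnt _ _ uA vB Muv.
  have : 1 < #|[set w in A | M w v]|.
    rewrite h; apply/card_gt1P; exists y, v; rewrite !inE ?yB ?vB //; split=> //.
    by rewrite eq_sym.
  case/card_gt1P => a [b []]; rewrite !inE => /andP[aB Ma] /andP[bB Mb] ab.
  have [ay|ay] := eqVneq a x; last by exists a => //; rewrite !inE ay.
  by exists b => //; rewrite !inE bB andbT -ay eq_sym.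
move=> f [[finj fim] fM]; exists (fun u => if u == x then y else f u); split; last first.
  by move=> u uA; case: eqP => [->//|/eqP ux]; apply: fM; rewrite !inE ux.
have fy u : u \in A -> u != x -> f u != y.
  move=> uA ux; have : f u \in B :\ y by rewrite -fim imset_f // !inE ux.
  by rewrite !inE => /andP[].
split.
  move=> u v uA vA; case: (eqVneq u x) => ux; case: (eqVneq v x) => vx.
  - by rewrite ux vx.
  - by move=> /esym /eqP; rewrite (negPf (fy _ vA vx)).
  - by move=> /eqP; rewrite (negPf (fy _ uA ux)).
  - by apply: finj; rewrite !inE ?ux ?vx.
apply/setP => v; apply/imsetP/idP => [[u uA ->]|vB].
  case: eqP => // /eqP ux.
  have : f u \in B :\ y by rewrite -fim imset_f // !inE ux.
  by rewrite !inE => /andP[].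
have [->|vy] := eqVneq v y; first by exists x => //; rewrite eqxx.
have : v \in f @: (A :\ x) by rewrite fim !inE vy.
case/imsetP => u; rewrite !inE => /andP[ux uA] ->; exists u => //.
by rewrite (negPf ux).
Qed.

Lemma bij_on_card A B f : bij_on A B f -> #|A| = #|B|.
Proof. by case=> fi <-; rewrite card_in_imset. Qed.

End Matching.

(** * Bijective pebble games as relations between tuples *)

Section Bisim.
Variables (U W : finType) (e : rel U) (e' : rel W).

(* [E xs ys] reads: the pebbles [xs] in the first graph and [ys] in the second
   form a position from which Duplicator survives in the bijective k-pebble game. *)
Record bisim (k : nat) (A : {set U}) (B : {set W}) (E : seq U -> seq W -> Prop) : Prop := Bisim {
  bs_size : forall xs ys, E xs ys -> size xs = size ys;
  bs_le : forall xs ys, E xs ys -> size xs <= k;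
  bs_inl : forall xs ys, E xs ys -> {subset xs <= A};
  bs_inr : forall xs ys, E xs ys -> {subset ys <= B};
  bs_atom : forall x y x' y', E [:: x; y] [:: x'; y'] ->
    (x == y) = (x' == y') /\ e x y = e' x' y';
  bs_ext : forall xs ys, E xs ys -> size xs < k ->
    exists2 f, bij_on A B f & {in A, forall v, E (v :: xs) (f v :: ys)};
  bs_sub : forall xs ys, E xs ys -> forall x0 y0 (s : seq nat),
    all (fun i => i < size xs) s -> size s <= size xs ->
    E [seq nth x0 xs i | i <- s] [seq nth y0 ys i | i <- s];
  bs_dif : forall xs ys us vs, E xs ys -> E us ys -> E us vs -> E xs vs }.

(** The last clause keeps track of types; gluing along a quotient relies on it. *)
Definition iso_on (A : {set U}) (B : {set W}) (E : seq U -> seq W -> Prop) :=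
  exists f, [/\ bij_on A B f, {in A &, forall x y, e x y = e' (f x) (f y)}
    & {in A, forall x, E [:: x] [:: f x]}].

Lemma iso_on_weaken A B (E E0 : seq U -> seq W -> Prop) :
  (forall x y, E0 [:: x] [:: y] -> E [:: x] [:: y]) -> iso_on A B E0 -> iso_on A B E.
Proof. by move=> h [f [fb fe fE]]; exists f; split=> // x /fE /h. Qed.

Section Theory.
Variables (k : nat) (A : {set U}) (B : {set W}) (E : seq U -> seq W -> Prop).
Hypothesis bE : bisim k A B E.

Lemma bs_forth xs ys x : E xs ys -> size xs < k -> x \in A ->
  exists2 y, y \in B & E (x :: xs) (y :: ys).
Proof.
move=> Exy lt xA; have [f fb fE] := bs_ext bE Exy lt.
by exists (f x); [apply: bij_on_mem fb _ | apply: fE].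
Qed.

Lemma bs_back xs ys y : E xs ys -> size xs < k -> y \in B ->
  exists2 x, x \in A & E (x :: xs) (y :: ys).
Proof.
move=> Exy lt yB; have [f fb fE] := bs_ext bE Exy lt.
by have [x xA ->] := bij_on_surj fb yB; exists x => //; apply: fE.
Qed.

Lemma bs_nil xs ys : E xs ys -> E [::] [::].
Proof.
case: xs => [|x xs]; case: ys => [|y ys] h //; try by move: (bs_size bE h).
exact: (bs_sub bE h x y (s := [::])).
Qed.

Lemma bs_head x xs y ys : E (x :: xs) (y :: ys) -> E [:: x] [:: y].
Proof. by move=> h; apply: (bs_sub bE h x y (s := [:: 0])). Qed.

Lemma bs_tl x xs y ys : E (x :: xs) (y :: ys) -> E xs ys.
Proof.
move=> h; have sz : size xs = size ys by case: (bs_size bE h).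
have := bs_sub bE h x y (s := iota 1 (size xs)).
rewrite size_iota leqnSn => /(_ _ isT).
have -> : [seq nth x (x :: xs) i | i <- iota 1 (size xs)] = xs.
  by rewrite (iotaDl 1 0) -map_comp /= -/(mkseq _ _) mkseq_nth.
have -> : [seq nth y (y :: ys) i | i <- iota 1 (size xs)] = ys.
  by rewrite sz (iotaDl 1 0) -map_comp /= -/(mkseq _ _) mkseq_nth.
by apply; apply/allP => i; rewrite mem_iota add1n ltnS => /andP[].
Qed.

Lemma bs_mem x y : E [:: x] [:: y] -> x \in A /\ y \in B.
Proof. by move=> h; rewrite (bs_inl bE h) ?(bs_inr bE h) ?mem_head. Qed.

End Theory.
End Bisim.

(** * Classes and representatives of an equivalence on a set *)

Section Classes.
Variables (U : finType) (A : {set U}) (R : rel U).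

Record equiv_on : Prop := EquivOn {
  eq_refl_on : {in A, forall x, R x x};
  eq_sym_on : {in A &, forall x y, R x y -> R y x};
  eq_trans_on : {in A & &, forall y x z, R x y -> R y z -> R x z} }.

Definition cls (x : U) := [set y in A | R x y].
(** The choice depends only on the class as a set, so related elements get the same representative.
    For [x] in [A] reflexivity ensures that the default is not reached. *)
Definition rep (x : U) := odflt x [pick y in A | R x y].
Definition reps := [set x in A | rep x == x].

Hypothesis Req : equiv_on.

Lemma rep_in x : x \in A -> rep x \in A.
Proof. by rewrite /rep; case: pickP => [y /andP[]|]. Qed.

Lemma rep_rel x : x \in A -> R x (rep x).
Proof.
move=> xA; rewrite /rep; case: pickP => [y /andP[]//|/(_ x)].
by rewrite /= xA eq_refl_on.
Qed.

Lemma cls_eq x y : x \in A -> y \in A -> R x y -> cls x = cls y.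
Proof.
move=> xA yA Rxy; have Ryx := eq_sym_on Req xA yA Rxy.
apply/setP => z; rewrite !inE; case zA : (z \in A) => //=.
by apply/idP/idP; apply: eq_trans_on.
Qed.

Lemma rep_eq x y : x \in A -> y \in A -> R x y -> rep x = rep y.
Proof.
move=> xA yA Rxy; rewrite /rep.
have e : [pick z in A | R x z] = [pick z in A | R y z].
  by apply: eq_pick => z; move/setP: (cls_eq xA yA Rxy) => /(_ z); rewrite !inE.
rewrite e; case: pickP => //= /(_ y); by rewrite /= yA eq_refl_on.
Qed.

Lemma rep_reps x : x \in A -> rep x \in reps.
Proof.
move=> xA; rewrite inE rep_in //=; apply/eqP/esym/rep_eq => //; first exact: rep_in.
exact: rep_rel.
Qed.

Lemma repsW x : x \in reps -> x \in A.
Proof. by rewrite inE => /andP[]. Qed.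

Lemma rep_id x : x \in reps -> rep x = x.
Proof. by rewrite inE => /andP[_ /eqP]. Qed.

Lemma rel_rep x y : x \in A -> y \in reps -> R x y -> rep x = y.
Proof. by move=> xA yr /rep_eq -> //; [apply: rep_id | apply: repsW]. Qed.

Lemma cls_mem x : x \in A -> x \in cls x.
Proof. by move=> xA; rewrite inE xA eq_refl_on. Qed.

(** Every class meets [S] in [c] elements or not at all; [S] is the disjoint union of these
    traces. *)
Lemma card_cls_sum (S : {set U}) c : S \subset A ->
  {in S, forall v, #|[set w in S | R v w]| = c} ->
  #|S| = #|[set u in reps | [exists v in S, R u v]]| * c.
Proof.
move=> /subsetP SA Sc; rewrite -sum1_card.
rewrite (partition_big rep (mem [set u in reps | [exists v in S, R u v]])) /=; last first.
  move=> v vS; have vA := SA _ vS; rewrite inE rep_reps //; apply/existsP; exists v.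
  rewrite vS /=; apply: (eq_sym_on Req) => //; [exact: rep_in | exact: rep_rel].
rewrite -sum_nat_const; apply: eq_bigr => u; rewrite inE => /andP[ur /existsP[v /andP[vS Ruv]]].
have uA := repsW ur; have vA := SA _ vS.
rewrite -(Sc v vS) -sum1_card; apply: eq_bigl => w; rewrite inE.
case wS : (w \in S) => //=; have wA := SA _ wS.
apply/eqP/idP => [wu|Rvw].
  have := rep_rel wA; rewrite wu => Rwu.
  exact: (eq_trans_on Req uA vA wA (eq_sym_on Req uA vA Ruv) (eq_sym_on Req wA uA Rwu)).
apply: rel_rep => //; apply: (eq_sym_on Req) => //.
exact: (eq_trans_on Req vA uA wA Ruv Rvw).
Qed.

End Classes.

(** * The induced game of a graph with itself; fixing pebbles *)

Section Self.
Variables (U W : finType) (e : rel U) (e' : rel W).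
Variables (k : nat) (A : {set U}) (B : {set W}) (E : seq U -> seq W -> Prop).

(** By difunctionality, tuples that share one answer share all of them, so this is an equivalence on
    the tuples that have an answer. *)
Definition selfE (xs us : seq U) := exists2 ys, E xs ys & E us ys.

Hypothesis bE : bisim e e' k A B E.

Lemma selfE_sym xs us : selfE xs us -> selfE us xs.
Proof. by case=> ys; exists ys. Qed.

Lemma bs_trans xs us ys : selfE xs us -> E us ys -> E xs ys.
Proof. by case=> zs Ex Eu Ey; apply: (bs_dif bE Ex Eu Ey). Qed.

(** Two tuples with a common answer are extended by one bijection of Duplicator followed by the
    inverse of another. *)
Lemma bisim_self : bisim e e k A A selfE.
Proof.
split.
- by move=> xs us [ys /(bs_size bE) -> /(bs_size bE) ->].
- by move=> xs us [ys /(bs_le bE)].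
- by move=> xs us [ys /(bs_inl bE)].
- by move=> xs us [ys _ /(bs_inl bE)].
- move=> x y u v [ys E1 E2]; have := bs_size bE E1; case: ys E1 E2 => [|a [|b [|c ys]]] //.
  by move=> /(bs_atom bE)[-> ->] /(bs_atom bE)[-> ->].
- move=> xs us [ys E1 E2] lt.
  have [f fb fE] := bs_ext bE E1 lt; have lt' := lt.
  rewrite (bs_size bE E1) -(bs_size bE E2) in lt'.
  have [g gb gE] := bs_ext bE E2 lt'.
  pose h v := odflt v [pick w in A | g w == f v].
  have hP v : v \in A -> h v \in A /\ g (h v) = f v.
    move=> vA; rewrite /h; case: pickP => [w /andP[-> /eqP ->]//|no].
    have [w wA fw] := bij_on_surj gb (bij_on_mem fb vA).
    by move: (no w); rewrite /= wA fw eqxx.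
  have hinj : {in A &, injective h}.
    move=> v w vA wA /(congr1 g); rewrite (hP v vA).2 (hP w wA).2; exact: fb.1.
  exists h; last first.
    move=> v vA; exists (f v :: ys); first exact: fE.
    by rewrite -(hP v vA).2; apply: gE; apply: (hP v vA).1.
  split=> //; apply/eqP; rewrite eqEcard card_in_imset // leqnn andbT.
  by apply/subsetP => _ /imsetP[v vA ->]; apply: (hP v vA).1.
- move=> xs us [ys E1 E2] x0 u0 s sa ss.
  case: ys E1 E2 => [|y ys] E1 E2.
    move: (bs_size bE E1) (bs_size bE E2); case: xs E1 sa ss => // E1 sa; case: s sa => // _ _ _.
    by case: us E2 => // E2 _; exists [::].
  exists [seq nth y (y :: ys) i | i <- s]; first exact: (bs_sub bE).
  by apply: (bs_sub bE); rewrite // (bs_size bE E2) -(bs_size bE E1).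
- move=> xs a us vs [y E1 E2] [z E3 E4] [t E5 E6]; exists t => //.
  exact: (bs_dif bE (bs_dif bE E1 E2 E4) E3 E5).
Qed.

Lemma bs_dom xs : E [::] [::] -> size xs <= k -> {subset xs <= A} ->
  exists ys, E xs ys.
Proof.
move=> E0; elim: xs => [|x xs IH] ss sub; first by exists [::].
case: IH => [||ys Exy]; [exact: ltnW | by move=> z zx; apply: sub; rewrite inE zx orbT |].
have [y yB Ey] := bs_forth bE Exy ss (sub _ (mem_head _ _)).
by exists (y :: ys).
Qed.

Lemma selfE_refl xs : E [::] [::] -> size xs <= k -> {subset xs <= A} -> selfE xs xs.
Proof. by move=> E0 ss sub; have [ys Exy] := bs_dom E0 ss sub; exists ys. Qed.

(** Pebbles left on [ps] and [qs] for good individualize these vertices; the remaining pebbles still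
    play a game. *)
Lemma bisim_params ps qs : E ps qs ->
  bisim e e' (k - size ps) A B (fun xs ys => E (xs ++ ps) (ys ++ qs)).
Proof.
move=> Epq; have szp := bs_size bE Epq.
have szs xs ys : E (xs ++ ps) (ys ++ qs) -> size xs = size ys.
  by move=> /(bs_size bE); rewrite !size_cat szp => /addIn.
have sub xs ys : E (xs ++ ps) (ys ++ qs) -> forall x0 y0 s,
    all (fun i => i < size xs) s -> size s <= size xs ->
    E ([seq nth x0 xs i | i <- s] ++ ps) ([seq nth y0 ys i | i <- s] ++ qs).
  move=> h x0 y0 s sa ss.
  have := bs_sub bE h x0 y0 (s := s ++ iota (size xs) (size ps)).
  rewrite !map_cat [size (s ++ _)]size_cat size_iota [size (xs ++ _)]size_cat leq_add2r ss all_cat.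
  have -> : all (fun i => i < size xs + size ps) s.
    by apply/allP => i /(allP sa) /leq_trans; apply; apply: leq_addr.
  have -> : all (fun i => i < size xs + size ps) (iota (size xs) (size ps)).
    by apply/allP => i; rewrite mem_iota => /andP[].
  move=> /(_ isT isT).
  have -> : [seq nth x0 (xs ++ ps) i | i <- s] = [seq nth x0 xs i | i <- s].
    by apply/eq_in_map => i /(allP sa) lt; rewrite nth_cat lt.
  have -> : [seq nth y0 (ys ++ qs) i | i <- s] = [seq nth y0 ys i | i <- s].
    by apply/eq_in_map => i /(allP sa) lt; rewrite nth_cat -(szs _ _ h) lt.
  have -> : iota (size xs) (size ps) = [seq size xs + i | i <- iota 0 (size ps)].
    by rewrite -iotaDl addn0.
  rewrite -!map_comp.
  have shift (T : Type) (z0 : T) s1 s2 m : size s1 = m ->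
      [seq nth z0 (s1 ++ s2) (m + i) | i <- iota 0 (size s2)] = s2.
    move=> <-; rewrite -{3}(mkseq_nth z0 s2); apply: eq_map => i.
    by rewrite nth_cat ltnNge leq_addr /= addKn.
  by rewrite [map (_ \o _) _](shift _ x0) // szp [map (_ \o _) _](shift _ y0) // (szs _ _ h).
split=> //.
- by move=> xs ys /(bs_le bE); rewrite size_cat => h; rewrite leq_subRL ?(leq_trans _ h) ?leq_addl // addnC.
- by move=> xs ys /(bs_inl bE) h x xx; apply: h; rewrite mem_cat xx.
- by move=> xs ys /(bs_inr bE) h x xx; apply: h; rewrite mem_cat xx.
- move=> x y x' y' h; apply: (bs_atom bE).
  by have := bs_sub bE h x x' (s := [:: 0; 1]); apply.
- move=> xs ys h lt; case: (bs_ext bE h) => [|f fb fE].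
    by rewrite size_cat addnC -ltn_subRL.
  by exists f.
- by move=> xs ys us vs; apply: (bs_dif bE).
Qed.

End Self.

(** * Invariant equivalences, their transfer to the other graph and the matching of their classes *)

Section Gluing.
Variables (U W : finType) (e : rel U) (e' : rel W).
Variables (k : nat) (A : {set U}) (B : {set W}) (E : seq U -> seq W -> Prop).
Hypotheses (bE : bisim e e' k A B E) (k3 : 3 <= k) (E0 : E [::] [::]).
Variable R : rel U.
Hypothesis Req : equiv_on A R.
Hypothesis Rinv : forall x y u v, selfE E [:: x; y] [:: u; v] -> R x y -> R u v.

(** The copy of [R] in the second graph, read off any pair answered by the given one; by invariance
    all such pairs agree. *)
Definition trel (x' y' : W) : bool := `[< exists x y, E [:: x; y] [:: x'; y'] /\ R x y >].

Local Notation R' := trel.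

Lemma trelE x y x' y' : E [:: x; y] [:: x'; y'] -> R' x' y' = R x y.
Proof.
move=> h; apply/asboolP/idP => [[u [v [h2 Ruv]]]|Rxy]; last by exists x, y.
by apply: Rinv Ruv; exists [:: x'; y'].
Qed.

Lemma bs_swap x y x' y' xs ys : E [:: x, y & xs] [:: x', y' & ys] -> E [:: y; x] [:: y'; x'].
Proof. by move=> h; have := bs_sub bE h x x' (s := [:: 1; 0]); apply. Qed.

Lemma bs_two x y x' y' xs ys : E [:: x, y & xs] [:: x', y' & ys] -> E [:: x; y] [:: x'; y'].
Proof. by move=> h; have := bs_sub bE h x x' (s := [:: 0; 1]); apply. Qed.

Let lt0 : size ([::] : seq U) < k. Proof. exact: leq_trans k3. Qed.
Let lt1 (x : U) : size [:: x] < k. Proof. exact: leq_trans k3. Qed.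

Lemma bs_pull2 x' y' : x' \in B -> y' \in B -> exists x y, E [:: x; y] [:: x'; y'].
Proof.
move=> xB yB; have [y yA Ey] := bs_back bE E0 lt0 yB.
by have [x xA Ex] := bs_back bE Ey (lt1 y) xB; exists x, y.
Qed.

Lemma trel_equiv : equiv_on B R'.
Proof.
split.
- move=> x' xB; have [x [y h]] := bs_pull2 xB xB; rewrite (trelE h).
  have h1 := (bs_atom bE h).1; rewrite eqxx in h1; move/eqP: h1 => <-.
  by apply: (eq_refl_on Req); apply: (bs_inl bE h); rewrite mem_head.
- move=> x' y' xB yB; have [x [y h]] := bs_pull2 xB yB.
  rewrite (trelE h) (trelE (bs_swap h)); apply: (eq_sym_on Req);
    by apply: (bs_inl bE h); rewrite !inE ?eqxx ?orbT.
- move=> y' x' z' yB xB zB; have [x [y h]] := bs_pull2 xB yB.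
  have [z zA hz] := bs_back bE h k3 zB.
  rewrite (trelE h).
  have -> : R' y' z' = R y z.
    by apply: trelE; have := bs_sub bE hz x x' (s := [:: 2; 0]); apply.
  have -> : R' x' z' = R x z.
    by apply: trelE; have := bs_sub bE hz x x' (s := [:: 1; 0]); apply.
  by apply: (eq_trans_on Req) => //; apply: (bs_inl bE h); rewrite !inE ?eqxx ?orbT.
Qed.

(** A pebble inside the class is [R]-related to exactly the vertices of the class, so Duplicator's
    bijection maps the class onto the paired one. On an empty board the bijection is borrowed from
    the position [x0], [x0']. *)
Lemma bisim_restrict x0 x0' : E [:: x0] [:: x0'] ->
  bisim e e' k (cls A R x0) (cls B R' x0') (fun xs ys =>
    [/\ E xs ys, {subset xs <= cls A R x0} & {subset ys <= cls B R' x0'}]).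
Proof.
move=> Ex0; have [x0A x0B] := bs_mem bE Ex0.
have R'eq := trel_equiv.
split.
- by move=> xs ys [/(bs_size bE)].
- by move=> xs ys [/(bs_le bE)].
- by move=> xs ys [].
- by move=> xs ys [].
- by move=> x y x' y' [/(bs_atom bE)].
- move=> xs ys [Exy sx sy] lt.
  suff [f [fb fE fR]] : exists f, [/\ bij_on A B f,
      {in A, forall v, E (v :: xs) (f v :: ys)} & {in A, forall v, R x0 v = R' x0' (f v)}].
    have fc v : v \in A -> (f v \in cls B R' x0') = (v \in cls A R x0).
      by move=> vA; rewrite !inE vA (bij_on_mem fb vA) -fR.
    exists f; last first.
      move=> v vc; have vA : v \in A by move: vc; rewrite inE => /andP[].
      split; [exact: fE | by move=> z; rewrite inE => /orP[/eqP -> //|/sx] |].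
      by move=> z; rewrite inE => /orP[/eqP ->|/sy //]; rewrite fc.
    split; first by move=> v w; rewrite !inE => /andP[vA _] /andP[wA _]; apply: fb.1.
    apply/setP => z; apply/imsetP/idP => [[v vc ->]|zc].
      by rewrite fc //; move: vc; rewrite inE => /andP[].
    have zB : z \in B by move: zc; rewrite inE => /andP[].
    by have [v vA zv] := bij_on_surj fb zB; exists v => //; rewrite -fc -?zv.
  case: xs Exy sx lt => [|x1 xs] Exy sx lt; last case: ys Exy sy => [|x1' ys] Exy sy.
  - have [f fb fE] := bs_ext bE Ex0 (lt1 x0); exists f; split=> // v vA.
      by have := bs_size bE Exy; case: ys {Exy sy} => // _; apply: (bs_head bE (fE v vA)).
    by rewrite (trelE (bs_swap (fE v vA))).
  - by have := bs_size bE Exy.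
  have [f fb fE] := bs_ext bE Exy lt; exists f; split=> // v vA.
  have := sx _ (mem_head _ _); have := sy _ (mem_head _ _).
  rewrite !inE => /andP[x1B R01'] /andP[x1A R01].
  have h : R' x1' (f v) = R x1 v by apply: trelE; apply: bs_swap (fE v vA).
  have fvB := bij_on_mem fb vA.
  have := cls_eq Req x0A x1A R01 => /setP /(_ v); rewrite !inE vA /= => ->.
  have := cls_eq R'eq x0B x1B R01' => /setP /(_ (f v)); rewrite !inE fvB /= => ->.
  by rewrite h.
- move=> xs ys [Exy sx sy] u0 v0 s sa ss; split; first exact: (bs_sub bE).
    by move=> z /mapP[i /(allP sa) lt ->]; apply/sx/mem_nth.
  by move=> z /mapP[i /(allP sa) lt ->]; apply/sy/mem_nth; rewrite -(bs_size bE Exy).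
- move=> xs ys us vs [E1 h1 h2] [E2 h3 h4] [E3 h5 h6]; split=> //; exact: (bs_dif bE E1 E2 E3).
Qed.

(** Relate two classes when they contain vertices that can be pebbled against each other. This
    relation is difunctional. It is balanced by a count of vertices: the vertices answered by a
    fixed [v0'] are as many as the answers of [v0], and a class containing one of them contains the
    same number [c] of them, on either side; dividing by [c] counts classes. Two free pebbles are
    needed to compare a vertex with another one of its class. *)
Lemma class_matching xs ys : E xs ys -> size xs + 2 <= k ->
  exists f, bij_on (reps A R) (reps B R') f /\
    {in reps A R, forall x, exists v v',
       [/\ v \in A, R x v, v' \in B, R' (f x) v' & E (v :: xs) (v' :: ys)]}.
Proof.
move=> Exy lk.
have ltx : size xs < k by apply: leq_trans lk; rewrite addn2.
have lt2 v : size (v :: xs) < k by apply: leq_trans lk; rewrite addn2.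
have R'eq := trel_equiv.
pose M x x' := `[< exists v v',
  [/\ v \in A, R x v, v' \in B, R' x' v' & E (v :: xs) (v' :: ys)] >].
have swap v w v' w' : E [:: v, w & xs] [:: v', w' & ys] -> E (v :: xs) (v' :: ys).
  move=> h; have := bs_sub bE h v v' (s := 0 :: iota 2 (size xs)) => /=.
  rewrite !ltnS size_iota leqnSn.
  have nth2 (T : Type) (z0 a b : T) s : [seq nth z0 [:: a, b & s] i | i <- iota 2 (size s)] = s.
    by rewrite (iotaDl 2 0) -map_comp -[RHS](mkseq_nth z0 s); apply: eq_map.
  rewrite nth2 (bs_size bE Exy) nth2; apply=> //.
  by apply/allP => i; rewrite mem_iota => /andP[_].
have addl v v' w : E (v :: xs) (v' :: ys) -> w \in A -> R v w ->
    exists w', [/\ w' \in B, R' v' w' & E (w :: xs) (w' :: ys)].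
  move=> h wA Rvw; have [w' w'B hw] := bs_forth bE h (lt2 v) wA.
  by exists w'; rewrite (trelE (bs_swap hw)); split=> //; apply: swap hw.
have addr v v' w' : E (v :: xs) (v' :: ys) -> w' \in B -> R' v' w' ->
    exists w, [/\ w \in A, R v w & E (w :: xs) (w' :: ys)].
  move=> h wA Rvw; have [w w'B hw] := bs_back bE h (lt2 v) wA.
  by exists w; rewrite -(trelE (bs_swap hw)); split=> //; apply: swap hw.
have inA v v' : E (v :: xs) (v' :: ys) -> v \in A by move/(bs_inl bE); apply; apply: mem_head.
have inB v v' : E (v :: xs) (v' :: ys) -> v' \in B by move/(bs_inr bE); apply; apply: mem_head.
have Rs x y : x \in A -> y \in A -> R x y -> R y x := @eq_sym_on _ _ _ Req x y.
have R's x y : x \in B -> y \in B -> R' x y -> R' y x := @eq_sym_on _ _ _ R'eq x y.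
have Rt x y z : x \in A -> y \in A -> z \in A -> R x y -> R y z -> R x z.
  by move=> xA yA zA; apply: (eq_trans_on Req).
have R't x y z : x \in B -> y \in B -> z \in B -> R' x y -> R' y z -> R' x z.
  by move=> xA yA zA; apply: (eq_trans_on R'eq).
have Mat x x' v v' : x \in A -> x' \in B -> M x x' -> E (v :: xs) (v' :: ys) -> R' x' v' ->
    exists w, [/\ w \in A, R x w & E (w :: xs) (v' :: ys)].
  move=> xA xB /asboolP[w [w' [wA Rxw wB Rxw' Ew]]] Ev Rxv.
  have vB := inB _ _ Ev.
  have [|u [uA Rwu Eu]] := addr _ _ v' Ew vB.
    by apply: (R't _ x') => //; apply: R's.
  by exists u; split=> //; apply: (Rt _ w).
have Mat' x x' v v' : x \in A -> x' \in B -> M x x' -> E (v :: xs) (v' :: ys) -> R x v ->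
    exists w', [/\ w' \in B, R' x' w' & E (v :: xs) (w' :: ys)].
  move=> xA xB /asboolP[w [w' [wA Rxw wB Rxw' Ew]]] Ev Rxv.
  have vA := inA _ _ Ev.
  have [|u [uA Rwu Eu]] := addl _ _ v Ew vA.
    by apply: (Rt _ x) => //; apply: Rs.
  by exists u; split=> //; apply: (R't _ w').
have [f0 f0b f0E] := bs_ext bE Exy ltx.
have [[x xr]|A0] := pselect (exists x, x \in reps A R); last first.
  exists f0; split; last by move=> x xr; case: A0; exists x.
  split; first by move=> x y xr; case: A0; exists x.
  apply/setP => y; apply/imsetP/idP => [[x xr]|yr]; first by case: A0; exists x.
  have yB := repsW yr; have [x xA _] := bs_back bE Exy ltx yB.
  by case: A0; exists (rep A R x); apply: rep_reps.
have [||||f [fb fM]] := @difunctional_matching _ _ (f0 x) M (reps A R) (reps B R').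
- move=> x1 u1 y1 v1 /repsW xA /repsW uA /repsW yB /repsW vB Mxy Muy Muv.
  case/asboolP: (Mxy) => [v [v' [vA Rxv vB' Rxv' Ev]]].
  have [w [wA Ruw Ew]] := Mat _ _ _ _ uA yB Muy Ev Rxv'.
  have [w' [wB Rw' Ew']] := Mat' _ _ _ _ uA vB Muv Ew Ruw.
  by apply/asboolP; exists v, w'; split=> //; apply: (bs_dif bE Ev Ew Ew').
- move=> x1 y1 /repsW xA /repsW yB Mxy.
  case/asboolP: (Mxy) => [v0 [v0' [vA Rxv vB Rxv' Ev]]].
  (* [S] collects the vertices answered by [v0'], and [S'] the answers of [v0]; the bijection [f0]
     maps one onto the other. *)
  pose S := [set v in A | `[< E (v :: xs) (v0' :: ys) >]].
  pose S' := [set v' in B | `[< E (v0 :: xs) (v' :: ys) >]].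
  have cSS : #|S| = #|S'|.
    have <- : f0 @: S = S'.
      apply/setP => z; apply/imsetP/idP => [[v]|].
        rewrite !inE => /andP[vA' /asboolP Ev2] ->; rewrite (bij_on_mem f0b vA') /=.
        apply/asboolP; exact: (bs_dif bE Ev Ev2 (f0E _ vA')).
      rewrite inE => /andP[zB /asboolP Ez].
      have [v vA' zv] := bij_on_surj f0b zB; exists v => //; rewrite inE vA' /=.
      by apply/asboolP; apply: (bs_dif bE (f0E _ vA') _ Ev); rewrite -zv.
    rewrite card_in_imset // => v w; rewrite !inE => /andP[? _] /andP[? _]; exact: f0b.1.
  (* The same comparison inside the two classes, through the bijection played once [v] and [v'] are
     pebbled. *)
  have cc v v' : E (v :: xs) (v' :: ys) ->
      #|[set w in A | R v w && `[< E (w :: xs) (v' :: ys) >]]| =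
      #|[set w in B | R' v' w && `[< E (v :: xs) (w :: ys) >]]|.
    move=> Evv; have [g gb gE] := bs_ext bE Evv (lt2 v).
    have gR w : w \in A -> R' v' (g w) = R v w.
      by move=> wA; rewrite (trelE (bs_swap (gE w wA))).
    have <- : g @: [set w in A | R v w && `[< E (w :: xs) (v' :: ys) >]] =
        [set w in B | R' v' w && `[< E (v :: xs) (w :: ys) >]].
      apply/setP => z; apply/imsetP/idP => [[w]|].
        rewrite !inE => /and3P[wA Rvw /asboolP Ew] ->; rewrite (bij_on_mem gb wA) gR // Rvw /=.
        apply/asboolP; exact: (bs_dif bE Evv Ew (swap _ _ _ _ (gE _ wA))).
      rewrite inE => /and3P[zB Rz /asboolP Ez].
      have [w wA zw] := bij_on_surj gb zB; exists w => //.
      rewrite inE wA -gR // -zw Rz /=; apply/asboolP.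
      by apply: (bs_dif bE (swap _ _ _ _ (gE _ wA)) _ Evv); rewrite -zw.
    rewrite card_in_imset // => u w; rewrite !inE => /andP[? _] /andP[? _]; exact: gb.1.
  pose c := #|[set w in A | R v0 w && `[< E (w :: xs) (v0' :: ys) >]]|.
  have cS v : v \in S -> #|[set w in S | R v w]| = c.
    rewrite inE => /andP[vA' /asboolP Ev2].
    transitivity #|[set w in A | R v w && `[< E (w :: xs) (v0' :: ys) >]]|.
      by apply: eq_card => w; rewrite !inE -andbA [R v w && _]andbC.
    rewrite /c !cc //; apply: eq_card => w; rewrite !inE; congr (_ && (_ && _)).
    by apply/asboolP/asboolP => h; [apply: (bs_dif bE Ev Ev2 h) | apply: (bs_dif bE Ev2 Ev h)].
  have cS' v : v \in S' -> #|[set w in S' | R' v w]| = c.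
    rewrite inE => /andP[vA' /asboolP Ev2].
    transitivity #|[set w in B | R' v w && `[< E (v0 :: xs) (w :: ys) >]]|.
      by apply: eq_card => w; rewrite !inE -andbA [R' v w && _]andbC.
    rewrite /c -!cc //; apply: eq_card => w; rewrite !inE; congr (_ && (_ && _)).
    by apply/asboolP/asboolP => h; [apply: (bs_dif bE h Ev2 Ev) | apply: (bs_dif bE h Ev Ev2)].
  have c0 : 0 < c.
    by apply/card_gt0P; exists v0; rewrite inE vA (eq_refl_on Req) //=; apply/asboolP.
  have SA : S \subset A by apply/subsetP => v; rewrite inE => /andP[].
  have S'B : S' \subset B by apply/subsetP => v; rewrite inE => /andP[].
  have := card_cls_sum Req SA cS; rewrite cSS (card_cls_sum R'eq S'B cS') => /eqP.
  rewrite eqn_pmul2r // => /eqP h.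
  transitivity #|[set u in reps A R | [exists v in S, R u v]]|; last first.
    rewrite -h; apply: eq_card => u; rewrite [LHS]inE [RHS]inE; case ur: (u \in reps _ _) => //=.
    have uB := repsW ur; apply/existsP/idP => [[v /andP[]]|Mxu].
      rewrite inE => /andP[vB' /asboolP Ev2] Ruv.
      by apply/asboolP; exists v0, v.
    have [w [wB Rw Ew]] := Mat' _ _ _ _ xA uB Mxu Ev Rxv.
    by exists w; rewrite inE wB Rw andbT /=; apply/asboolP.
  apply: eq_card => u; rewrite [LHS]inE [RHS]inE; case ur: (u \in reps _ _) => //=.
  have uA := repsW ur; apply/idP/existsP => [Muy|[v /andP[]]].
    have [w [wB Rw Ew]] := Mat _ _ _ _ uA yB Muy Ev Rxv'.
    by exists w; rewrite inE wB Rw andbT /=; apply/asboolP.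
  rewrite inE => /andP[vB' /asboolP Ev2] Ruv.
  by apply/asboolP; exists v, v0'.
- move=> x1 xr'; have xA := repsW xr'; have [y yB Ey] := bs_forth bE Exy ltx xA.
  exists (rep B R' y); first exact: rep_reps.
  apply/asboolP; exists x1, y; split=> //; first exact: (eq_refl_on Req).
  by apply: R's => //; [apply: rep_in | apply: rep_rel].
- move=> y1 yr'; have yB := repsW yr'; have [y yA Ey] := bs_back bE Exy ltx yB.
  exists (rep A R y); first exact: rep_reps.
  apply/asboolP; exists y, y1; split=> //; last exact: (eq_refl_on R'eq).
  by apply: Rs => //; [apply: rep_in | apply: rep_rel].
by exists f; split=> // z zr; apply/asboolP/fM.
Qed.

End Gluing.

(** * Moving pebbles inside classes, gluing isomorphisms and quotients by modules *)

Lemma bij_on_inv (U W : finType) (A : {set U}) (B : {set W}) (f : U -> W) (u0 : W -> U) :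
  bij_on A B f -> exists2 g, bij_on B A g & {in B, forall y, f (g y) = y}.
Proof.
move=> fb; pose g y := odflt (u0 y) [pick x in A | f x == y].
have gP y : y \in B -> g y \in A /\ f (g y) = y.
  move=> yB; rewrite /g; case: pickP => [x /andP[xA /eqP //]|no].
  by have [x xA yx] := bij_on_surj fb yB; move: (no x); rewrite /= xA yx eqxx.
exists g => [|y /gP[]//]; split.
  by move=> y z yB zB /(congr1 f); rewrite (gP y yB).2 (gP z zB).2.
apply/setP => x; apply/imsetP/idP => [[y yB ->]|xA]; first exact: (gP y yB).1.
have fxB := bij_on_mem fb xA; exists (f x) => //.
by apply: fb.1 => //; rewrite ?(gP _ fxB).1 ?(gP _ fxB).2.
Qed.

Lemma bisim_flip (U W : finType) (e : rel U) (e' : rel W) k A B E (u0 : W -> U) :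
  bisim e e' k A B E -> bisim e' e k B A (fun ys xs => E xs ys).
Proof.
move=> bE; split.
- by move=> ys xs /(bs_size bE).
- by move=> ys xs h; rewrite -(bs_size bE h) (bs_le bE h).
- by move=> ys xs /(bs_inr bE).
- by move=> ys xs /(bs_inl bE).
- by move=> x y x' y' /(bs_atom bE)[-> ->].
- move=> ys xs h; rewrite -(bs_size bE h) => lt.
  have [f fb fE] := bs_ext bE h lt; have [g gb fg] := bij_on_inv u0 fb.
  by exists g => // y yB; rewrite -{2}(fg y yB); apply: fE; apply: bij_on_mem gb _.
- by move=> ys xs h x0 y0 s; rewrite -(bs_size bE h); apply: (bs_sub bE).
- by move=> ys xs us vs h1 h2 h3; apply: (bs_dif bE h3 h2 h1).
Qed.

(** One pebble is moved at a time: the spare pebble goes to the new vertex of the class, the old one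
    is lifted, and the list is rotated so that moved pebbles gather at its end. *)
Lemma bs_shift (U W : finType) (e : rel U) (e' : rel W) k A B E (R : rel U) (R' : rel W) :
  bisim e e' k A B E ->
  (forall x y x' y', E [:: x; y] [:: x'; y'] -> R' x' y' = R x y) ->
  forall cs ds bs qs ps, size cs = size ds -> E (cs ++ qs) (ds ++ ps) ->
  size (cs ++ qs) < k -> {subset bs <= B} -> all2 R' bs ds ->
  exists2 cs', E (qs ++ cs') (ps ++ bs) & all2 R cs' cs.
Proof.
move=> bE RE; elim=> [|c cs IH] [|d ds] [|b bs] qs ps //=.
  by move=> _ h _ _ _; exists [::]; rewrite ?cats0.
move=> [szs] h lt sb /andP[Rbd al].
have bB : b \in B by apply: sb; rewrite mem_head.
have [c' c'A hc] := bs_back bE h lt bB.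
have szq : size qs = size ps.
  by have := bs_size bE h; rewrite /= !size_cat szs => -[/addnI].
have h2 : E (cs ++ rcons qs c') (ds ++ rcons ps b).
  have := bs_sub bE hc c b (s := rcons (iota 2 (size (cs ++ qs))) 0).
  have sh (T : Type) (z0 x y : T) s : [seq nth z0 [:: x, y & s] i | i <- iota 2 (size s)] = s.
    by rewrite (iotaDl 2 0) -map_comp -[RHS](mkseq_nth z0 s); apply: eq_map.
  rewrite !map_rcons sh.
  have -> : size (cs ++ qs) = size (ds ++ ps) by rewrite !size_cat szs szq.
  rewrite sh -!cats1 !catA /=; apply.
    rewrite all_cat /= andbT; apply/allP => i; rewrite mem_iota => /andP[_].
    by rewrite !size_cat szs szq.
  by rewrite ?size_cat ?size_iota ?size_cat /= szs szq addn1.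
have [||cs' h3 al'] := IH ds bs (rcons qs c') (rcons ps b) szs h2 _ _ al.
- by move: lt; rewrite !size_cat size_rcons addnS.
- by move=> z zb; apply: sb; rewrite inE zb orbT.
exists (c' :: cs'); first by move: h3; rewrite !cat_rcons.
rewrite /= al' andbT -(RE _ _ b d) //.
by have := bs_sub bE hc c b (s := [:: 0; 1]); apply.
Qed.

Section Gluing.
Variables (U W : finType) (e : rel U) (e' : rel W).
Variables (k : nat) (A : {set U}) (B : {set W}) (E : seq U -> seq W -> Prop).
Hypotheses (bE : bisim e e' k A B E) (k3 : 3 <= k) (E0 : E [::] [::]).
Variable R : rel U.
Hypothesis Req : equiv_on A R.
Hypothesis Rinv : forall x y u v, selfE E [:: x; y] [:: u; v] -> R x y -> R u v.

Local Notation R' := (trel E R).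

Let R'eq : equiv_on B R' := trel_equiv bE k3 E0 Req Rinv.

(** On each class use its isomorphism onto the class paired by [h]; pairs across classes are the
    business of [cross]. *)
Lemma glue_classes (h : U -> W) :
  bij_on (reps A R) (reps B R') h ->
  {in reps A R, forall x, exists v v',
     [/\ v \in A, R x v, v' \in B, R' (h x) v' & E [:: v] [:: v']]} ->
  (forall x y x' y', x \in A -> y \in A -> ~~ R x y -> ~~ R' x' y' ->
     E [:: x] [:: x'] -> E [:: y] [:: y'] ->
     R' (h (rep A R x)) x' -> R' (h (rep A R y)) y' -> e x y = e' x' y') ->
  (forall x x', E [:: x] [:: x'] -> iso_on e e' (cls A R x) (cls B R' x') E) ->
  iso_on e e' A B E.
Proof.
move=> hb hM cross ciso.
have hr x : x \in A -> h (rep A R x) \in reps B R'.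
  by move=> xA; apply: bij_on_mem hb _; apply: rep_reps.
have /choice[g gP] : forall x, exists g : U -> W, x \in reps A R ->
   [/\ bij_on (cls A R x) (cls B R' (h x)) g,
       {in cls A R x &, forall u v, e u v = e' (g u) (g v)}
     & {in cls A R x, forall u, E [:: u] [:: g u]}].
  move=> x; case xr: (x \in reps A R); last by exists h.
  have [v [v' [vA Rxv v'B R'v Ev]]] := hM x xr.
  have := ciso _ _ Ev; rewrite -(cls_eq Req (repsW xr) vA Rxv).
  have hxB : h x \in B by apply: repsW (bij_on_mem hb xr).
  by rewrite -(cls_eq R'eq hxB v'B R'v) => -[g gP]; exists g.
pose f x := g (rep A R x) x.
have xc x : x \in A -> x \in cls A R (rep A R x).
  move=> xA; rewrite inE xA /=; apply: (eq_sym_on Req) => //; first exact: rep_in.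
  exact: rep_rel.
have fc x : x \in A -> f x \in cls B R' (h (rep A R x)).
  move=> xA; have [gb _ _] := gP _ (rep_reps Req xA).
  by apply: bij_on_mem gb (xc x xA).
have fB x : x \in A -> f x \in B by move=> /fc; rewrite inE => /andP[].
have fR x : x \in A -> R' (h (rep A R x)) (f x) by move=> /fc; rewrite inE => /andP[].
have sepR x y : x \in A -> y \in A -> R' (f x) (f y) -> R x y.
  move=> xA yA Rf.
  have hx := repsW (hr x xA); have hy := repsW (hr y yA).
  have R1 := eq_trans_on R'eq (fB _ xA) hx (fB _ yA) (fR _ xA) Rf.
  have R2 := eq_trans_on R'eq (fB _ yA) hx hy R1 (eq_sym_on R'eq hy (fB _ yA) (fR _ yA)).
  have := rel_rep R'eq hx (hr y yA) R2; rewrite (rep_id (hr x xA)) => hxy.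
  have rxy : rep A R x = rep A R y.
    by apply: hb.1 => //; apply: rep_reps.
  apply: (eq_trans_on Req (rep_in R xA) xA yA (rep_rel Req xA)).
  by rewrite rxy; apply: (eq_sym_on Req) => //; [apply: rep_in | apply: rep_rel].
have sameR x y : x \in A -> y \in A -> R x y -> rep A R x = rep A R y.
  by move=> xA yA Rxy; apply: rep_eq.
have fE x : x \in A -> E [:: x] [:: f x].
  by move=> xA; have [_ _ gE] := gP _ (rep_reps Req xA); apply: gE; apply: xc.
exists f; split=> //.
- split.
    move=> x y xA yA fxy; have Rxy : R x y.
      by apply: sepR => //; rewrite fxy; apply: (eq_refl_on R'eq); apply: fB.
    have [gb _ _] := gP _ (rep_reps Req xA); apply: gb.1; first exact: xc.
      by rewrite (sameR _ _ xA yA Rxy); apply: xc.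
    by rewrite -/(f x) fxy /f (sameR _ _ xA yA Rxy).
  apply/setP => z; apply/imsetP/idP => [[x xA ->]|zB]; first exact: fB.
  have zr := rep_reps R'eq zB; have [x xr zx] := bij_on_surj hb zr.
  have [gb _ _] := gP _ xr.
  have zc : z \in cls B R' (h x).
    by rewrite -zx inE zB /=; apply: (eq_sym_on R'eq) => //; [apply: rep_in | apply: rep_rel].
  have [y yc zy] := bij_on_surj gb zc.
  move: yc; rewrite inE => /andP[yA Rxy].
  exists y => //; rewrite zy /f (rel_rep Req yA xr) //.
  by apply: (eq_sym_on Req) => //; apply: repsW xr.
- move=> x y xA yA; have [Rxy|nR] := boolP (R x y).
    have [_ ge _] := gP _ (rep_reps Req xA).
    rewrite /f -(sameR _ _ xA yA Rxy); apply: ge; first exact: xc.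
    by rewrite (sameR _ _ xA yA Rxy); apply: xc.
  apply: cross => //; try exact: fE; try exact: fR.
  by apply/negP => /sepR h'; move/negP: nR; apply; apply: h'.
Qed.

(** When types decide the adjacencies across classes, any matching of classes that pairs up some
    equivalent vertices will do: isomorphisms found class by class preserve types and therefore fit
    together. *)
Theorem decomposition :
  (forall x y u v, x \in A -> y \in A -> selfE E [:: x] [:: u] -> selfE E [:: y] [:: v] ->
     ~~ R x y -> ~~ R u v -> e x y = e u v) ->
  (forall x x', E [:: x] [:: x'] -> forall E',
     bisim e e' k (cls A R x) (cls B R' x') E' -> E' [::] [::] ->
     (forall xs ys, E' xs ys -> E xs ys) -> iso_on e e' (cls A R x) (cls B R' x') E') ->
  iso_on e e' A B E.
Proof.
move=> cross ciso.
have [h [hb hM]] := class_matching bE k3 E0 Req Rinv E0 (ltnW k3).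
apply: (glue_classes hb hM).
  move=> x y x' y' xA yA nR nR' Ex Ey _ _.
  have [_ xB] := bs_mem bE Ex; have [_ yB] := bs_mem bE Ey.
  have [u [v h2]] := bs_pull2 bE k3 E0 xB yB.
  rewrite -(bs_atom bE h2).2; apply: cross => //.
  - by exists [:: x'] => //; apply: bs_head bE _ _ _ _ h2.
  - by exists [:: y'] => //; apply: (bs_head bE); apply: bs_swap bE _ _ _ _ _ _ h2.
  - by rewrite -(trelE Rinv h2).
move=> x x' Ex; pose E' xs ys := [/\ E xs ys, {subset xs <= cls A R x} & {subset ys <= cls B R' x'}].
have [||f [fb fe fE]] := ciso _ _ Ex E' (bisim_restrict bE k3 E0 Req Rinv Ex); [by [] | by move=> ? ? [] |].
by exists f; split=> // v /fE[].
Qed.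

Hypothesis k4 : 4 <= k.
Hypothesis eirr : irreflexive e.
Hypothesis e'irr : irreflexive e'.
Hypothesis Rmod : forall x y u v, x \in A -> y \in A -> u \in A -> v \in A ->
  R x u -> R y v -> ~~ R x y -> e x y = e u v.

(** All four vertices are pulled back to one position, hence the four pebbles. *)
Lemma trel_module x y u v : x \in B -> y \in B -> u \in B -> v \in B ->
  R' x u -> R' y v -> ~~ R' x y -> e' x y = e' u v.
Proof.
move=> xB yB uB vB Rxu Ryv nR.
have [x0 [y0 h]] := bs_pull2 bE k3 E0 xB yB.
have [u0 u0A h1] := bs_back bE h k3 uB.
have [v0 v0A h2] := bs_back bE h1 k4 vB.
have hh (s : seq nat) := bs_sub bE h2 x0 x (s := s).
have xu : R x0 u0 by rewrite -(trelE Rinv (hh [:: 2; 1] isT isT)).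
have yv : R y0 v0 by rewrite -(trelE Rinv (hh [:: 3; 0] isT isT)).
have xy : ~~ R x0 y0 by rewrite -(trelE Rinv h).
have x0A : x0 \in A by apply: (bs_inl bE h); rewrite mem_head.
have y0A : y0 \in A by apply: (bs_inl bE h); rewrite !inE eqxx orbT.
rewrite -(bs_atom bE h).2 (Rmod x0A y0A u0A v0A xu yv xy).
exact: (bs_atom bE (hh [:: 1; 0] isT isT)).2.
Qed.

(** The pebble held back here is the spare one of [bs_shift]. *)
Definition quotE xs ys := exists us vs, [/\ E us vs, size us <= k.-1,
  xs = map (rep A R) us & ys = map (rep B R') vs].

Lemma repE x y x' y' : E [:: x; y] [:: x'; y'] ->
  (rep A R x == rep A R y) = (rep B R' x' == rep B R' y') /\
  e (rep A R x) (rep A R y) = e' (rep B R' x') (rep B R' y').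
Proof.
move=> h.
have [xA yA] : x \in A /\ y \in A.
  by split; apply: (bs_inl bE h); rewrite !inE eqxx ?orbT.
have [xB yB] : x' \in B /\ y' \in B.
  by split; apply: (bs_inr bE h); rewrite !inE eqxx ?orbT.
have eqA : (rep A R x == rep A R y) = R x y.
  apply/eqP/idP => [rxy|]; last exact: rep_eq.
  apply: (eq_trans_on Req (rep_in R xA)) => //; first exact: rep_rel.
  by rewrite rxy; apply: (eq_sym_on Req) => //; [apply: rep_in | apply: rep_rel].
have eqB : (rep B R' x' == rep B R' y') = R' x' y'.
  apply/eqP/idP => [rxy|]; last exact: rep_eq.
  apply: (eq_trans_on R'eq (rep_in R' xB)) => //; first exact: rep_rel.
  by rewrite rxy; apply: (eq_sym_on R'eq) => //; [apply: rep_in | apply: rep_rel].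
have Rxy := trelE Rinv h.
split; first by rewrite eqA eqB Rxy.
have [r|r] := boolP (R x y).
  have -> : rep A R x = rep A R y by apply/eqP; rewrite eqA.
  have -> : rep B R' x' = rep B R' y' by apply/eqP; rewrite eqB Rxy.
  by rewrite eirr e'irr.
rewrite -(Rmod xA yA) ?rep_in ?rep_rel //.
rewrite -(trel_module xB yB) ?rep_in ?rep_rel ?Rxy //; exact: (bs_atom bE h).2.
Qed.

Lemma all2_rep (T : finType) (C : {set T}) (Q : rel T) (bs ds : seq T) :
  equiv_on C Q -> {subset bs <= C} -> {subset ds <= C} ->
  map (rep C Q) bs = map (rep C Q) ds -> all2 Q bs ds.
Proof.
move=> Qeq; elim: bs ds => [|b bs IH] [|d ds] //= sb sd [rbd rs].
have bC : b \in C by apply: sb; rewrite mem_head.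
have dC : d \in C by apply: sd; rewrite mem_head.
rewrite IH // ?andbT; last by move=> z zs; apply: sd; rewrite inE zs orbT.
  apply: (eq_trans_on Qeq (rep_in Q bC)) => //; first exact: rep_rel.
  by rewrite rbd; apply: (eq_sym_on Qeq) => //; [apply: rep_in | apply: rep_rel].
by move=> z zs; apply: sb; rewrite inE zs orbT.
Qed.

Lemma rep_all2 (T : finType) (C : {set T}) (Q : rel T) (bs ds : seq T) :
  equiv_on C Q -> {subset bs <= C} -> {subset ds <= C} -> all2 Q bs ds ->
  map (rep C Q) bs = map (rep C Q) ds.
Proof.
move=> Qeq; elim: bs ds => [|b bs IH] [|d ds] //= sb sd /andP[Qbd al].
rewrite (IH ds) //; first congr (_ :: _).
- by apply: rep_eq => //; [apply: sb | apply: sd]; rewrite mem_head.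
- by move=> z zs; apply: sb; rewrite inE zs orbT.
by move=> z zs; apply: sd; rewrite inE zs orbT.
Qed.

(** Extension is [class_matching]. Difunctionality is the delicate clause: the positions to be
    composed agree only up to classes, so pebbles are first moved inside their classes, once on each
    side. *)
Lemma bisim_quotient : bisim e e' k.-1 (reps A R) (reps B R') quotE.
Proof.
have kk : k.-1 < k by case: (k) k3.
split.
- by move=> _ _ [us [vs [h _ -> ->]]]; rewrite !size_map (bs_size bE h).
- by move=> _ _ [us [vs [_ h -> _]]]; rewrite size_map.
- by move=> _ _ [us [vs [h _ -> _]]] x /mapP[u /(bs_inl bE h) uA ->]; apply: rep_reps.
- by move=> _ _ [us [vs [h _ _ ->]]] x /mapP[u /(bs_inr bE h) uA ->]; apply: rep_reps.
- move=> x y x' y' [us [vs [h _]]].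
  case: us h => [|u [|u2 [|u3 us]]] // h; case: vs h => [|v [|v2 [|v3 vs]]] // h.
  by move=> [-> ->] [-> ->]; apply: repE.
- move=> _ _ [us [vs [h sz -> ->]]]; rewrite size_map => lt.
  have lt2 : size us + 2 <= k by case: (k) lt => [|k0] //=; rewrite addn2 ltnS.
  have [f [fb fM]] := class_matching bE k3 E0 Req Rinv h lt2.
  exists f => // x xr; have [v [v' [vA Rxv vB Rfv Ev]]] := fM x xr.
  exists (v :: us), (v' :: vs); split=> //=.
    congr (_ :: _); apply/esym; apply: rel_rep => //.
    by apply: (eq_sym_on Req) => //; apply: repsW xr.
  have fr := bij_on_mem fb xr.
  congr (_ :: _); apply/esym; apply: rel_rep => //.
  by apply: (eq_sym_on R'eq) => //; apply: repsW fr.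
- move=> _ _ [us [vs [h sz -> ->]]] x0 y0 s; rewrite !size_map => sa ss.
  exists [seq nth x0 us i | i <- s], [seq nth y0 vs i | i <- s]; split.
  + exact: (bs_sub bE).
  + by rewrite size_map (leq_trans ss).
  + by rewrite -map_comp; apply/eq_in_map => i /(allP sa) lt; rewrite (nth_map x0).
  + rewrite -map_comp; apply/eq_in_map => i /(allP sa) lt.
    by rewrite (nth_map y0) // -(bs_size bE h).
- move=> _ _ _ _ [a [b [hab sa -> ->]]] [c [d [hcd sc -> rbd]]] [p [q [hpq sp rcp ->]]].
  have ub := bs_inr bE hab; have ud := bs_inr bE hcd.
  have al := all2_rep R'eq ub ud rbd.
  have := bs_shift bE (trelE Rinv) (cs := c) (ds := d) (bs := b) (qs := [::]) (ps := [::]).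
  rewrite !cats0 (bs_size bE hcd) => /(_ erefl hcd).
  rewrite -(bs_size bE hcd) => /(_ (leq_ltn_trans sc kk) ub al) [c' /= hc' alc].
  have uc' := bs_inl bE hc'; have uc := bs_inl bE hcd; have up := bs_inl bE hpq.
  have rc' : map (rep A R) c' = map (rep A R) p by rewrite -rcp; apply: rep_all2.
  have al' := all2_rep Req uc' up rc'.
  (* Flipping the game inverts bijections and takes some map from [W] to [U]. If there is none, [U]
     is empty and so are the positions. *)
  have [u0|noU] := pselect (inhabited (W -> U)); last first.
    have [c0|c0] := pselect (c' = [::]).
      case: p hpq sp rcp up rc' al' => [|? ?] hpq sp rcp up rc' al'; last by rewrite c0 in rc'.
      exists a, b; split=> //.
      have := bs_size bE hpq; case: q hpq => // _ _.
      by have := bs_size bE hc'; rewrite c0; case: b {hab rbd ub al} hc'.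
    case: c' {hc' alc uc' rc' al'} c0 => [|x c'] c0; first by case: c0.
    by case: noU; split=> _; exact: x.
  case: u0 => u0.
  have bF := bisim_flip u0 bE.
  have RF x y x' y' : E [:: x'; y'] [:: x; y] -> R x' y' = R' x y.
    by move=> /(trelE Rinv) ->.
  have := bs_shift bF RF (cs := q) (ds := p) (bs := c') (qs := [::]) (ps := [::]).
  rewrite !cats0 => /(_ (esym (bs_size bE hpq)) hpq).
  rewrite -(bs_size bE hpq) => /(_ (leq_ltn_trans sp kk) uc' al') [q' hq' alq].
  exists a, q'; split=> //; first exact: (bs_dif bE hab hc' hq').
  by apply/esym/rep_all2 => //; [apply: (bs_inr bE hq') | apply: (bs_inr bE hpq)].
Qed.

(** Between modules adjacency is that of their representatives, so an isomorphism of quotients pairs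
    the modules correctly and the isomorphisms of the paired modules fill it in. *)
Theorem quotient_iso :
  iso_on e e' (reps A R) (reps B R') quotE ->
  (forall x x', E [:: x] [:: x'] -> forall E',
     bisim e e' k (cls A R x) (cls B R' x') E' -> E' [::] [::] ->
     (forall xs ys, E' xs ys -> E xs ys) -> iso_on e e' (cls A R x) (cls B R' x') E') ->
  iso_on e e' A B E.
Proof.
case=> h [hb he hE] ciso.
apply: (glue_classes hb).
- move=> x xr; have [us [vs [hh _]]] := hE x xr.
  case: us hh => [|u [|? ?]] // hh; case: vs hh => [|v [|? ?]] // hh [xu] [yv].
  have [uA vB] := bs_mem bE hh.
  exists u, v; split=> //.
    by rewrite xu; apply: (eq_sym_on Req) => //; [apply: rep_in | apply: rep_rel].
  by rewrite yv; apply: (eq_sym_on R'eq) => //; [apply: rep_in | apply: rep_rel].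
- move=> x y x' y' xA yA nR nR' Ex Ey Rx Ry.
  have [_ xB] := bs_mem bE Ex; have [_ yB] := bs_mem bE Ey.
  rewrite (Rmod xA yA (rep_in R xA) (rep_in R yA)) ?rep_rel // he ?rep_reps //.
  have hx := bij_on_mem hb (rep_reps Req xA); have hy := bij_on_mem hb (rep_reps Req yA).
  have hxB := repsW hx; have hyB := repsW hy.
  apply: trel_module => //.
  apply/negP => Rh; move/negP: nR'; apply.
  apply: (eq_trans_on R'eq hxB xB yB (eq_sym_on R'eq hxB xB Rx)).
  exact: (eq_trans_on R'eq hyB hxB yB Rh Ry).
move=> x x' Ex; pose E' xs ys := [/\ E xs ys, {subset xs <= cls A R x} & {subset ys <= cls B R' x'}].
have [||f [fb fe fE]] := ciso _ _ Ex E' (bisim_restrict bE k3 E0 Req Rinv Ex); [by [] | by move=> ? ? [] |].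
by exists f; split=> // v /fE[].
Qed.

Lemma quotE_nil : quotE [::] [::].
Proof. by exists [::], [::]. Qed.

End Gluing.

(** * Connectivity inside vertex sets of P5-free graphs *)

Section Graph.
Variables (U : finType) (e : rel U).

Definition p5free := forall a b c d f, e a b -> e b c -> e c d -> e d f ->
  ~~ e a c -> ~~ e a d -> ~~ e a f -> ~~ e b d -> ~~ e b f -> ~~ e c f -> False.

Definition k4free (A : {set U}) := forall a b c d, a \in A -> b \in A -> c \in A -> d \in A ->
  e a b -> e a c -> e a d -> e b c -> e b d -> e c d -> False.

Definition rst (X : {set U}) : rel U := [rel a b | [&& e a b, a \in X & b \in X]].
(** Connection by edges inside [X]; it is reflexive outside [X] as well. *)
Definition cn (X : {set U}) : rel U := connect (rst X).

Hypothesis esy : symmetric e.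

Lemma cn_sym X : symmetric (cn X).
Proof. by apply: sym_connect_sym => a b; rewrite /rst /= esy [(a \in X) && _]andbC. Qed.

Lemma cn_refl X x : cn X x x. Proof. exact: connect0. Qed.

Lemma cn_trans X y x z : cn X x y -> cn X y z -> cn X x z.
Proof. exact: connect_trans. Qed.

Lemma cn_edge (X : {set U}) x y : x \in X -> y \in X -> e x y -> cn X x y.
Proof. by move=> xX yX xy; apply: connect1; rewrite /rst /= xy xX. Qed.

Lemma cn_sub (X Y : {set U}) x y : X \subset Y -> cn X x y -> cn Y x y.
Proof.
move=> /subsetP sXY; apply: connect_sub => a b /and3P[ab aX bX].
by apply: connect1; rewrite /rst /= ab !sXY.
Qed.

Lemma cn_mem (X : {set U}) x y : cn X x y -> x \in X -> y \in X.
Proof.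
case/connectP => p; elim: p x => [|z p IH] x /=; first by move=> _ ->.
by move=> /andP[/and3P[_ _ zX] /IH] h el _; apply: h.
Qed.

Lemma ncn_edge (X : {set U}) x y : x \in X -> y \in X -> ~~ cn X x y -> ~~ e x y.
Proof. by move=> xX yX; apply: contra; apply: cn_edge. Qed.

Lemma ncn_trans X x y z : cn X x y -> ~~ cn X x z -> ~~ cn X y z.
Proof. by move=> xy; apply: contra; apply: cn_trans xy. Qed.

Lemma boundary_edge (X : {set U}) (P : pred U) x y : cn X x y -> P x -> ~~ P y ->
  exists u v, [/\ cn X x u, rst X u v, P u & ~~ P v].
Proof.
case/connectP => p; elim: p x => [|z p IH] x /=; first by move=> _ -> ->.
move=> /andP[xz /IH] h el Px nPy; have [Pz|nPz] := boolP (P z).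
  have [u [v [c r Pu Pv]]] := h el Pz nPy; exists u, v; split=> //.
  by apply: cn_trans c; apply: connect1.
by exists x, z; split=> //; apply: cn_refl.
Qed.

Hypothesis P5 : p5free.

(* A vertex of a P5-free graph is mixed on at most one component of any vertex set:
   two mixed components yield v1 - u1 - f - u2 - v2. *)
Lemma mixed_once (X : {set U}) f x1 y1 x2 y2 : x1 \in X -> x2 \in X -> cn X x1 y1 -> cn X x2 y2 ->
  e f x1 -> ~~ e f y1 -> e f x2 -> ~~ e f y2 -> cn X x1 x2.
Proof.
move=> x1X x2X c1 c2 f1 nf1 f2 nf2; apply/negPn/negP => nc.
have [u [v [cu /and3P[uv uX vX] fu fv]]] := boundary_edge (P := e f) c1 f1 nf1.
have [p [q [cp /and3P[pq pX qX] fp fq]]] := boundary_edge (P := e f) c2 f2 nf2.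
have sep a b : cn X u a -> cn X p b -> a \in X -> b \in X -> ~~ e a b.
  move=> ua pb aX bX; apply/negP => ab; move/negP: nc; apply.
  apply: (cn_trans cu); apply: (cn_trans ua); apply: (cn_trans (cn_edge aX bX ab)).
  by rewrite cn_sym; apply: cn_trans pb.
have cuv := cn_edge uX vX uv; have cpq := cn_edge pX qX pq.
apply: (P5 (a := v) (b := u) (c := f) (d := p) (f := q)); rewrite // 1?[e _ f]esy 1?[e v u]esy //;
  by apply: sep => //; apply: cn_refl.
Qed.

(** If a vertex [p] reached from [f] through [w] had a neighbour [q] farther away,
    [y - f - w - p - q] would be an induced P5. *)
Lemma within_two (X : {set U}) f y u0 u : e f y -> (forall v, cn X u0 v -> ~~ e y v) ->
  u0 \in X -> e f u0 -> cn X u0 u ->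
  e f u \/ exists w, [/\ w \in X, cn X u0 w, e f w & e w u].
Proof.
move=> fy ny u0X fu0 cu.
pose P v := e f v || [exists w, [&& w \in X, cn X u0 w, e f w & e w v]].
suff: P u by case/orP => [|/existsP[w /and4P[]]]; [left | right; exists w].
apply/negPn/negP => nPu.
have Pu0 : P u0 by rewrite /P fu0.
have [p [q [cp /and3P[pq pX qX] Pp Pq]]] := boundary_edge cu Pu0 nPu.
have cq := cn_trans cp (cn_edge pX qX pq).
have nfp : ~~ e f p.
  apply/negP => fp; move/negP: Pq; apply; apply/orP; right; apply/existsP; exists p.
  by rewrite pX cp fp.
case/orP: Pp => [fp|/existsP[w /and4P[wX cw fw wp]]]; first by rewrite fp in nfp.
move: Pq; rewrite negb_or => /andP[nfq nq].
apply: (P5 (a := y) (b := f) (c := w) (d := p) (f := q)); rewrite // 1?[e y f]esy ?ny //.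
by apply: contra nq => wq; apply/existsP; exists w; rewrite wX cw fw.
Qed.

End Graph.

(** * Types of vertices and sets closed under them *)

Section SelfBisim.
Variables (U : finType) (e : rel U) (k : nat) (A : {set U}) (T : seq U -> seq U -> Prop).

Record self_bisim : Prop := SelfBisim {
  sb_bisim : bisim e e k A A T;
  sb_sym : forall xs ys, T xs ys -> T ys xs;
  sb_refl : forall xs, size xs <= k -> {subset xs <= A} -> T xs xs }.

(** Same type: a single pebble does not tell the two vertices apart. *)
Definition ty (x y : U) := T [:: x] [:: y].

Hypothesis sT : self_bisim.
Hypothesis k3 : 3 < k.

Lemma sb_ext2 x u y : ty x u -> y \in A -> exists v, T [:: y; x] [:: v; u].
Proof.
by move=> h yA; have [v _ ?] := bs_forth (sb_bisim sT) h (ltnW (ltnW k3)) yA; exists v.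
Qed.

Lemma sb_ext3 x y u v z : T [:: x; y] [:: u; v] -> z \in A -> exists w, T [:: z; x; y] [:: w; u; v].
Proof.
by move=> h yA; have [w _ ?] := bs_forth (sb_bisim sT) h (ltnW k3) yA; exists w.
Qed.

Lemma sb_ext4 x y z u v w t : T [:: x; y; z] [:: u; v; w] -> t \in A ->
  exists s, T [:: t; x; y; z] [:: s; u; v; w].
Proof.
by move=> h yA; have [s _ ?] := bs_forth (sb_bisim sT) h k3 yA; exists s.
Qed.

Lemma sb_map s xs us x0 : T xs us -> all (fun i => i < size xs) s -> size s <= size xs ->
  T [seq nth x0 xs i | i <- s] [seq nth x0 us i | i <- s].
Proof. by move=> h; apply: (bs_sub (sb_bisim sT) h). Qed.

Lemma sb_mem x u : ty x u -> x \in A /\ u \in A.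
Proof. exact: bs_mem (sb_bisim sT) _ _. Qed.

Lemma sb_adj x y u v : T [:: x; y] [:: u; v] -> e x y = e u v.
Proof. by move=> /(bs_atom (sb_bisim sT)) []. Qed.

Lemma sb_eq x y u v : T [:: x; y] [:: u; v] -> (x == y) = (u == v).
Proof. by move=> /(bs_atom (sb_bisim sT)) []. Qed.

Lemma sb_hd x y u v : T [:: x; y] [:: u; v] -> ty x u.
Proof. exact: bs_head (sb_bisim sT) _ _ _ _. Qed.

Lemma sb_snd x y u v : T [:: x; y] [:: u; v] -> ty y v.
Proof. exact: bs_tl (sb_bisim sT) _ _ _ _. Qed.

Lemma sb_sw x y u v : T [:: x; y] [:: u; v] -> T [:: y; x] [:: v; u].
Proof. by move=> h; have := sb_map x (s := [:: 1; 0]) h; apply. Qed.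

Lemma ty_sym x u : ty x u -> ty u x. Proof. exact: (sb_sym sT). Qed.

Lemma ty_refl x : x \in A -> ty x x.
Proof.
move=> xA; apply: (sb_refl sT); first exact: leq_trans k3.
by move=> z; rewrite inE => /eqP ->.
Qed.

Lemma sb_trans xs ys zs : T xs ys -> T ys zs -> T xs zs.
Proof.
move=> h1 h2; apply: (bs_dif (sb_bisim sT) h1 _ h2).
apply: (sb_refl sT); last exact: bs_inl (sb_bisim sT) _ _ h2.
exact: bs_le (sb_bisim sT) _ _ h2.
Qed.

Lemma ty_trans y x z : ty x y -> ty y z -> ty x z. Proof. exact: sb_trans. Qed.

Definition ty_closed (X : {set U}) := forall x u, ty x u -> x \in X -> u \in X.

Lemma ty_closed_eq (X : {set U}) x u : ty_closed X -> ty x u -> (x \in X) = (u \in X).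
Proof. by move=> cX xu; apply/idP/idP; apply: cX => //; apply: ty_sym. Qed.

(** A path is copied edge by edge with three pebbles: on its current start, its end, and the next
    vertex. *)
Lemma cn_inv (X : {set U}) x y u v : X \subset A -> ty_closed X -> T [:: x; y] [:: u; v] ->
  cn e X x y -> cn e X u v.
Proof.
move=> /subsetP XA cX h /connectP[p]; elim: p x u h => [|z p IH] x u h /=.
  by move=> _ xy; have := sb_eq h; rewrite xy eqxx => /esym /eqP ->; apply: connect0.
move=> /andP[/and3P[xz xX zX] pp] yl.
have [w hw] := sb_ext3 h (XA _ zX).
have zw : T [:: z; x] [:: w; u] by have := sb_map x (s := [:: 0; 1]) hw; apply.
have zy : T [:: z; y] [:: w; v] by have := sb_map x (s := [:: 0; 2]) hw; apply.
apply: (connect_trans (connect1 _) (IH _ _ zy pp yl)).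
rewrite /rst /= -(sb_adj (sb_sw zw)) xz /= (cX _ _ (sb_hd h) xX).
exact: cX (sb_hd zw) zX.
Qed.

End SelfBisim.

Lemma selfE_self_bisim (U W : finType) (e : rel U) (e' : rel W) k A B E :
  bisim e e' k A B E -> E [::] [::] -> self_bisim e k A (selfE E).
Proof.
move=> bE E0; split; first exact: bisim_self bE.
  by move=> xs ys; apply: selfE_sym.
by move=> xs sz sub; apply: selfE_refl bE _ E0 sz sub.
Qed.

(** * Partitions indexed by the components of a type-closed set *)

Section Index.
Variables (U : finType) (Y : {set U}) (bel : rel U).
(* [bel x y] means that x belongs to the part represented by y in Y. *)
Hypothesis bel_share : forall x x' y y', y \in Y -> y' \in Y ->
  bel x y -> bel x y' -> bel x' y -> bel x' y'.

Definition indexed x := [exists y in Y, bel x y].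

Lemma indexedP x : reflect (exists2 y, y \in Y & bel x y) (indexed x).
Proof. by apply: (iffP existsP) => [[y /andP[]]|[y h1 h2]]; exists y => //; rewrite h1. Qed.

(** Vertices that belong to no part together form one more class. *)
Definition ixrel x y := [exists z in Y, bel x z && bel y z] || (~~ indexed x && ~~ indexed y).

Lemma ixrelP x y z : bel x z -> z \in Y -> ixrel x y = bel y z.
Proof.
move=> bx zY; apply/orP/idP => [[/existsP[w /and3P[wY bxw byw]]|]|by'].
- exact: bel_share bxw bx byw.
- by case/andP => /indexedP[]; exists z.
by left; apply/existsP; exists z; rewrite zY bx.
Qed.

Lemma ixrel_sym x y : ixrel x y = ixrel y x.
Proof.
by rewrite /ixrel [~~ indexed y && _]andbC; congr orb; apply: eq_existsb => z; rewrite [bel y z && _]andbC.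
Qed.

Lemma ixrel_none x y : ~~ indexed x -> ixrel x y = ~~ indexed y.
Proof.
move=> nx; rewrite /ixrel nx /=; case hy: (indexed y); rewrite ?orbT //= orbF.
apply/existsP => -[z /and3P[zY bz _]]; by case/indexedP: nx; exists z.
Qed.

Lemma ixrel_equiv A : equiv_on A ixrel.
Proof.
split.
- move=> x _; have [/indexedP[z zY b]|nx] := boolP (indexed x); first by rewrite (ixrelP _ b).
  by rewrite ixrel_none.
- by move=> x y _ _; rewrite ixrel_sym.
move=> y x z _ _ _; have [/indexedP[w wY b]|nx] := boolP (indexed x).
  by rewrite !(ixrelP _ b) // => b2; rewrite (ixrelP _ b2).
by rewrite (ixrel_none y nx) (ixrel_none z nx) => ny; rewrite (ixrel_none z ny).
Qed.

Variables (e : rel U) (k : nat) (A : {set U}) (T : seq U -> seq U -> Prop).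
Hypotheses (sT : self_bisim e k A T) (k3 : 3 < k).
Hypotheses (YA : Y \subset A) (Ycl : ty_closed T Y).
Hypothesis bel_inv : forall x y u v, y \in Y -> T [:: x; y] [:: u; v] -> bel x y -> bel u v.

Lemma indexed_inv x u : ty T x u -> indexed x -> indexed u.
Proof.
move=> xu /indexedP[y yY b]; have [v hv] := sb_ext2 sT k3 xu (subsetP YA _ yY).
apply/indexedP; exists v; first exact: Ycl (sb_hd sT hv) yY.
exact: bel_inv yY (sb_sw sT hv) b.
Qed.

Lemma indexed_inv_eq x u : ty T x u -> indexed x = indexed u.
Proof. by move=> xu; apply/idP/idP; apply: indexed_inv => //; apply: (ty_sym sT). Qed.

Lemma ixrel_inv x y u v : T [:: x; y] [:: u; v] -> ixrel x y -> ixrel u v.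
Proof.
move=> h; case/orP => [/existsP[z /and3P[zY bx by']]|/andP[nx ny]]; last first.
  by rewrite ixrel_none -?(indexed_inv_eq (sb_hd sT h)) // -(indexed_inv_eq (sb_snd sT h)).
have [s hs] := sb_ext3 sT k3 h (subsetP YA _ zY).
have h1 : T [:: x; z] [:: u; s] by have := @sb_map _ _ _ _ _ sT [:: 1; 0] _ _ z hs; apply.
have h2 : T [:: y; z] [:: v; s] by have := @sb_map _ _ _ _ _ sT [:: 2; 0] _ _ z hs; apply.
apply/orP; left; apply/existsP; exists s.
by rewrite (bel_inv zY h1) ?(bel_inv zY h2) // (Ycl (sb_snd sT h1) zY).
Qed.

Lemma ixrel_inv_eq x y u v : T [:: x; y] [:: u; v] -> ixrel x y = ixrel u v.
Proof. by move=> h; apply/idP/idP; apply: ixrel_inv => //; apply: (sb_sym sT). Qed.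

End Index.

Section Mixing.
Variables (U : finType) (e : rel U) (k : nat) (A : {set U}) (T : seq U -> seq U -> Prop).
Hypotheses (esy : symmetric e) (sT : self_bisim e k A T) (k3 : 3 < k).
Variable Y : {set U}.
Hypotheses (YA : Y \subset A) (Ycl : ty_closed T Y).

Local Notation tyT := (ty T).
Local Notation cY := (cn e Y).
Let YinA y : y \in Y -> y \in A. Proof. exact: (subsetP YA). Qed.
Let tyA x u : tyT x u -> u \in A. Proof. by case/(sb_mem sT). Qed.
Let cY_sym x y : cY x y -> cY y x. Proof. by rewrite cn_sym. Qed.
Let cY_inv x y u v : T [:: x; y] [:: u; v] -> cY x y -> cY u v.
Proof. exact: (cn_inv sT k3). Qed.

Definition touch f := [exists y in Y, e f y].

Lemma touch_inv f g : tyT f g -> touch f -> touch g.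
Proof.
move=> fg /existsP[y /andP[yY fy]].
have [z hz] := sb_ext2 sT k3 fg (YinA yY).
apply/existsP; exists z; rewrite (Ycl (sb_hd sT hz) yY).
by rewrite -(sb_adj sT (sb_sw sT hz)).
Qed.

Definition mix f v := [&& f \in A, f \notin Y, touch f, v \in Y & ~~ e f v].

Lemma mix_inv f v g w : T [:: f; v] [:: g; w] -> mix f v -> mix g w.
Proof.
move=> h /and5P[fA fY tf vY fv]; have fg := sb_hd sT h.
rewrite /mix (tyA fg) -(ty_closed_eq sT Ycl fg) fY (touch_inv fg tf).
by rewrite (Ycl (sb_snd sT h) vY) -(sb_adj sT h).
Qed.

(** The part of a component of [Y] is the component itself with the outside vertices that touch [Y]
    but miss a vertex of this component. *)
Definition bel x y := (x \in Y) && cY x y || [exists v, mix x v && cY v y].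

Lemma belY x y : x \in Y -> bel x y = cY x y.
Proof.
move=> xY; rewrite /bel xY /=; case: (cY x y) => //=; apply/existsP => -[v /andP[/and5P[_]]].
by rewrite xY.
Qed.

Lemma belF x y : x \notin Y -> bel x y -> exists2 v, mix x v & cY v y.
Proof.
by move=> xY; rewrite /bel (negPf xY) /= => /existsP[v /andP[]]; exists v.
Qed.

Lemma mix_bel x v : mix x v -> bel x v.
Proof. by move=> m; apply/orP; right; apply/existsP; exists v; rewrite m cn_refl. Qed.

Lemma bel_cn x y z : bel x y -> cY y z -> bel x z.
Proof.
case/orP => [/andP[xY c] yz|/existsP[v /andP[m c]] yz].
  by rewrite belY //; apply: cn_trans c yz.
by apply/orP; right; apply/existsP; exists v; rewrite m; apply: cn_trans c yz.
Qed.

(* A vertex outside [Y] is mixed on at most one component of [Y]. *)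
Hypothesis mix_off : forall f v y, mix f v -> y \in Y -> ~~ cY v y -> e f y.

Lemma bel_uniq x y z : bel x y -> bel x z -> cY y z.
Proof.
have [xY|xY] := boolP (x \in Y).
  by rewrite !belY // => xy xz; apply: cn_trans (cY_sym xy) xz.
move=> /(belF xY)[v mv cv] /(belF xY)[w mw cw].
apply: (cn_trans (cY_sym cv)); apply: (cn_trans _ cw).
apply/negPn/negP => nvw.
case/and5P: (mw) => _ _ _ wY xw; by rewrite (mix_off mv wY nvw) in xw.
Qed.

Lemma bel_inv x y u v : T [:: x; y] [:: u; v] -> bel x y -> bel u v.
Proof.
move=> h; case/orP => [/andP[xY c]|/existsP[w /andP[m c]]].
  by rewrite belY; [apply: cY_inv h c | apply: Ycl (sb_hd sT h) xY].
have wA : w \in A by case/and5P: m => _ _ _ /YinA.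
have [s hs] := sb_ext3 sT k3 h wA.
have h1 : T [:: x; w] [:: u; s] by have := @sb_map _ _ _ _ _ sT [:: 1; 0] _ _ w hs; apply.
have h2 : T [:: w; y] [:: s; v] by have := @sb_map _ _ _ _ _ sT [:: 0; 2] _ _ w hs; apply.
by apply/orP; right; apply/existsP; exists s; rewrite (mix_inv h1 m) (cY_inv h2 c).
Qed.

Lemma bel_share x x' y y' : y \in Y -> y' \in Y ->
  bel x y -> bel x y' -> bel x' y -> bel x' y'.
Proof. by move=> _ _ b1 b2 b3; apply: bel_cn b3 (bel_uniq b1 b2). Qed.

Definition mixrel := ixrel Y bel.

Lemma mixrelP x y z : bel x z -> z \in Y -> mixrel x y = bel y z.
Proof. exact: (ixrelP bel_share). Qed.

Lemma mixrel_equiv : equiv_on A mixrel.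
Proof. exact: (ixrel_equiv bel_share). Qed.

Lemma mixrel_inv x y u v : T [:: x; y] [:: u; v] -> mixrel x y -> mixrel u v.
Proof. by apply: (ixrel_inv sT k3 YA Ycl) => ? ? ? ? _; apply: bel_inv. Qed.

Lemma mixrel_inv_eq x y u v : T [:: x; y] [:: u; v] -> mixrel x y = mixrel u v.
Proof. by move=> h; apply/idP/idP; apply: mixrel_inv => //; apply: (sb_sym sT). Qed.

(** Distinct components of [Y] are anticomplete. A vertex outside [Y] that touches [Y] and misses
    [x] is in the part of [x]; hence a vertex of another part sees [x] exactly when it touches [Y],
    which its type decides. *)
Lemma mixrel_cross_in x y u v : x \in A -> y \in A -> tyT x u -> tyT y v ->
  ~~ mixrel x y -> ~~ mixrel u v -> x \in Y -> e x y -> e u v.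
Proof.
move=> xA yA xu yv nR nR' xY xy; have uY := Ycl xu xY.
have uA := YinA uY; have vA := tyA yv.
have bxx z : z \in Y -> bel z z by move=> zY; rewrite belY // cn_refl.
have [yY|yY] := boolP (y \in Y).
by move: nR; rewrite (mixrelP _ (bxx _ xY)) // belY // => /negP[]; apply: cY_sym; apply: cn_edge.
have vY : v \notin Y by rewrite -(ty_closed_eq sT Ycl yv).
have tv : touch v.
by apply: (touch_inv yv); apply/existsP; exists x; rewrite xY esy.
apply/negPn/negP => nuv; have m : mix v u by rewrite /mix vA vY tv uY esy.
by move: nR'; rewrite (mixrelP _ (bxx _ uY)) // (mix_bel m).
Qed.

End Mixing.

(** * K4-free, P5-free graphs whose types are independent sets *)

Section IndependentTypes.
Variables (U : finType) (e : rel U) (k : nat) (A : {set U}) (T : seq U -> seq U -> Prop).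
Hypotheses (esy : symmetric e) (P5 : p5free e) (K4 : k4free e A).
Hypotheses (sT : self_bisim e k A T) (k3 : 3 < k).
Hypothesis indep : forall u v, ty T u v -> ~~ e u v.

Local Notation tyT := (ty T).

Variable a0 a1 : U.
Hypotheses (a01 : tyT a0 a1) (a0n : a0 != a1).

(* [Y] is a union of types each of whose components contains a vertex of the type of [a0],
   and [G[Y]] is disconnected; we take such a set of maximal size. *)
Definition homog (Y : {set U}) := [/\ Y \subset A, ty_closed T Y, a0 \in Y,
  forall y, y \in Y -> exists2 a, tyT a0 a & cn e Y y a &
  exists a b, [/\ tyT a0 a, tyT a0 b & ~~ cn e Y a b]].

Lemma a0A : a0 \in A. Proof. exact: (sb_mem sT a01).1. Qed.

(** The type of [a0] itself: it is independent and contains the distinct vertices [a0] and [a1]. *)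
Lemma homog_ex : exists Y, homog Y.
Proof.
exists [set u in A | `[< tyT a0 u >]].
split.
- by apply/subsetP => u; rewrite inE => /andP[].
- move=> x u xu; rewrite !inE => /andP[_ /asboolP h].
  by rewrite (sb_mem sT xu).2 /=; apply/asboolP; apply: (ty_trans sT h xu).
- by rewrite inE a0A; apply/asboolP; apply: (ty_refl sT) a0A.
- by move=> y; rewrite inE => /andP[_ /asboolP]; exists y => //; apply: cn_refl.
exists a0, a1; split=> //; first exact: (ty_refl sT) a0A.
apply/negP => /connectP[[|z p] /=]; first by move=> _ h; move: a0n; rewrite h eqxx.
move=> /andP[/and3P[ez _]]; rewrite inE => /andP[_ /asboolP zt] _.
by move: (indep zt); rewrite ez.
Qed.

Lemma homog_max : exists2 Y, homog Y & forall Z, homog Z -> #|Z| <= #|Y|.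
Proof.
have [Y hY] := homog_ex.
pose P (Z : {set U}) := `[< homog Z >].
have PY : P Y by apply/asboolP.
case: (arg_maxnP (fun Z : {set U} => #|Z|) PY) => Z /asboolP hZ mZ.
by exists Z => // V hV; apply: mZ; apply/asboolP.
Qed.

Section WithY.
Variable Y : {set U}.
Hypothesis hY : homog Y.
Hypothesis maxY : forall Z, homog Z -> #|Z| <= #|Y|.

Let YA : Y \subset A. Proof. by case: hY. Qed.
Let Ycl : ty_closed T Y. Proof. by case: hY. Qed.
Let YinA y : y \in Y -> y \in A. Proof. exact: (subsetP YA). Qed.
Let a0Y : a0 \in Y. Proof. by case: hY. Qed.

Local Notation cY := (cn e Y).

Lemma tyA x u : tyT x u -> u \in A. Proof. by case/(sb_mem sT). Qed.
Lemma cY_sym x y : cY x y -> cY y x. Proof. by rewrite cn_sym. Qed.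
Lemma cY_inv x y u v : T [:: x; y] [:: u; v] -> cY x y -> cY u v.
Proof. exact: (cn_inv sT k3). Qed.

Lemma meets_comp b y : b \in Y -> y \in Y -> exists b', [/\ b' \in Y, tyT b b' & cY y b'].
Proof.
move=> bY yY; case: hY => _ _ _ hc _.
have [a ha ca] := hc y yY; have [a' ha' ca'] := hc b bY.
have aa : tyT a' a by apply: (ty_trans sT) (ty_sym sT ha') ha.
have [b' hb] := sb_ext2 sT k3 aa (YinA bY).
exists b'; split; first exact: Ycl (sb_hd sT hb) bY.
  exact: (sb_hd sT hb).
by apply: (cn_trans ca); apply: cY_sym; apply: cY_inv hb ca'.
Qed.

Lemma other_comp y : exists2 z, z \in Y & ~~ cY y z.
Proof.
case: hY => _ _ _ _ [a [b [ha hb nab]]].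
have aY := Ycl ha a0Y; have bY := Ycl hb a0Y.
have [ya|] := boolP (cY y a); last by exists a.
exists b => //; apply: contra nab => yb; exact: cn_trans (cY_sym ya) yb.
Qed.

Lemma other_same v : v \in Y -> exists b, [/\ b \in Y, tyT v b & ~~ cY v b].
Proof.
move=> vY; have [y yY nc] := other_comp v; have [b [bY vb cb]] := meets_comp vY yY.
by exists b; split=> //; apply: contra nc => h; apply: cn_trans h (cY_sym cb).
Qed.

Local Notation touch := (touch e Y).
Local Notation mix := (mix e A Y).
Local Notation bel := (bel e A Y).
Local Notation R := (mixrel e A Y).
Let touch_inv f g : tyT f g -> touch f -> touch g. Proof. exact: (touch_inv sT k3 YA Ycl). Qed.
Let mix_inv f v g w : T [:: f; v] [:: g; w] -> mix f v -> mix g w.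
Proof. exact: (mix_inv sT k3 YA Ycl). Qed.

Definition nu f := [set y in Y | [exists z in Y, cY y z && e f z]].

Lemma nuP f y : reflect (y \in Y /\ exists z, [/\ z \in Y, cY y z & e f z]) (y \in nu f).
Proof.
rewrite inE; apply: (iffP andP) => -[yY].
  by case/existsP => z /and3P[zY c h]; split=> //; exists z.
by case=> z [zY c h]; split=> //; apply/existsP; exists z; rewrite zY c.
Qed.

Lemma nu_cn f y z : y \in nu f -> cY y z -> z \in nu f.
Proof.
move=> /nuP[yY [w [wY cw fw]]] yz; apply/nuP; split; first exact: cn_mem yz yY.
by exists w; split=> //; apply: cn_trans cw; apply: cY_sym.
Qed.

(** Adding the whole type [F] of [f] to [Y] gives a connected set, by maximality of [Y]. Choose [g]
    in [F] touching a maximal set [nu g] of components. If a component were missed, connectivity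
    would supply a second vertex [v] of [F], incomparable with [g] in the components touched but
    sharing one of them, and an induced P5 would arise through the shared component. *)
Lemma nu_full f : f \in A -> f \notin Y -> touch f -> exists2 g, tyT f g & Y \subset nu g.
Proof.
move=> fA fY tf.
pose F := [set u in A | `[< tyT f u >]].
have FP u : reflect (tyT f u) (u \in F).
  by rewrite inE; apply: (iffP andP) => [[_ /asboolP]|h] //; rewrite (tyA h); split=> //; apply/asboolP.
have FY u : u \in F -> u \notin Y.
  by move=> /FP fu; rewrite -(ty_closed_eq sT Ycl fu).
pose Y2 := Y :|: F.
have sub2 : Y \subset Y2 by apply: subsetUl.
have hc2 u : u \in Y2 -> exists2 a, tyT a0 a & cn e Y2 u a.
  rewrite inE => /orP[uY|uF].
    by case: hY => _ _ _ /(_ u uY)[a ha ca] _; exists a => //; apply: cn_sub ca.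
  have := touch_inv (elimT (FP u) uF) tf => /existsP[y /andP[yY uy]].
  case: hY => _ _ _ /(_ y yY)[a ha ca] _; exists a => //.
  apply: cn_trans (cn_sub sub2 ca); apply: cn_edge => //; first by rewrite inE uF orbT.
  exact: (subsetP sub2).
have cl2 : ty_closed T Y2.
  move=> x u xu; rewrite !inE => /orP[xY|/andP[_ /asboolP fx]].
    by rewrite (Ycl xu xY).
  by rewrite (tyA xu); apply/orP; right; apply/asboolP; apply: (ty_trans sT) fx xu.
have con2 a b : tyT a0 a -> tyT a0 b -> cn e Y2 a b.
  move=> ha hb; apply/negPn/negP => nab.
  have h2 : homog Y2.
    split=> //; last by exists a, b.
      apply/subsetP => u; rewrite inE => /orP[/YinA //|]; by rewrite inE => /andP[].
    by rewrite inE a0Y.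
  have := maxY h2; rewrite leqNgt => /negP; apply; apply: proper_card.
  apply/properP; split=> //; exists f => //; rewrite inE.
  by apply/orP; right; apply/FP; apply: (ty_refl sT).
have con u v : u \in Y2 -> v \in Y2 -> cn e Y2 u v.
  move=> /hc2[a ha ca] /hc2[b hb cb]; apply: (cn_trans ca).
  by apply: (cn_trans (con2 _ _ ha hb)); rewrite cn_sym.
have fF : f \in F by apply/FP; apply: (ty_refl sT).
case: (arg_maxnP (fun g => #|nu g|) fF) => g gF0 maxg; have gF : g \in F := gF0.
have fg := elimT (FP g) gF; exists g => //; apply/subsetP => y yY; apply/negPn/negP => ny.
(* [P] holds at [g] and fails at the missed vertex [y]. An edge on which it gets lost joins some [u]
   in [nu g] to a type mate [v] of [g] with [nu v] not inside [nu g]. *)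
pose P u := (u \in nu g) || (u \in F) && (nu u \subset nu g).
have gY2 : g \in Y2 by rewrite inE gF orbT.
have yY2 : y \in Y2 by rewrite inE yY.
have Pg : P g by rewrite /P gF subxx orbT.
have nPy : ~~ P y.
  by rewrite /P (negPf ny) /=; apply/negP => /andP[/FY]; rewrite yY.
have [u [v [_ /and3P[uv uY2 vY2] Pu nPv]]] := boundary_edge (con _ _ gY2 yY2) Pg nPy.
move: nPv; rewrite /P negb_or => /andP[nv nPv].
have [uY vF] : u \in nu g /\ v \in F.
  case/orP: Pu => [un|/andP[uF un]].
    split=> //; move: vY2; rewrite inE => /orP[vY|//].
    case/negP: nv; apply: (nu_cn un); apply: cn_edge => //.
    by case/nuP: un.
  move: vY2; rewrite inE => /orP[vY|vF].
    case/negP: nv; apply: (subsetP un); apply/nuP; split=> //.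
    by exists v; split=> //; apply: cn_refl.
  have := indep (ty_trans sT (ty_sym sT (elimT (FP u) uF)) (elimT (FP v) vF)).
  by rewrite uv.
rewrite vF /= in nPv.
have [z zv zg] := subsetPn nPv.
have [l lg lv] : exists2 l, l \in nu g & l \notin nu v.
  apply/subsetPn; apply/negP => sgv.
  have := maxg v vF; rewrite /= leqNgt => /negP; apply; apply: proper_card.
  by apply/properP; split=> //; exists z.
have gv : ~~ e g v by apply: indep; apply: (ty_trans sT) (ty_sym sT fg) (elimT (FP v) vF).
have [zY [z1 [z1Y cz vz]]] := nuP _ _ zv.
have z1g : z1 \notin nu g by apply: contra zg => h; apply: (nu_cn h (cY_sym cz)).
have [lY [l1 [l1Y cl gl]]] := nuP _ _ lg.
have l1v : l1 \notin nu v by apply: contra lv => h; apply: (nu_cn h (cY_sym cl)).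
have [uY1 [u0 [u0Y cu gu]]] := nuP _ _ uY.
have vu : e v u by rewrite esy.
have uv' : u \in nu v by apply/nuP; split=> //; exists u; split=> //; apply: cn_refl.
have inng w : w \in Y -> e g w -> w \in nu g.
  by move=> wY gw; apply/nuP; split=> //; exists w; split=> //; apply: cn_refl.
have innv w : w \in Y -> e v w -> w \in nu v.
  by move=> wY gw; apply/nuP; split=> //; exists w; split=> //; apply: cn_refl.
have ng w : w \in Y -> w \notin nu g -> ~~ e g w by move=> wY; apply: contra; apply: inng.
have nv' w : w \in Y -> w \notin nu v -> ~~ e v w by move=> wY; apply: contra; apply: innv.
have sep f' x w : x \in nu f' -> w \notin nu f' -> w \in Y -> ~~ e x w.
  move=> xn wn wY; apply: contra wn => xw; apply: (nu_cn xn); apply: cn_edge => //.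
  by case/nuP: xn.
have common w : w \in Y -> e g w -> e v w -> False.
  move=> wY gw vw.
  apply: (P5 (a := z1) (b := v) (c := w) (d := g) (f := l1)) => //.
  - by rewrite esy.
  - by rewrite esy.
  - by rewrite esy; apply: (sep g) => //; apply: inng.
  - by rewrite esy; apply: ng.
  - by apply: (sep v) => //; apply: innv.
  - by rewrite esy.
  - exact: nv'.
  - by apply: (sep v) => //; apply: innv.
have nl1 w : cY u0 w -> ~~ e l1 w.
  move=> uw; rewrite esy; apply: (sep v) => //; apply: (nu_cn uv').
  exact: cn_trans cu uw.
(* Inside the shared component [g] reaches [u] within two steps. As [g] and [v] have no common
   neighbour there, this gives [l1 - g - w - u - v]. *)
case: (within_two esy P5 gl nl1 u0Y gu (cY_sym cu)) => [gu1|[w [wY cw gw wu]]].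
  exact: (common u).
have [vw|vw] := boolP (e v w); first exact: (common w).
have [gu2|gu2] := boolP (e g u); first exact: (common u).
apply: (P5 (a := l1) (b := g) (c := w) (d := u) (f := v)) => //.
- by rewrite esy.
- exact: nl1.
- exact: nl1 (cY_sym cu).
- by rewrite esy; apply: nv'.
- by rewrite esy.
Qed.

(** Touching every component is invariant under the game, so it passes from the type mate [g] of
    [nu_full] to [f]. *)
Lemma touches_all f y : f \in A -> f \notin Y -> touch f -> y \in Y ->
  exists z, [/\ z \in Y, cY y z & e f z].
Proof.
move=> fA fY tf yY; have [g fg /subsetP full] := nu_full fA fY tf.
have [z hz] := sb_ext2 sT k3 fg (YinA yY).
have zY := Ycl (sb_hd sT hz) yY.
have [_ [w [wY cw gw]]] := nuP _ _ (full z zY).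
have [s hs] := sb_ext3 sT k3 (sb_sym sT hz) (YinA wY).
have h1 : T [:: w; z] [:: s; y] by have := @sb_map _ _ _ _ _ sT [:: 0; 1] _ _ w hs; apply.
have h2 : T [:: w; g] [:: s; f] by have := @sb_map _ _ _ _ _ sT [:: 0; 2] _ _ w hs; apply.
exists s; split; first exact: Ycl (sb_hd sT h1) wY.
  by apply: cY_inv (sb_sw sT h1) cw.
by rewrite -(sb_adj sT (sb_sw sT h2)).
Qed.

Lemma complete_off f v y : f \in A -> f \notin Y -> touch f -> v \in Y -> ~~ e f v ->
  y \in Y -> ~~ cY v y -> e f y.
Proof.
move=> fA fY tf vY fv yY nvy; apply/negPn/negP => fy.
have [v1 [v1Y cv1 fv1]] := touches_all fA fY tf vY.
have [y1 [y1Y cy1 fy1]] := touches_all fA fY tf yY.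
have c := mixed_once esy P5 v1Y y1Y (cY_sym cv1) (cY_sym cy1) fv1 fv fy1 fy.
move/negP: nvy; apply; apply: (cn_trans cv1); apply: (cn_trans c); exact: cY_sym.
Qed.

(* If f misses v and also indexed a neighbour b' of the type of v in the component of v, then for
   f2, b2 the copies of f, v at another component, b2 - f - b' - f2 - v is an induced P5;
   a vertex of the type of v in a third component would serve as b' as well. *)
Lemma mix_type f v b c : mix f v -> b \in Y -> tyT v b -> ~~ cY v c -> c \in Y ->
  e f b -> ~~ cY c b -> False.
Proof.
move=> mfv bY vb nvc cY' fb ncb; have /and5P[fA fY tf vY fv] := mfv.
have [b2 [b2Y vb2 cb2]] := meets_comp vY cY'.
have nvb2 : ~~ cY v b2 by apply: contra nvc => h; apply: cn_trans h (cY_sym cb2).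
have nb2b : ~~ cY b2 b by apply: contra ncb => h; apply: cn_trans cb2 h.
have [f2 h2] := sb_ext2 sT k3 vb2 fA.
have /and5P[f2A f2Y tf2 _ f2b2] := mix_inv h2 mfv.
have f2b : e f2 b by apply: (complete_off f2A f2Y tf2 b2Y f2b2 bY nb2b).
have f2v : e f2 v.
  by apply: (complete_off f2A f2Y tf2 b2Y f2b2 vY); rewrite cn_sym.
have fb2 : e f b2 by apply: (complete_off fA fY tf vY fv).
apply: (P5 (a := b2) (b := f) (c := b) (d := f2) (f := v)) => //.
- by rewrite esy.
- by rewrite esy.
- by apply: indep; apply: (ty_trans sT (ty_sym sT vb2) vb).
- by rewrite esy.
- by apply: indep; apply: (ty_sym sT vb2).
- by apply: indep; apply: (sb_hd sT h2).
- by apply: indep; apply: (ty_sym sT vb).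
Qed.

Lemma mix_nbr f v b : mix f v -> b \in Y -> tyT v b -> cY v b -> ~~ e f b.
Proof.
move=> mfv bY vb cvb; have [c cY' nvc] := other_comp v.
apply/negP => fb; apply: (mix_type mfv bY vb nvc cY' fb).
by apply: contra nvc => h; apply: cn_trans cvb (cY_sym h).
Qed.

(** Once a vertex is mixed, [Y] has at most two components: in a third one a vertex of the type of
    [v] would contradict [mix_type]. *)
Lemma mix_two f v b c : mix f v -> b \in Y -> ~~ cY v b -> c \in Y -> ~~ cY v c -> cY b c.
Proof.
move=> mfv bY nvb cY' nvc; apply/negPn/negP => nbc; have /and5P[fA fY tf vY fv] := mfv.
have [b1 [b1Y vb1 cb1]] := meets_comp vY bY.
have nvb1 : ~~ cY v b1 by apply: contra nvb => h; apply: cn_trans h (cY_sym cb1).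
have fb1 : e f b1 by apply: (complete_off fA fY tf vY fv).
apply: (mix_type mfv b1Y vb1 nvc cY' fb1).
by apply: contra nbc => h; apply: cn_trans cb1 (cY_sym h).
Qed.

Let off f v y : mix f v -> y \in Y -> ~~ cY v y -> e f y.
Proof. by case/and5P => fA fY tf vY fv yY; apply: (complete_off fA fY tf vY fv yY). Qed.

Let bel_uniq x y z : bel x y -> bel x z -> cY y z. Proof. exact: (bel_uniq esy off). Qed.
Let RP x y z : bel x z -> z \in Y -> R x y = bel y z. Proof. exact: (mixrelP esy off). Qed.
Let R_inv_eq x y u v : T [:: x; y] [:: u; v] -> R x y = R u v.
Proof. exact: (mixrel_inv_eq sT k3 YA Ycl). Qed.
Let R_sym x y : R x y = R y x. Proof. exact: ixrel_sym. Qed.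
Let R_none x y : ~~ indexed Y bel x -> R x y = ~~ indexed Y bel y. Proof. exact: ixrel_none. Qed.
Let indexed_inv x u : tyT x u -> indexed Y bel x -> indexed Y bel u.
Proof.
move=> h; apply: (indexed_inv sT k3 YA Ycl _ h) => a b c d _; exact: (bel_inv sT k3 YA Ycl).
Qed.
Lemma R_equiv : equiv_on A R. Proof. exact: (mixrel_equiv esy off). Qed.
Lemma R_inv x y u v : T [:: x; y] [:: u; v] -> R x y -> R u v.
Proof. exact: (mixrel_inv sT k3 YA Ycl). Qed.

(** A part omits the other components of [Y], and the unindexed class omits [a0]; this feeds the
    induction on the vertex set. *)
Lemma R_small x : x \in A -> #|cls A R x| < #|A|.
Proof.
move=> xA; apply: proper_card; apply/properP; split.
  by apply/subsetP => y; rewrite inE => /andP[].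
have [/indexedP[z zY b]|nx] := boolP (indexed Y bel x).
  have [w wY nw] := other_comp z; exists w; first exact: YinA.
  by rewrite inE (YinA wY) /= (RP _ b) // belY // cn_sym.
exists a0; first exact: a0A.
rewrite inE a0A /= R_none // negbK; apply/indexedP; exists a0 => //.
by rewrite belY // cn_refl.
Qed.

Lemma inF_mix x : x \in A -> x \notin Y -> indexed Y bel x -> exists v, mix x v.
Proof. by move=> xA xY /indexedP[y yY /((belF xY))[v m _]]; exists v. Qed.

(** The component on which [f] is mixed contains an edge; a copy of this edge in another component,
    to which [f] is complete, would form a K4 with [z] and [f]. *)
Lemma no_F_complete z f v : z \in A -> (forall y, y \in Y -> e z y) -> mix f v -> ~~ e z f.
Proof.
move=> zA zc m; apply/negP => zf; have /and5P[fA fY tf vY fv] := m.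
have [u [uY cu fu]] := touches_all fA fY tf vY.
have [p [q [cp /and3P[pq pY qY] _ _]]] := boundary_edge (P := e f) (cY_sym cu) fu fv.
have [y yY nvy] := other_comp v.
have [p2 [p2Y pp2 cp2]] := meets_comp pY yY.
have [q2 hq] := sb_ext2 sT k3 pp2 (YinA qY).
have q2Y := Ycl (sb_hd sT hq) qY.
have pq2 : e p2 q2 by rewrite -(sb_adj sT (sb_sw sT hq)).
have nvp2 : ~~ cY v p2 by apply: contra nvy => h; apply: cn_trans h (cY_sym cp2).
have nvq2 : ~~ cY v q2.
  by apply: contra nvp2 => h; apply: cn_trans h (cY_sym (cn_edge p2Y q2Y pq2)).
apply: (K4 zA fA (YinA p2Y) (YinA q2Y)) => //; try exact: zc.
  exact: (complete_off fA fY tf vY fv).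
exact: (complete_off fA fY tf vY fv).
Qed.

Lemma far_step w f f' v v' : w \in A -> ~~ touch w -> mix f v -> mix f' v' -> tyT f f' ->
  ~~ cY v v' -> e w f -> e w f'.
Proof.
move=> wA nw m m' ff nc wf; apply/negPn/negP => wf'.
have /and5P[fA fY tf vY fv] := m; have /and5P[f'A f'Y tf' v'Y fv'] := m'.
have [u [uY cu fu]] := touches_all f'A f'Y tf' v'Y.
have nwY y : y \in Y -> ~~ e w y.
  by move=> yY; apply: contra nw => wy; apply/existsP; exists y; rewrite yY.
have nvu : ~~ cY v u by apply: contra nc => h; apply: cn_trans h (cY_sym cu).
have fu' : e f u := complete_off fA fY tf vY fv uY nvu.
have f'v : e f' v by apply: (complete_off f'A f'Y tf' v'Y fv' vY); rewrite cn_sym.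
apply: (P5 (a := w) (b := f) (c := u) (d := f') (f := v)) => //.
- by rewrite esy.
- exact: nwY.
- exact: nwY.
- exact: indep.
- by apply: (ncn_edge uY vY); rewrite cn_sym.
Qed.

(** [far_step] covers [f] and [f'] mixed on different components. If they are mixed on the same one,
    a third vertex of their type, mixed on another component, serves as intermediary. *)
Lemma far_complete w f v f' : w \in A -> ~~ touch w -> mix f v -> tyT f f' -> e w f -> e w f'.
Proof.
move=> wA nw m ff wf; have vY : v \in Y by case/and5P: m.
have [v' hv'] := sb_ext2 sT k3 ff (YinA vY); have m' := mix_inv (sb_sw sT hv') m.
have [nc|/negPn cv] := boolP (~~ cY v v'); first exact: (far_step wA nw m m').
have [v1 [v1Y vv1 nc1]] := other_same vY.
have fA : f \in A by case/and5P: m.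
have [f1 hf1] := sb_ext2 sT k3 vv1 fA; have m1 := mix_inv hf1 m.
have wf1 := far_step wA nw m m1 (sb_hd sT hf1) nc1 wf.
apply: (far_step wA nw m1 m' _ _ wf1).
  exact: (ty_trans sT (ty_sym sT (sb_hd sT hf1)) ff).
by apply: contra nc1 => h; apply: cn_trans cv (cY_sym h).
Qed.

(* Between the parts of two types lying over different components there is no induced 2K2
   q - p - w - p' - q' (w a common non-neighbour of q and q'), so neighbourhoods are nested;
   each p indexed a neighbour and each q a non-neighbour, which is absurd for nested sets. *)
Lemma cross_types p q vp vq p1 q1 v1 v2 :
  mix p vp -> mix q vq -> ~~ cY vp vq -> mix p1 v1 -> mix q1 v2 -> ~~ cY v1 v2 ->
  tyT p p1 -> tyT q q1 -> e p q -> e p1 q1.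
Proof.
move=> mp mq npq m1 m2 n12 pp1 qq1 pq; apply/negPn/negP => npq1.
have /and5P[p1A p1Y tp1 v1Y p1v1] := m1; have /and5P[q1A q1Y tq1 v2Y q1v2] := m2.
pose P1 := [set x in A | `[< tyT p x >] && bel x v1].
pose Q2 := [set x in A | `[< tyT q x >] && bel x v2].
have vpY : vp \in Y by case/and5P: mp.
have vqY : vq \in Y by case/and5P: mq.
have nR : ~~ R q p.
  by rewrite (RP _ (mix_bel mq)) //; apply: contra npq => b; apply: bel_uniq (mix_bel mp) b.
have nR1 : ~~ R p1 q1.
  by rewrite (RP _ (mix_bel m1)) //; apply: contra n12 => b; apply: bel_uniq b (mix_bel m2).
have P1mix x : x \in P1 -> exists2 v, mix x v & cY v v1.
  rewrite inE => /and3P[xA /asboolP px b]; apply: belF b => //.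
  by rewrite -(ty_closed_eq sT Ycl px); case/and5P: mp.
have Q2mix x : x \in Q2 -> exists2 v, mix x v & cY v v2.
  rewrite inE => /and3P[xA /asboolP px b]; apply: belF b => //.
  by rewrite -(ty_closed_eq sT Ycl px); case/and5P: mq.
have hP x : x \in P1 -> exists2 y, y \in Q2 & e x y.
  move=> xP; have [vx mx cx] := P1mix _ xP; move: xP; rewrite inE => /and3P[xA /asboolP px bx].
  have qA : q \in A by case/and5P: mq.
  have [y hy] := sb_ext2 sT k3 px qA; exists y; last by rewrite -(sb_adj sT (sb_sw sT hy)).
  have qy := sb_hd sT hy.
  rewrite inE (tyA qy); apply/andP; split=> //; apply/andP; split; first exact/asboolP.
  have [w hw] := sb_ext2 sT k3 qy (YinA vqY); have my := mix_inv (sb_sw sT hw) mq.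
  have wY : w \in Y by case/and5P: my.
  apply: bel_cn (mix_bel my) _; apply: (mix_two m1) => //.
  apply: contra nR => c1w; rewrite (R_inv_eq hy) (RP _ (mix_bel my)) //.
  exact: bel_cn bx c1w.
have hQ y : y \in Q2 -> exists2 x, x \in P1 & ~~ e x y.
  move=> yQ; have [vy my cy] := Q2mix _ yQ; move: yQ; rewrite inE => /and3P[yA /asboolP qy by'].
  have q1y : tyT q1 y by apply: (ty_trans sT (ty_sym sT qq1) qy).
  have [x hx] := sb_ext2 sT k3 q1y p1A; exists x; last by rewrite -(sb_adj sT hx).
  have p1x := sb_hd sT hx.
  rewrite inE (tyA p1x); apply/andP; split=> //; apply/andP; split.
    by apply/asboolP; apply: (ty_trans sT) pp1 p1x.
  have [w hw] := sb_ext2 sT k3 p1x (YinA v1Y); have mx := mix_inv (sb_sw sT hw) m1.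
  have wY : w \in Y by case/and5P: mx.
  apply: bel_cn (mix_bel mx) _; apply: (mix_two m2) => //; last by rewrite cn_sym.
  apply: contra nR1 => c2w; rewrite (R_inv_eq hx) (RP _ (mix_bel mx)) //.
  exact: bel_cn by' c2w.
have P1p1 : p1 \in P1.
  by rewrite inE p1A (mix_bel m1) andbT /=; apply/asboolP.
pose N x := [set y in Q2 | e x y].
case: (arg_minnP (fun x => #|N x|) P1p1) => p0 p0P minp0.
have [q0 q0Q pq0] := hP _ p0P.
have [p' p'P np'] := hQ _ q0Q.
have [q' q'Q] : exists2 q', q' \in N p' & q' \notin N p0.
  apply/subsetPn; apply/negP => s.
  have := minp0 _ p'P; rewrite /= leqNgt => /negP; apply; apply: proper_card.
  by apply/properP; split=> //; exists q0; rewrite inE q0Q ?pq0 // negbK.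
rewrite inE in q'Q; case/andP: q'Q => q'Q p'q'; rewrite inE q'Q /= => np0q'.
have [w mw cw] := Q2mix _ q0Q; have wY : w \in Y by case/and5P: mw.
have [w' mw' cw'] := Q2mix _ q'Q.
have tQ y : y \in Q2 -> tyT q y by rewrite inE => /and3P[_ /asboolP].
have tP y : y \in P1 -> tyT p y by rewrite inE => /and3P[_ /asboolP].
have tq0 := tQ _ q0Q; have tq' := tQ _ q'Q; have tp0 := tP _ p0P; have tp' := tP _ p'P.
have nq'w : ~~ e q' w.
  have [w2 hw2] := sb_ext2 sT k3 (ty_trans sT (ty_sym sT tq0) tq') (YinA wY).
  have mw2 := mix_inv (sb_sw sT hw2) mw.
  apply: (mix_nbr mw2 wY (ty_sym sT (sb_hd sT hw2))).
  apply: (cn_trans (bel_uniq (mix_bel mw2) (mix_bel mw'))).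
  exact: cn_trans cw' (cY_sym cw).
have pw x : x \in P1 -> e x w.
  move=> xP; have [vx /and5P[xA xY tx vxY xvx] cx] := P1mix _ xP.
  apply: (complete_off xA xY tx vxY xvx wY).
  by apply: contra n12 => h; apply: (cn_trans (cY_sym cx)); apply: cn_trans h cw.
apply: (P5 (a := q0) (b := p0) (c := w) (d := p') (f := q')) => //.
- by rewrite esy.
- exact: pw.
- by rewrite esy; apply: pw.
- by case/and5P: mw.
- by rewrite esy.
- by apply: indep; apply: (ty_trans sT) (ty_sym sT tq0) tq'.
- by apply: indep; apply: (ty_trans sT) (ty_sym sT tp0) tp'.
- by rewrite esy.
Qed.

(** If a vertex lies in [Y], this is [mixrel_cross_in]; for two mixed vertices it is [cross_types].
    A mixed vertex has no neighbour complete to [Y] ([no_F_complete]), and a vertex not touching [Y]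
    sees all or none of a type of mixed vertices ([far_complete]). Two unindexed vertices are in one
    class. *)
Lemma R_cross x y u v : x \in A -> y \in A -> tyT x u -> tyT y v -> ~~ R x y -> ~~ R u v ->
  e x y -> e u v.
Proof.
have FX x0 y0 u0 v0 : x0 \in A -> y0 \in A -> tyT x0 u0 -> tyT y0 v0 -> ~~ R x0 y0 ->
    ~~ R u0 v0 -> x0 \notin Y -> y0 \notin Y -> indexed Y bel x0 -> e x0 y0 -> e u0 v0.
  move=> xA yA xu yv nR nR' xY yY hx xy.
  have uA := tyA xu; have vA := tyA yv.
  have uY : u0 \notin Y by rewrite -(ty_closed_eq sT Ycl xu).
  have vY : v0 \notin Y by rewrite -(ty_closed_eq sT Ycl yv).
  have [vx mx] := inF_mix xA xY hx.
  have vxY : vx \in Y by case/and5P: mx.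
  have [vu mu] := inF_mix uA uY (indexed_inv xu hx).
  have vuY : vu \in Y by case/and5P: mu.
  have [hy|hy] := boolP (indexed Y bel y0).
    have [vy my] := inF_mix yA yY hy; have [vv mv] := inF_mix vA vY (indexed_inv yv hy).
    apply: (cross_types mx my _ mu mv _ xu yv xy).
      by apply: contra nR => c; rewrite (RP _ (mix_bel mx)) //; apply: bel_cn (mix_bel my) (cY_sym c).
    by apply: contra nR' => c; rewrite (RP _ (mix_bel mu)) //; apply: bel_cn (mix_bel mv) (cY_sym c).
  have [ty'|nty] := boolP (touch y0).
    have ycomp z : z \in Y -> e y0 z.
      move=> zY; apply/negPn/negP => nyz; move/negP: hy; apply; apply/indexedP; exists z => //.
      by apply: mix_bel; rewrite /mix yA yY ty' zY.
    by move: (no_F_complete yA ycomp mx); rewrite esy xy.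
  have ntv : ~~ touch v0 by apply: contra nty; apply: touch_inv; apply: (ty_sym sT).
  have [x2 hx2] := sb_ext2 sT k3 yv xA.
  have m2 := mix_inv _ mx.
  have [w2 hw2] := sb_ext2 sT k3 (sb_hd sT hx2) (YinA vxY).
  have mx2 := mix_inv (sb_sw sT hw2) mx.
  rewrite esy; apply: (far_complete vA ntv mx2).
    by apply: (ty_trans sT) (ty_sym sT (sb_hd sT hx2)) xu.
  by rewrite esy -(sb_adj sT hx2).
move=> xA yA xu yv nR nR' xy.
have uY := ty_closed_eq sT Ycl xu; have vY := ty_closed_eq sT Ycl yv.
have [xY|xY] := boolP (x \in Y); first exact: (mixrel_cross_in esy sT k3 YA Ycl off (x := x) (y := y)).
have [yY|yY] := boolP (y \in Y).
  by rewrite esy; apply: (mixrel_cross_in esy sT k3 YA Ycl off (x := y) (y := x)) => //; rewrite 1?R_sym 1?esy.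
have [hx|hx] := boolP (indexed Y bel x); first exact: (FX x y).
have [hy|hy] := boolP (indexed Y bel y).
  by rewrite esy; apply: (FX y x) => //; rewrite 1?R_sym 1?esy.
by move: nR; rewrite R_none // hy.
Qed.

End WithY.
End IndependentTypes.

Section IndependentTypesIso.
Variables (U W : finType) (e : rel U) (e' : rel W) (k : nat).
Hypotheses (esy : symmetric e) (P5 : p5free e) (k3 : 3 < k).

(** With singleton types all answers are forced: after [x] is pebbled, the answer to [y] is still
    the image of [y] under the first bijection. *)
Lemma discrete_iso A B E : bisim e e' k A B E -> E [::] [::] ->
  (forall x y, selfE E [:: x] [:: y] -> x = y) -> iso_on e e' A B E.
Proof.
move=> bE E0 disc; have [f fb fE] := bs_ext bE E0 (ltn_trans (ltn0Sn 2) k3).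
exists f; split=> // x y xA yA.
have [y' yB hy] := bs_forth bE (fE x xA) (ltnW (ltnW k3)) yA.
have [z zA yz] := bij_on_surj fb yB; have Ezy := fE z zA; rewrite -yz in Ezy.
have yz' : z = y by apply: disc; exists [:: y'] => //; apply: (bs_head bE hy).
rewrite -yz' -yz; have [_ <-] := bs_atom bE (bs_swap bE hy); by rewrite yz'.
Qed.

(** Induction on the size of [A]: if some type has two vertices, a maximal [homog] set splits [A]
    into smaller classes to which [decomposition] applies; the hypotheses are inherited because a
    restricted game only refines types. *)
Theorem independent_types_iso A B E : bisim e e' k A B E -> E [::] [::] -> k4free e A ->
  (forall x y, selfE E [:: x] [:: y] -> ~~ e x y) -> iso_on e e' A B E.
Proof.
have [n] := ubnP #|A|; elim: n A B E => // n IH A B E /ltnSE leAn bE E0 K4 indep.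
have sT := selfE_self_bisim bE E0.
have [[a0 [a1 [h01 n01]]]|none] := pselect (exists a0 a1, selfE E [:: a0] [:: a1] /\ a0 != a1);
  last first.
  apply: discrete_iso bE E0 _ => x y h; apply/eqP/negPn/negP => nxy; apply: none.
  by exists x, y.
have [Y hY maxY] := homog_max sT k3 indep h01 n01.
have Req := R_equiv esy P5 sT k3 indep hY maxY.
have Rinv x y u v : selfE E [:: x; y] [:: u; v] ->
    mixrel e A Y x y -> mixrel e A Y u v.
  exact: (R_inv sT k3 hY).
apply: (decomposition bE (ltnW k3) E0 Req Rinv).
  move=> x y u v xA yA xu yv nR nR'.
  have uA := (sb_mem sT xu).2; have vA := (sb_mem sT yv).2.
  apply/idP/idP; first exact: (R_cross esy P5 K4 sT k3 indep hY maxY xA yA xu yv).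
  apply: (R_cross esy P5 K4 sT k3 indep hY maxY uA vA) => //; exact: selfE_sym.
move=> x x' Ex E' bE' E0' sub; have [xA _] := bs_mem bE Ex.
apply: IH bE' E0' _ _.
- by apply: leq_trans leAn; apply: (R_small esy P5 sT k3 indep h01 hY maxY).
- by move=> a b c d; rewrite !inE => /andP[? _] /andP[? _] /andP[? _] /andP[? _]; apply: K4.
by move=> u v [ys h1 h2]; apply: indep; exists ys; apply: sub.
Qed.

End IndependentTypesIso.

(** * Fixing pebbles; graphs without induced 2K2 *)

Section Pebbles.
Variables (U W : finType) (e : rel U) (e' : rel W).
Hypotheses (esy : symmetric e) (P5 : p5free e).

Lemma params_type k A B E ps qs x y : bisim e e' k A B E ->
  selfE (fun xs ys => E (xs ++ ps) (ys ++ qs)) [:: x] [:: y] ->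
  selfE E (x :: ps) (y :: ps).
Proof. by move=> bE [ys h1 h2]; exists (ys ++ qs). Qed.

Lemma selfE_adj k A B E x y ps p : bisim e e' k A B E ->
  selfE E (x :: ps) (y :: ps) -> p \in ps -> e x p = e y p.
Proof.
move=> bE h pp; have bT := bisim_self bE.
have := bs_sub bT h x x (s := [:: 0; (index p ps).+1]).
rewrite /= !ltnS index_mem pp /= !nth_index //.
move=> /(_ isT); case: ps pp h => // a ps _ _ /(_ isT) h2; exact: (bs_atom bT h2).2.
Qed.

(** With [ps] pebbled, vertices of the same type agree in their adjacencies to [ps]; four pebbles
    remain for [independent_types_iso]. *)
Lemma pebbled_iso k A B E ps : bisim e e' k A B E -> E [::] [::] -> 4 + size ps <= k ->
  {subset ps <= A} -> k4free e A ->
  (forall x y, x \in A -> y \in A -> selfE E [:: x] [:: y] ->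
     {in ps, forall p, e x p = e y p} -> ~~ e x y) ->
  iso_on e e' A B E.
Proof.
move=> bE E0 kp sub K4 indep.
have [qs Epq] := bs_dom bE E0 (leq_trans (leq_addl 4 _) kp) sub.
have bP := bisim_params bE Epq.
have k4 : 3 < k - size ps by rewrite ltn_subRL addnC.
apply: (iso_on_weaken (E0 := fun xs ys => E (xs ++ ps) (ys ++ qs))).
  by move=> x y h; apply: bs_head bE _ _ _ _ h.
apply: (independent_types_iso esy P5 k4 bP Epq K4) => x y h.
have h' := params_type bE h.
have [xA yA] : x \in A /\ y \in A.
  case: h' => ys h1 h2; split.
    by apply: (bs_inl bE h1); rewrite mem_head.
  by apply: (bs_inl bE h2); rewrite mem_head.
apply: indep => // [|p pp]; last exact: selfE_adj bE h' pp.
by have := bs_head (bisim_self bE) h'.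
Qed.

Definition two_k2 (A : {set U}) a b c d := [/\ a \in A, b \in A, c \in A & d \in A] /\
  [/\ e a b, e c d, ~~ e a c & ~~ e a d] /\ ~~ e b c /\ ~~ e b d.

(** Pebble an edge [x y] and, where they exist, an edge among the neighbours of [x] that miss [y]
    and one with the roles exchanged. Two adjacent vertices [s], [t] agreeing on these six form a K4
    with [x y] if they see both ends, and a 2K2 if they see none. If they see only one end, the
    corresponding further edge gives a K4 with that end or a 2K2. *)
Lemma two_k2_free_iso k A B E : irreflexive e -> bisim e e' k A B E -> E [::] [::] -> 10 <= k ->
  k4free e A -> (forall a b c d, ~ two_k2 A a b c d) -> iso_on e e' A B E.
Proof.
move=> eirr bE E0 k10 K4 no2.
have [[x [y [xA yA xy]]]|noE] := pselect (exists x y, [/\ x \in A, y \in A & e x y]); last first.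
  apply: (pebbled_iso (ps := [::]) bE E0 _ _ K4) => // [|x y xA yA _ _].
    exact: leq_trans k10.
  by apply/negP => xy; apply: noE; exists x, y.
(* If there is no edge to pick, the pair [(x, x)] stands in; the implication is then vacuous. *)
have pick_edge a b : exists p : U * U, [/\ p.1 \in A, p.2 \in A &
    forall u v, u \in A -> v \in A -> e u a -> e v a -> ~~ e u b -> ~~ e v b -> e u v ->
      [/\ e p.1 a, e p.2 a & e p.1 p.2]].
  have [[u [v [[uA vA ua va] uv]]]|no] := pselect (exists u v,
      [/\ u \in A, v \in A, e u a & e v a] /\ [/\ ~~ e u b, ~~ e v b & e u v]).
    by exists (u, v); split=> //; case: uv.
  exists (x, x); split=> // u v uA vA ua va ub vb uv; case: no; exists u, v.
  by split.
have [[u1 v1] /= [u1A v1A h1]] := pick_edge x y.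
have [[u2 v2] /= [u2A v2A h2]] := pick_edge y x.
have key a b p q s t : a \in A -> p \in A -> q \in A -> s \in A -> t \in A ->
    (forall u v, u \in A -> v \in A -> e u a -> e v a -> ~~ e u b -> ~~ e v b -> e u v ->
      [/\ e p a, e q a & e p q]) ->
    e s a -> ~~ e s b -> e t a -> ~~ e t b -> e s t -> e s p = e t p -> e s q = e t q -> False.
  move=> aA pA qA sA tA hpq sa sb ta tb st sp sq.
  have [pa qa pq] := hpq s t sA tA sa ta sb tb st.
  have [tp|tp] := boolP (e t p).
    by apply: (K4 s t a p) => //; rewrite ?sp // esy.
  have [tq|tq] := boolP (e t q).
    by apply: (K4 s t a q) => //; rewrite ?sq // esy.
  by apply: (no2 s t p q); rewrite /two_k2 sp sq.
apply: (pebbled_iso (ps := [:: x; y; u1; v1; u2; v2]) bE E0 k10 _ K4).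
  by apply/allP; rewrite /= xA yA u1A v1A u2A v2A.
move=> s t sA tA _ h; apply/negP => st.
have [hx hy hu1 hv1] : [/\ e s x = e t x, e s y = e t y, e s u1 = e t u1 & e s v1 = e t v1].
  by split; apply: h; rewrite !inE eqxx ?orbT.
have [hu2 hv2] : e s u2 = e t u2 /\ e s v2 = e t v2.
  by split; apply: h; rewrite !inE eqxx ?orbT.
have [tx|tx] := boolP (e t x); have [ty'|ty'] := boolP (e t y).
- by apply: (K4 s t x y) => //; rewrite ?hx ?hy.
- by apply: (key x y u1 v1 s t) => //; rewrite ?hx ?hy.
- by apply: (key y x u2 v2 s t) => //; rewrite ?hx ?hy.
by apply: (no2 s t x y); rewrite /two_k2 hx hy.
Qed.

End Pebbles.

(** * Prime K4-free graphs with an induced 2K2: minimum separators of two edges *)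

Section Separator.
Variables (U W : finType) (e : rel U) (e' : rel W).
Hypotheses (esy : symmetric e) (eirr : irreflexive e) (P5 : p5free e).
Variable A : {set U}.

Definition gmodule (M : {set U}) := M \subset A /\
  forall z x y, z \in A -> z \notin M -> x \in M -> y \in M -> e z x = e z y.

Definition prime_on := forall M, gmodule M -> 1 < #|M| -> M = A.
Definition connected_on := forall x y, x \in A -> y \in A -> cn e A x y.

Hypotheses (K4 : k4free e A) (pA : prime_on).

Definition separates (S : {set U}) := S \subset A /\ exists a b c d,
  [/\ a \in A :\: S, b \in A :\: S, c \in A :\: S & d \in A :\: S] /\
  [/\ e a b, e c d & ~~ cn e (A :\: S) a c].

Variable S : {set U}.
Hypotheses (sepS : separates S) (minS : forall Z, separates Z -> #|S| <= #|Z|).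

Local Notation X := (A :\: S).
Local Notation cX := (cn e X).

(* The vertices lying in nontrivial components of [A :\: S]. *)
Definition core := [set x in X | [exists y in X, e x y]].

Lemma coreP x : reflect (x \in X /\ exists2 y, y \in X & e x y) (x \in core).
Proof.
rewrite [x \in core]in_set; apply: (iffP andP) => -[xX].
  by case/existsP => y /andP[yX xy]; split=> //; exists y.
by case=> y yX xy; split=> //; apply/existsP; exists y; rewrite yX.
Qed.

Lemma coreX x : x \in core -> x \in X. Proof. by case/coreP. Qed.
Lemma XA x : x \in X -> x \in A. Proof. by rewrite inE => /andP[]. Qed.
Lemma coreA x : x \in core -> x \in A. Proof. by move=> /coreX /XA. Qed.
Lemma cX_sym x y : cX x y -> cX y x. Proof. by rewrite cn_sym. Qed.
Lemma SA s : s \in S -> s \in A. Proof. by case: sepS => /subsetP h _; apply: h. Qed.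

Lemma edge_core x y : x \in X -> y \in X -> e x y -> x \in core /\ y \in core.
Proof. by move=> xX yX xy; split; apply/coreP; split=> //; [exists y|exists x; rewrite 1?esy]. Qed.

Lemma cX_core x y : x \in core -> cX x y -> y \in core.
Proof.
move=> xc /connectP[p]; elim: p x xc => [|z p IH] x xc /=; first by move=> _ ->.
move=> /andP[/and3P[xz xX zX] pp] yl; apply: (IH z) => //.
by have [] := edge_core xX zX xz.
Qed.

Lemma cX_cn_core x y : x \in core -> cX x y = cn e core x y.
Proof.
move=> xc; apply/idP/idP; last by apply: cn_sub; apply/subsetP => z /coreX.
move=> /connectP[p]; elim: p x xc => [|z p IH] x xc /=; first by move=> _ ->; apply: cn_refl.
move=> /andP[/and3P[xz xX zX] pp] yl; have [_ zc] := edge_core xX zX xz.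
by apply: (cn_trans (cn_edge xc zc xz)); apply: IH.
Qed.

Lemma other_core x : exists2 y, y \in core & ~~ cX x y.
Proof.
case: sepS => _ [a [b [c [d [[aX bX cX' dX] [ab cd nac]]]]]].
have [ac _] := edge_core aX bX ab; have [cc _] := edge_core cX' dX cd.
have [xa|] := boolP (cX x a); last by exists a.
by exists c => //; apply: contra nac => xc; apply: cn_trans (cX_sym xa) xc.
Qed.

(** Otherwise [s] could be taken out of [S]: the component of [x] would remain separated, against
    minimality. *)
Lemma sep_touches s x : s \in S -> x \in core -> exists y, [/\ y \in X, cX x y & e s y].
Proof.
move=> sS xc; apply: contrapT => no.
have nos y : y \in X -> cX x y -> ~~ e s y.
  by move=> yX c; apply/negP => sy; apply: no; exists y.
have [z zc nxz] := other_core x.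
have [xX [x1 x1X xx1]] := coreP _ xc; have [zX [z1 z1X zz1]] := coreP _ zc.
pose S' := S :\ s.
have sX : X \subset A :\: S'.
  by apply/subsetP => y; rewrite !inE => /andP[yS ->]; rewrite negb_and yS orbT.
have : separates S'.
  split; first by apply/subsetP => y; rewrite !inE => /andP[_]; apply: SA.
  exists x, x1, z, z1; split; first by split; apply: (subsetP sX).
  split=> //; apply/negP => cxz.
  have [u [v [cu /and3P[uv uX' vX'] /= Pu Pv]]] := boundary_edge (P := cX x) cxz (cn_refl _ _ _) nxz.
  have uX : u \in X := cn_mem Pu xX.
  have [vX|vX] := boolP (v \in X).
    by move/negP: Pv; apply; apply: (cn_trans Pu (cn_edge uX vX uv)).
  have vs : v = s.
    move: vX' vX; rewrite !inE negb_and negbK => /andP[] + vA; rewrite vA.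
    by rewrite /= andbT => h1 /negPn h2; move: h1; rewrite h2 orbF => /eqP.
  by move: (nos u uX Pu); rewrite -vs esy uv.
by move=> /minS; rewrite leqNgt => /negP; apply; rewrite [X in _ < X](cardsD1 s) sS.
Qed.

Lemma sep_mixed_once s x y v w : s \in S -> x \in core -> y \in core -> ~~ cX x y ->
  cX x v -> ~~ e s v -> cX y w -> e s w.
Proof.
move=> sS xc yc nxy xv sv yw; apply/negPn/negP => sw.
have [x1 [x1X cx1 sx1]] := sep_touches sS xc.
have [y1 [y1X cy1 sy1]] := sep_touches sS yc.
have c := mixed_once esy P5 x1X y1X (cn_trans (cX_sym cx1) xv) (cn_trans (cX_sym cy1) yw) sx1 sv sy1 sw.
by move/negP: nxy; apply; apply: (cn_trans cx1); apply: (cn_trans c); apply: cX_sym.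
Qed.

(** If all of [S] were complete to the component, it would be a module with at least two vertices,
    yet not everything since there is another nontrivial component. *)
Lemma comp_mixed x : x \in core -> exists s v, [/\ s \in S, v \in X, cX x v & ~~ e s v].
Proof.
move=> xc; apply: contrapT => no.
pose C := [set v in X | cX x v].
have [xX [y yX xy]] := coreP _ xc.
have mC : gmodule C.
  split; first by apply/subsetP => v; rewrite inE => /andP[/XA].
  move=> z u v zA; rewrite !inE => zC /andP[uX xu] /andP[vX xv].
  have [zS|zS] := boolP (z \in S).
    have h t : t \in X -> cX x t -> e z t.
      by move=> tX xt; apply/negPn/negP => nzt; apply: no; exists z, t.
    by rewrite !h // inE.
  have zX : z \in X by rewrite inE zS.
  have h t : t \in X -> cX x t -> e z t = false.
    move=> tX xt; apply/negP => zt; move: zC; rewrite zS zA /= => /negP; apply.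
    by apply: cn_trans xt (cn_edge tX zX _); rewrite esy.
  by rewrite !h // inE.
have CA : C = A.
  apply: (pA mC).
  apply/card_gt1P; exists x, y; split.
  - by rewrite [x \in C]in_set xX cn_refl.
  - by rewrite [y \in C]in_set yX cn_edge.
  by apply/eqP => h; move: xy; rewrite h eirr.
have [z zc nxz] := other_core x.
by have := coreA zc; rewrite -CA inE (negPf nxz) andbF.
Qed.

(** A vertex of [S] missing some vertex of another component is complete to this one. With
    K4-freeness this rules out triangles in the component. *)
Lemma comp_complete x : x \in core -> exists2 s, s \in S & forall v, cX x v -> e s v.
Proof.
move=> xc; have [y yc nxy] := other_core x.
have [s [v [sS vX yv sv]]] := comp_mixed yc; exists s => // w xw.
by apply: (sep_mixed_once sS yc xc _ yv sv xw); rewrite cn_sym.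
Qed.

Lemma comp_triangle_free x a b c : x \in core -> cX x a -> cX x b -> cX x c ->
  e a b -> e a c -> e b c -> False.
Proof.
move=> xc xa xb xcc ab ac bc; have [s sS hs] := comp_complete xc.
have xX := coreX xc.
apply: (K4 (SA sS) (XA (cn_mem xa xX)) (XA (cn_mem xb xX)) (XA (cn_mem xcc xX))) => //; exact: hs.
Qed.

(* In a connected P5-free graph, if c d is far from a b, then no vertex next to N[a,b] is next
   to c d (it would extend b - a - u - c to a P5 by d), and the first far vertex on the way from
   c to a extends b - a - u - q by its predecessor. *)
Lemma comp_no_2k2 x a b c d : x \in core -> cX x a -> cX x b -> cX x c -> cX x d ->
  e a b -> e c d -> ~~ e a c -> ~~ e a d -> ~~ e b c -> ~~ e b d -> False.
Proof.
move=> xc xa xb xcc xd ab cd nac nad nbc nbd.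
have xX := coreX xc.
pose far v := ~~ e v a && ~~ e v b.
have tri u : cX x u -> e u a -> e u b -> False.
  move=> xu ua ub; apply: (comp_triangle_free xc xu xa xb) => //.
have P5' u q p : cX x u -> ~~ far u -> u != a -> u != b -> far q -> far p -> e u q -> ~~ e u p -> e q p -> False.
  move=> xu nfu ua ub /andP[qa qb] /andP[pa pb] uq up qp.
  have [qa' qb' pa' pb'] : [/\ ~~ e a q, ~~ e b q, ~~ e a p & ~~ e b p].
    by rewrite ![e a _]esy ![e b _]esy.
  have ba : e b a by rewrite esy.
  move: nfu; rewrite /far negb_and !negbK => /orP[h|h].
    apply: (P5 (a := b) (b := a) (c := u) (d := q) (f := p)) => //; first by rewrite esy.
    by rewrite esy; apply/negP => h2; apply: (tri u).
  apply: (P5 (a := a) (b := b) (c := u) (d := q) (f := p)) => //; first by rewrite esy.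
  by rewrite esy; apply/negP => h2; apply: (tri u).
pose deep v := far v && [forall u in X, e u v ==> far u].
have fc : far c by rewrite /far ![e c _]esy nac.
have fd : far d by rewrite /far ![e d _]esy nad.
have nba u v : far v -> e u v -> u != a.
  by move=> /andP[h _] uv; apply/eqP => ua; rewrite esy -ua uv in h.
have nbb u v : far v -> e u v -> u != b.
  by move=> /andP[_ h] uv; apply/eqP => ua; rewrite esy -ua uv in h.
have cXn u v : cX x v -> u \in X -> e u v -> cX x u.
  by move=> xv uX uv; apply: (cn_trans xv); apply: cn_edge; rewrite 1?esy //; apply: cn_mem xv xX.
have dc : deep c.
  rewrite /deep fc /=; apply/forallP => u; apply/implyP => uX; apply/implyP => uc.
  apply/negPn/negP => nfu; have xu := cXn _ _ xcc uX uc.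
  apply: (P5' u c d) => //; [exact: nba uc | exact: nbb uc |].
  apply/negP => ud; exact: (comp_triangle_free xc xu xcc xd).
have nda : ~~ deep a by rewrite /deep /far ab andbF.
have cca : cX c a := cn_trans (cX_sym xcc) xa.
have [p [q [cp /and3P[pq pX qX] dp dq]]] := boundary_edge cca dc nda.
have xp := cn_trans xcc cp; have xq := cn_trans xp (cn_edge pX qX pq).
have fp : far p by case/andP: dp.
have fq : far q.
  by case/andP: dp => _ /forallP /(_ q); rewrite qX /= => /implyP; apply; rewrite esy.
move: dq; rewrite /deep fq /= negb_forall => /existsP[u].
rewrite negb_imply negb_imply => /and3P[uX uq nfu].
apply: (P5' u q p) => //; [exact: cXn xq uX uq|exact: nba uq|exact: nbb uq| |by rewrite esy].
apply/negP => up; case/andP: dp => _ /forallP /(_ u); rewrite uX /= => /implyP /(_ up).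
exact/negP.
Qed.

(** An edge [u v] would form a triangle with a common neighbour among [p], [q], or else a 2K2 with
    [p q]; components contain neither. *)
Lemma comp_types x p q u v : x \in core -> cX x p -> cX x q -> cX x u -> cX x v -> e p q ->
  e u p = e v p -> e u q = e v q -> ~~ e u v.
Proof.
move=> xc xp xq xu xv pq up uq; apply/negP => uv.
have [vp|vp] := boolP (e v p).
  by apply: (comp_triangle_free xc xu xv xp) => //; rewrite up.
have [vq|vq] := boolP (e v q).
  by apply: (comp_triangle_free xc xu xv xq) => //; rewrite uq.
by apply: (comp_no_2k2 xc xp xq xu xv pq uv); rewrite esy ?up ?uq.
Qed.

(** Pebble an edge in each of the two components. A vertex of [S] is complete to one of them and so
    sees a whole pebbled edge, which adjacent type mates cannot do without a K4. Adjacent type mates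
    therefore lie in one component, against [comp_types]. *)
Lemma sep_two_iso k B E : bisim e e' k A B E -> E [::] [::] -> 8 <= k ->
  (forall x y z, x \in core -> y \in core -> z \in core -> [|| cX x y, cX x z | cX y z]) ->
  iso_on e e' A B E.
Proof.
move=> bE E0 k8 two.
case: (sepS) => _ [a [b [c [d [[aX bX cX' dX] [ab cd nac]]]]]].
have [ac bc] := edge_core aX bX ab; have [cc dc] := edge_core cX' dX cd.
have cab := cn_edge aX bX ab; have ccd := cn_edge cX' dX cd.
apply: (pebbled_iso esy P5 (ps := [:: a; b; c; d]) bE E0 k8 _ K4).
  by apply/allP; rewrite /= !XA.
move=> u v uA vA _ h; apply/negP => uv.
have [ha hb hc hd] : [/\ e u a = e v a, e u b = e v b, e u c = e v c & e u d = e v d].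
  by split; apply: h; rewrite !inE eqxx ?orbT.
have nab : ~~ (e u a && e u b).
  apply/negP => /andP[ua ub].
  by apply: (K4 uA vA (XA aX) (XA bX)); rewrite // -?ha -?hb.
have ncd : ~~ (e u c && e u d).
  apply/negP => /andP[ua ub].
  by apply: (K4 uA vA (XA cX') (XA dX)); rewrite // -?hc -?hd.
have inX s : ~~ (e s a && e s b) -> ~~ (e s c && e s d) -> s \in A -> s \in X.
  move=> sab scd sA; rewrite inE sA andbT; apply/negP => sS.
  have [w aw sw] : exists2 w, cX a w & ~~ e s w.
    by move: sab; rewrite negb_and => /orP[?|?]; [exists a => //; apply: cn_refl | exists b].
  by move/negP: scd; apply; rewrite !(sep_mixed_once sS ac cc nac aw sw) ?cn_refl.
have uX := inX _ nab ncd uA.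
have vX : v \in X by apply: inX vA; rewrite -?ha -?hb -?hc -?hd.
have [uc vc] := edge_core uX vX uv; have cuv := cn_edge uX vX uv.
have := two a c u ac cc uc; rewrite (negPf nac) /= => /orP[au|cu].
  have := comp_types ac (cn_refl _ _ _) cab au (cn_trans au cuv) ab ha hb; by rewrite uv.
have := comp_types cc (cn_refl _ _ _) ccd cu (cn_trans cu cuv) cd hc hd; by rewrite uv.
Qed.

Section Three.
Variables x1 x2 x3 : U.
Hypotheses (c1 : x1 \in core) (c2 : x2 \in core) (c3 : x3 \in core).
Hypotheses (n12 : ~~ cX x1 x2) (n13 : ~~ cX x1 x3) (n23 : ~~ cX x2 x3).

Definition cmpl s x := [forall w, cX x w ==> e s w].

Lemma cmplP s x : reflect (forall w, cX x w -> e s w) (cmpl s x).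
Proof.
apply: (iffP forallP) => h w; first by move: (h w) => /implyP.
by apply/implyP; apply: h.
Qed.

Lemma cmpl_self s x : cmpl s x -> e s x. Proof. by move/cmplP; apply; apply: cn_refl. Qed.

Lemma cmpl_or s x y : s \in S -> x \in core -> y \in core -> ~~ cX x y -> cmpl s x || cmpl s y.
Proof.
move=> sS xc yc nxy; have [//|nx] := boolP (cmpl s x).
move: nx; rewrite negb_forall => /existsP[v]; rewrite negb_imply => /andP[xv sv].
by apply/cmplP => w yw; exact: (sep_mixed_once sS xc yc nxy xv sv yw).
Qed.

Lemma cmpl3 s : s \in S -> [/\ cmpl s x1 || cmpl s x2, cmpl s x1 || cmpl s x3 & cmpl s x2 || cmpl s x3].
Proof. by move=> sS; split; apply: cmpl_or. Qed.

Lemma core_edge x : x \in core -> exists y, [/\ y \in core, e x y & cX x y].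
Proof.
case/coreP => xX [y yX xy]; exists y; split=> //; last exact: cn_edge.
by have [] := edge_core xX yX xy.
Qed.

(** Each of [s] and [t] is complete to at least two of the three components, hence both to a common
    one, where any edge completes a K4. *)
Lemma S_indep s t : s \in S -> t \in S -> ~~ e s t.
Proof.
move=> sS tS; apply/negP => st.
have [x xc /andP[sx tx]] : exists2 x, x \in core & cmpl s x && cmpl t x.
  apply: contrapT => no; have nx x : x \in core -> ~~ (cmpl s x && cmpl t x).
    by move=> xc; apply/negP => h; apply: no; exists x.
  move: (nx _ c1) (nx _ c2) (nx _ c3) => {nx no}.
  have [] := cmpl3 sS; have [] := cmpl3 tS.
  by do 6 case: (cmpl _ _).
have [y [yc xy cxy]] := core_edge xc.
apply: (K4 (SA sS) (SA tS) (coreA xc) (coreA yc)) => //.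
- exact: cmpl_self.
- by move/cmplP: sx; apply.
- exact: cmpl_self.
by move/cmplP: tx; apply.
Qed.

(** A vertex of [S] is complete to at least two of the components, whereas any other vertex has
    neighbours in at most one. Pebbles on [x1], [x2], [x3] thus make [S] recognizable. *)
Lemma S_count u : u \in A ->
  (u \in S) = [|| e u x1 && e u x2, e u x1 && e u x3 | e u x2 && e u x3].
Proof.
move=> uA; have [uS|uS] := boolP (u \in S).
  have [] := cmpl3 uS; have h x : cmpl u x ==> e u x by apply/implyP; apply: cmpl_self.
  move: (h x1) (h x2) (h x3).
  by do 3 case: (cmpl _ _); case: (e u x1); case: (e u x2); case: (e u x3).
have uX : u \in X by rewrite inE uS.
have no x y : x \in core -> y \in core -> ~~ cX x y -> (e u x && e u y) = false.
  move=> xc yc nxy; apply/negP => /andP[ux uy]; move/negP: nxy; apply.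
  apply: (cn_trans (cn_edge (coreX xc) uX _)); first by rewrite esy.
  exact: cn_edge uX (coreX yc) uy.
by rewrite !no.
Qed.

Lemma triv_edge d x : d \in X -> d \notin core -> x \in X -> ~~ e d x.
Proof. by move=> dX dc xX; apply: contra dc => dx; have [] := edge_core dX xX dx. Qed.

Lemma core_off f v y : mix e A core f v -> y \in core -> ~~ cn e core v y -> e f y.
Proof.
case/and5P => fA fc /existsP[z /andP[zc fz]] vc fv yc nvy.
have fS : f \in S.
  apply/negPn/negP => fS; have fX : f \in X by rewrite inE fS.
  by move: (triv_edge fX fc (coreX zc)); rewrite fz.
by apply: (sep_mixed_once fS vc yc _ (cn_refl _ _ _) fv (cn_refl _ _ _)); rewrite cX_cn_core.
Qed.

Lemma mix_S f v : mix e A core f v -> f \in S.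
Proof.
case/and5P => fA fc /existsP[z /andP[zc fz]] vc fv.
apply/negPn/negP => fS; have fX : f \in X by rewrite inE fS.
by move: (triv_edge fX fc (coreX zc)); rewrite fz.
Qed.

(** Some component off that of [v] is complete to both [s] and [t]; with [x] in it,
    [d - s - x - t - v] would be an induced P5. *)
Lemma triv_far d s v t : d \in X -> d \notin core -> mix e A core s v -> e d s ->
  t \in S -> cmpl t v -> e d t.
Proof.
move=> dX dc m ds tS tv; apply/negPn/negP => dt.
have /and5P[sA sc _ vc sv] := m; have sS := mix_S m.
have [x [xc nvx tx]] : exists x, [/\ x \in core, ~~ cX v x & cmpl t x].
  have [t12 t13 t23] := cmpl3 tS.
  have [v1|v1] := boolP (cX v x1).
    have v2 : ~~ cX v x2 by apply: contra n12 => h; apply: cn_trans (cX_sym v1) h.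
    have v3 : ~~ cX v x3 by apply: contra n13 => h; apply: cn_trans (cX_sym v1) h.
    by case/orP: t23 => h; [exists x2 | exists x3].
  have [v2|v2] := boolP (cX v x2).
    have v3 : ~~ cX v x3 by apply: contra n23 => h; apply: cn_trans (cX_sym v2) h.
    by case/orP: t13 => h; [exists x1 | exists x3].
  by case/orP: t12 => h; [exists x1 | exists x2].
have sx : e s x by apply: (core_off m xc); rewrite -cX_cn_core.
apply: (P5 (a := d) (b := s) (c := x) (d := t) (f := v)) => //.
- by rewrite esy; apply: cmpl_self.
- exact: cmpl_self.
- exact: triv_edge dX dc (coreX xc).
- exact: triv_edge dX dc (coreX vc).
- exact: S_indep.
by apply: (ncn_edge (coreX xc) (coreX vc)); apply: contra nvx; apply: cX_sym.
Qed.

(** If [t] is not complete to the component of [v], apply [triv_far] twice, through a vertex [s2]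
    mixed on another component, to which [t] is then complete. *)
Lemma triv_complete d s v t : d \in X -> d \notin core -> mix e A core s v -> e d s ->
  t \in S -> e d t.
Proof.
move=> dX dc m ds tS; have vc : v \in core by case/and5P: m.
have [tv|tv] := boolP (cmpl t v); first exact: triv_far m ds tS tv.
have [y yc nvy] := other_core v.
have [s2 [w [s2S wX yw s2w]]] := comp_mixed yc.
have wc := cX_core yc yw.
have nvw : ~~ cX v w by apply: contra nvy => h; apply: cn_trans h (cX_sym yw).
have s2v : cmpl s2 v.
  by apply/cmplP => z vz; apply: (sep_mixed_once s2S wc vc _ (cn_refl _ _ _) s2w vz); apply: contra nvw; apply: cX_sym.
have ds2 := triv_far dX dc m ds s2S s2v.
have m2 : mix e A core s2 w.
  apply/and5P; split=> //; first exact: SA.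
    by apply/negP => /coreX; rewrite inE s2S.
  by apply/existsP; exists v; rewrite vc; apply: cmpl_self.
apply: (triv_far dX dc m2 ds2 tS).
by have := cmpl_or tS vc wc nvw; rewrite (negPf tv).
Qed.

(** Three pebbles make [S] and the core type-closed. The parts are the nontrivial components with
    the vertices of [S] mixed on them. Within a part, types are independent in [S] by [S_indep] and,
    after pebbling one edge, in the component by [comp_types]. *)
Lemma sep_three_iso k B E : bisim e e' k A B E -> E [::] [::] -> 9 <= k -> iso_on e e' A B E.
Proof.
move=> bE E0 k9.
have subp : {subset [:: x1; x2; x3] <= A} by apply/allP; rewrite /= !coreA.
have kp : size [:: x1; x2; x3] <= k by apply: leq_trans k9.
have [qs Epq] := bs_dom bE E0 kp subp.
have bP := bisim_params bE Epq; rewrite /= in bP.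
set E1 := (fun xs ys => E (xs ++ _) (ys ++ _)) in bP.
(* Of these six pebbles, two go on an edge of a part and four remain for the independent types. *)
have k6 : 6 <= k - 3 by rewrite leq_subRL // (leq_trans _ k9).
have k4 : 3 < k - 3 by apply: leq_trans k6.
have sT := selfE_self_bisim bP Epq.
have E1sub x y : E1 [:: x] [:: y] -> E [:: x] [:: y] by move=> h; apply: bs_head bE _ _ _ _ h.
apply: (iso_on_weaken E1sub).
have tyS u v : ty (selfE E1) u v -> (u \in S) = (v \in S).
  move=> h; have [uA vA] := sb_mem sT h; have h' := params_type bE h.
  by rewrite !S_count // !(selfE_adj bE h') // !inE eqxx ?orbT.
have Xcl : ty_closed (selfE E1) X.
  by move=> u v h; rewrite !inE -(tyS _ _ h) (sb_mem sT h).2 => /andP[->].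
have cA : core \subset A by apply/subsetP => z /coreA.
have ccl : ty_closed (selfE E1) core.
  move=> u v h /coreP[uX [y yX uy]]; apply/coreP; split; first exact: Xcl h uX.
  have [z hz] := sb_ext2 sT k4 h (XA yX); exists z; first exact: Xcl (sb_hd sT hz) yX.
  by rewrite -(sb_adj sT (sb_sw sT hz)).
have Req := mixrel_equiv esy core_off.
have Rinv x y u v : selfE E1 [:: x; y] [:: u; v] -> mixrel e A core x y -> mixrel e A core u v.
  exact: (mixrel_inv sT k4 cA ccl).
have Rsym x y : mixrel e A core x y = mixrel e A core y x by apply: ixrel_sym.
have cross x y u v : x \in A -> y \in A -> ty (selfE E1) x u -> ty (selfE E1) y v ->
   ~~ mixrel e A core x y -> ~~ mixrel e A core u v -> e x y -> e u v.
  have SI a b p q : a \in S -> b \in X -> b \notin core -> ty (selfE E1) a p -> ty (selfE E1) b q ->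
      ~~ mixrel e A core a b -> e a b -> e p q.
    move=> aS bX bc ap bq nR ab.
    have [ia|ia] := boolP (indexed core (bel e A core) a); last first.
      move: nR; rewrite /mixrel (ixrel_none _ ia) negbK => /indexedP[z zc /(belF bc)[w]].
      by case/and5P => _ _ /existsP[t /andP[tc bt]]; move: (triv_edge bX bc (coreX tc)); rewrite bt.
    case/indexedP: ia => z zc /belF [|w m _]; first by apply/negP => /coreX; rewrite inE aS.
    have [a2 ha] := sb_ext2 sT k4 bq (SA aS); have aa := sb_hd sT ha.
    have wA : w \in A by case/and5P: m => _ _ _ /coreA.
    have [w2 hw] := sb_ext2 sT k4 aa wA.
    have m2 := mix_inv sT k4 cA ccl (sb_sw sT hw) m.
    have qX := Xcl _ _ bq bX; have qc : q \notin core by rewrite -(ty_closed_eq sT ccl bq).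
    rewrite esy; apply: (triv_complete qX qc m2); last by rewrite -(tyS _ _ ap).
    by rewrite esy -(sb_adj sT ha).
  move=> xA yA xu yv nR nR' xy.
  have [xc|xc] := boolP (x \in core).
    exact: (mixrel_cross_in esy sT k4 cA ccl core_off (x := x) (y := y)).
  have [yc|yc] := boolP (y \in core).
    rewrite esy; apply: (mixrel_cross_in esy sT k4 cA ccl core_off (x := y) (y := x)) => //;
      by rewrite 1?Rsym 1?esy.
  have [xS|xS] := boolP (x \in S); have [yS|yS] := boolP (y \in S).
  - by move: (S_indep xS yS); rewrite xy.
  - by apply: (SI x y) => //; rewrite inE yS.
  - by rewrite esy; apply: (SI y x) => //; rewrite 1?Rsym 1?esy // inE xS.
  have xX : x \in X by rewrite inE xS.
  have yX : y \in X by rewrite inE yS.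
  by move: (triv_edge xX xc yX); rewrite xy.
apply: (decomposition bP (ltnW k4) Epq Req Rinv).
  move=> x y u v xA yA xu yv nR nR'.
  have uA := (sb_mem sT xu).2; have vA := (sb_mem sT yv).2.
  apply/idP/idP; first exact: (cross x y u v xA yA xu yv).
  apply: (cross u v x y) => //; exact: selfE_sym.
move=> x x' Ex E2 bE2 E20 sub; have [xA _] := bs_mem bP Ex.
have K4' : k4free e (cls A (mixrel e A core) x).
  by move=> a b c d; rewrite !inE => /andP[? _] /andP[? _] /andP[? _] /andP[? _]; apply: K4.
have ty2 u v : selfE E2 [:: u] [:: v] -> (u \in S) = (v \in S).
  by move=> [ys h1 h2]; apply: tyS; exists ys; apply: sub.
have belc z : z \in core -> bel e A core z z by move=> zc; rewrite belY ?cn_refl.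
have [/indexedP[z zc bz]|nx] := boolP (indexed core (bel e A core) x).
  have [w [wc zw czw]] := core_edge zc.
  apply: (pebbled_iso esy P5 (ps := [:: z; w]) bE2 E20 k6 _ K4').
    apply/allP; rewrite /= !inE !coreA //= !(mixrelP esy core_off _ bz) // belc // (belY _ _ _ wc).
    by rewrite -cX_cn_core // cX_sym.
  move=> u v; rewrite !inE !(mixrelP esy core_off _ bz) // => /andP[uA bu] /andP[vA bv] h hp.
  have [uS|uS] := boolP (u \in S); first by apply: S_indep => //; rewrite -(ty2 _ _ h).
  have uX : u \in X by rewrite inE uS.
  have vX : v \in X by rewrite inE -(ty2 _ _ h) uS.
  apply/negP => uv; have [uc vc] := edge_core uX vX uv.
  move: bu bv; rewrite !belY // -!cX_cn_core // => zu zv.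
  have [hz hw] : e u z = e v z /\ e u w = e v w by split; apply: hp; rewrite !inE eqxx ?orbT.
  by have := comp_types zc (cn_refl _ _ _) czw (cX_sym zu) (cX_sym zv) zw hz hw; rewrite uv.
apply: (pebbled_iso esy P5 (ps := [::]) bE2 E20 k4 _ K4') => //.
move=> u v; rewrite !inE /mixrel !(ixrel_none _ nx) => /andP[uA iu] /andP[vA iv] h _.
have [uS|uS] := boolP (u \in S); first by apply: S_indep => //; rewrite -(ty2 _ _ h).
have uX : u \in X by rewrite inE uS.
have vX : v \in X by rewrite inE -(ty2 _ _ h) uS.
apply/negP => uv; have [uc vc] := edge_core uX vX uv.
by move/negP: iu; apply; apply/indexedP; exists u => //; apply: belc.
Qed.

End Three.
End Separator.

(** The cases are: no induced 2K2, and a minimum separator leaving at least three, or only two,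
    nontrivial components. *)
Theorem k4free_prime_iso (U W : finType) (e : rel U) (e' : rel W) k A B E :
  symmetric e -> irreflexive e -> p5free e -> k4free e A -> prime_on e A ->
  bisim e e' k A B E -> E [::] [::] -> 10 <= k -> iso_on e e' A B E.
Proof.
move=> esy eirr P5 K4 pA bE E0 k10.
have [[a [b [c [d [[aA bA cA dA] [[ab cd ac ad] [bc bd]]]]]]]|no2] :=
  pselect (exists a b c d, two_k2 e A a b c d); last first.
  by apply: (two_k2_free_iso esy P5 eirr bE E0 k10 K4) => a b c d h; apply: no2; exists a, b, c, d.
pose D := [set a; b; c; d].
(* Deleting all but the four vertices of an induced 2K2 separates its two edges. *)
have exS : separates e A (A :\: D).
  split; first exact: subsetDl.
  have DX : A :\: (A :\: D) = D.
    rewrite setDDr setDv set0U; apply/setIidPr/subsetP => z.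
    by rewrite !inE -!orbA => /or4P[] /eqP ->.
  rewrite DX; exists a, b, c, d; split; first by split; rewrite !inE eqxx ?orbT.
  split=> //; apply/negP => cac.
  have [||u [v [_ /and3P[uv uD vD] Pu Pv]]] := boundary_edge (P := [pred z | (z == a) || (z == b)]) cac.
  - by rewrite /= eqxx.
  - rewrite /= negb_or; apply/andP; split; apply/eqP => h.
      by move: ac ad; rewrite -h cd.
    by move: bd; rewrite -h cd.
  move: uv Pu Pv uD vD; rewrite /= !inE -!orbA => uv /orP[]/eqP uE.
    rewrite {}uE in uv *; rewrite negb_or => /andP[va vb] _; rewrite (negPf va) (negPf vb) /=.
    by case/orP => /eqP vE; move: ac ad; rewrite -vE uv.
  rewrite {}uE in uv *; rewrite negb_or => /andP[va vb] _; rewrite (negPf va) (negPf vb) /=.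
  by case/orP => /eqP vE; move: bc bd; rewrite -vE uv.
pose P (Z : {set U}) := `[< separates e A Z >].
have PY : P (A :\: D) by apply/asboolP.
case: (arg_minnP (fun Z : {set U} => #|Z|) PY) => S /asboolP sepS mS.
have minS Z : separates e A Z -> #|S| <= #|Z| by move=> hZ; apply: mS; apply/asboolP.
have [[x1 [x2 [x3 [[c1 c2 c3] [n12 n13 n23]]]]]|no3] := pselect (exists x1 x2 x3,
   [/\ x1 \in core e A S, x2 \in core e A S & x3 \in core e A S] /\
   [/\ ~~ cn e (A :\: S) x1 x2, ~~ cn e (A :\: S) x1 x3 & ~~ cn e (A :\: S) x2 x3]).
  exact: (sep_three_iso esy eirr P5 K4 pA sepS minS c1 c2 c3 n12 n13 n23 bE E0 (ltnW k10)).
apply: (sep_two_iso esy eirr P5 K4 pA sepS minS bE E0 (ltnW (ltnW k10))) => x y z xc yc zc.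
apply/negPn/negP; rewrite !negb_or => /and3P[n1 n2 n3]; apply: no3.
by exists x, y, z.
Qed.

(** * Prime graphs with a K4: complete multipartite blobs *)

Section Blobs.
Variables (U W : finType) (e : rel U) (e' : rel W).
Hypotheses (esy : symmetric e) (eirr : irreflexive e) (P5 : p5free e).

Definition k4 a b c d := [&& e a b, e a c, e a d, e b c, e b d & e c d].
Definition deg4 v a b c d : nat := e v a + e v b + e v c + e v d.

(* A vertex of K4 has three neighbours in it, so excluding the pattern "K4 plus a vertex with
   exactly two neighbours in it" bans the value 2 altogether. *)
Definition qfree := forall a b c d v, k4 a b c d -> deg4 v a b c d != 2.
Hypothesis Qf : qfree.

Variable A : {set U}.

(* A complete multipartite set with at least four parts such that every outside vertex has
   neighbours in at most one part. *)
Record blob (M : {set U}) : Prop := Blob {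
  blob_sub : {subset M <= A};
  blob_part : forall u v w, u \in M -> v \in M -> w \in M -> ~~ e u v -> ~~ e v w -> ~~ e u w;
  blob_out : forall z u v, z \in A -> z \notin M -> u \in M -> v \in M -> e z u -> e z v -> ~~ e u v;
  blob_many : forall u v w, u \in M -> v \in M -> w \in M ->
    exists c, [/\ c \in M, e c u, e c v & e c w] }.

Definition blob4 a b c d := [set v in A | 2 < deg4 v a b c d].

(** A blob vertex can replace one of [a], [b], [c], [d] in the K4, and since two neighbours in a K4
    are impossible, the new K4 has the same blob ([get1]). Hence each property is checked on a K4
    through one of the vertices concerned. *)
Lemma blob4P a b c d : a \in A -> b \in A -> c \in A -> d \in A -> k4 a b c d ->
  blob (blob4 a b c d) /\ [/\ a \in blob4 a b c d, b \in blob4 a b c d,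
                              c \in blob4 a b c d & d \in blob4 a b c d].
Proof.
move=> aA bA cA dA K; have /and5P[ab ac ad bc /andP[bd cd]] := K.
have deg3 z p q r s : k4 p q r s -> 1 < deg4 z p q r s -> 2 < deg4 z p q r s.
  by move=> /Qf h h1; rewrite ltn_neqAle eq_sym h h1.
have mem : [/\ a \in blob4 a b c d, b \in blob4 a b c d,
               c \in blob4 a b c d & d \in blob4 a b c d].
  rewrite !inE aA bA cA dA /deg4 !eirr ![e b a]esy ![e c a]esy ![e d a]esy.
  by rewrite ![e c b]esy ![e d b]esy ![e d c]esy ab ac ad bc bd cd.
have get1 v : 2 < deg4 v a b c d -> exists p q r, k4 v p q r /\
    (forall z, 1 < e z v + e z p + e z q + e z r -> 2 < deg4 z a b c d) /\
    (forall z, 2 < deg4 z a b c d -> 1 < e z p + e z q + e z r /\ 2 < deg4 z v p q r).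
  have exch p q r s : k4 p q r s -> e v q -> e v r -> e v s ->
     (forall z, deg4 z p q r s = deg4 z a b c d) -> k4 v q r s /\
     (forall z, 1 < e z v + e z q + e z r + e z s -> 2 < deg4 z a b c d) /\
     (forall z, 2 < deg4 z a b c d -> 1 < e z q + e z r + e z s /\ 2 < deg4 z v q r s).
    move=> Kp vq vr vs deq; have /and5P[pq pr ps qr /andP[qs rs]] := Kp.
    have Kv : k4 v q r s by rewrite /k4 vq vr vs qr qs rs.
    split=> //; split=> z.
      move=> /(deg3 z v q r s Kv) h; rewrite -deq; apply: deg3 Kp _; move: h; rewrite /deg4.
      by case: (e z v); case: (e z p); case: (e z q); case: (e z r); case: (e z s).
    rewrite -deq => h.
    have h2 : 1 < e z q + e z r + e z s.
      move: h; rewrite /deg4.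
      by case: (e z p); case: (e z q); case: (e z r); case: (e z s).
    split=> //; apply: deg3 Kv _; rewrite /deg4 -!addnA; apply: leq_trans (leq_addl _ _).
    by rewrite !addnA.
  rewrite /deg4 => dv.
  have Kb : k4 b a c d by rewrite /k4 esy ab bc bd ac ad cd.
  have Kc : k4 c a b d by rewrite /k4 [e c a]esy [e c b]esy ac bc cd ab ad bd.
  have Kd : k4 d a b c by rewrite /k4 ![e d _]esy ad bd cd ab ac bc.
  have [va|va] := boolP (e v a); last first.
    by exists b, c, d; apply: (exch a) => //; move: dv; rewrite (negPf va);
       case: (e v b); case: (e v c); case: (e v d).
  have [vb|vb] := boolP (e v b); last first.
    by exists a, c, d; apply: (exch b) => //; try (by move: dv; rewrite va (negPf vb);
       case: (e v c); case: (e v d)); move=> z; rewrite /deg4 [e z b + _]addnC.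
  have [vc|vc] := boolP (e v c); last first.
    exists a, b, d; apply: (exch c) => //; try (by move: dv; rewrite va vb (negPf vc);
       case: (e v d)); by move=> z; rewrite /deg4 [_ + e z c]addnC addnA.
  exists a, b, c; apply: (exch d) => // z; by rewrite /deg4 [RHS]addnC !addnA.
split=> //; split.
- by move=> z; rewrite inE => /andP[].
- move=> u v w; rewrite !inE => /andP[_ du] /andP[_ dv] /andP[_ dw] uv vw; apply/negP => uw.
  have [p [q [r [Kv [_ h]]]]] := get1 v dv.
  have [_ hu] := h u du; have [_ hw] := h w dw.
  have [up uq ur] : [/\ e u p, e u q & e u r].
    by move: hu; rewrite /deg4 (negPf uv); case: (e u p); case: (e u q); case: (e u r).
  have [wp wq wr] : [/\ e w p, e w q & e w r].
    by move: hw; rewrite /deg4 [e w v]esy (negPf vw); case: (e w p); case: (e w q); case: (e w r).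
  have /and5P[vp vq vr pq _] := Kv.
  have Kn : k4 u w p q by rewrite /k4 uw up uq wp wq pq.
  by have := Qf v Kn; rewrite /deg4 [e v u]esy (negPf uv) (negPf vw) vp vq.
- move=> z u v zA zM; rewrite !inE => /andP[uA du] /andP[vA dv] zu zv; apply/negP => uv.
  have [p [q [r [Ku [h1 h2]]]]] := get1 u du.
  have [hv _] := h2 v dv.
  have /and5P[up uq ur pq /andP[pr qr]] := Ku.
  have z1 : ~~ (1 < e z u + e z p + e z q + e z r).
    by apply: contra zM => /h1; rewrite inE zA.
  have key s t : k4 u v s t -> ~~ e z s -> ~~ e z t -> False.
    by move=> /(Qf z); rewrite /deg4 zu zv => + zs zt; rewrite (negPf zs) (negPf zt).
  have [zp zq zr] : [/\ ~~ e z p, ~~ e z q & ~~ e z r].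
    by move: z1; rewrite zu; case: (e z p); case: (e z q); case: (e z r).
  have [vp|vp] := boolP (e v p); have [vq|vq] := boolP (e v q); last 2 first.
  + apply: (key q r) => //; rewrite /k4 uv uq ur vq qr andbT /=.
    by move: hv; rewrite (negPf vp) vq; case: (e v r).
  + by move: hv; rewrite (negPf vp) (negPf vq); case: (e v r).
  + by apply: (key p q) => //; rewrite /k4 uv up uq vp vq pq.
  apply: (key p r) => //; rewrite /k4 uv up ur vp pr andbT /=.
  by move: hv; rewrite (negPf vq) vp; case: (e v r).
(* Three vertices miss at most one of [a], [b], [c], [d] each, so one of these four sees all
   three. *)
move=> u v w; rewrite !inE => /andP[_ du] /andP[_ dv] /andP[_ dw].
have [aM bM cM dM] := mem.
apply: contrapT => no.
have nx x : x \in blob4 a b c d -> ~~ [&& e u x, e v x & e w x].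
  by move=> xM; apply/negP => /and3P[ux vx wx]; apply: no; exists x; rewrite ![e x _]esy.
move: (nx a aM) (nx b bM) (nx c cM) (nx d dM) du dv dw; rewrite /deg4.
case: (e u a); case: (e u b); case: (e u c); case: (e u d) => //=;
case: (e v a); case: (e v b); case: (e v c); case: (e v d) => //=;
by case: (e w a); case: (e w b); case: (e w c); case: (e w d).
Qed.

Hypotheses (pA : prime_on e A) (conA : connected_on e A).

Section OneBlob.
Variable M : {set U}.
Hypothesis bM : blob M.

Let MA p : p \in M -> p \in A. Proof. exact: (blob_sub bM). Qed.
Let out z u v : z \in A -> z \notin M -> u \in M -> v \in M -> e z u -> e u v -> ~~ e z v.
Proof.
by move=> zA zM uM vM zu uv; apply/negP => zv; move: (blob_out bM zA zM uM vM zu zv); rewrite uv.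
Qed.

(* Otherwise the union of all parts other than those of p1 and p2 is a module. *)
Lemma blob_third p1 p2 : p1 \in M -> p2 \in M -> exists z q,
  [/\ z \in A, z \notin M, q \in M & e z q] /\ e q p1 /\ e q p2.
Proof.
move=> p1M p2M; apply: contrapT => no.
pose C := [set q in M | e q p1 && e q p2].
have mC : gmodule e A C.
  split; first by apply/subsetP => q; rewrite inE => /andP[/MA].
  move=> z u v zA zC; rewrite !inE => /and3P[uM up1 up2] /and3P[vM vp1 vp2].
  have [zM|zM] := boolP (z \in M); last first.
    have h t : t \in M -> e t p1 -> e t p2 -> e z t = false.
      by move=> tM t1 t2; apply/negP => zt; apply: no; exists z, t.
    by rewrite !h.
  have h t p : t \in M -> p \in M -> e t p -> ~~ e z p -> e z t.
    move=> tM pM tp zp; apply/negPn/negP => zt; move: (blob_part bM tM zM pM).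
    by rewrite [e t z]esy tp => /(_ zt zp).
  move: zC; rewrite inE zM /= negb_and => /orP[n1|n2].
    by rewrite (h u p1) // (h v p1).
  by rewrite (h u p2) // (h v p2).
have CA : C = A.
  apply: (pA mC); have [c1 [c1M c11 c12 _]] := blob_many bM p1M p2M p2M.
  have [c2 [c2M c21 c22 c2c]] := blob_many bM p1M p2M c1M.
  apply/card_gt1P; exists c1, c2; rewrite !inE c1M c11 c12 c2M c21 c22; split=> //.
  by apply/eqP => h; move: c2c; rewrite h eirr.
by have := MA p1M; rewrite -CA inE eirr andbF.
Qed.

Definition attached z := [exists p in M, e z p].

Lemma attachedP z : reflect (exists2 p, p \in M & e z p) (attached z).
Proof. by apply: (iffP existsP) => [[p /andP[]]|[p h1 h2]]; exists p => //; rewrite h1. Qed.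

(** On a path from the blob, a first vertex [v] violating this would start an induced P5
    [v - u - z - p - c] ending in the blob. *)
Lemma blob_near p0 w : p0 \in M -> w \in A -> w \notin M -> ~~ attached w ->
  exists z, [/\ z \in A, z \notin M, attached z & e w z].
Proof.
move=> p0M wA wM nw; apply: contrapT => no.
pose P v := [|| v \in M, attached v | [exists z, [&& z \in A, z \notin M, attached z & e v z]]].
have Pp : P p0 by rewrite /P p0M.
have nPw : ~~ P w.
  rewrite /P !negb_or wM nw; apply/negP => /existsP[z /and4P[zA zM az wz]].
  by apply: no; exists z.
have [u [v [_ /and3P[uv uA vA] Pu]]] := boundary_edge (conA (MA p0M) wA) Pp nPw.
rewrite /P !negb_or => /and3P[vM nv nev].
have noat x p : ~~ attached x -> p \in M -> ~~ e x p.
  by move=> nx pM; apply: contra nx => xp; apply/attachedP; exists p.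
have [uM|uM] := boolP (u \in M); first by move: (noat v u nv uM); rewrite esy uv.
have [au|nu] := boolP (attached u).
  by move/negP: nev; apply; apply/existsP; exists u; rewrite uA uM au esy.
have [z zA] : exists2 z, z \in A & [/\ z \notin M, attached z & e u z].
  move: Pu; rewrite /P (negPf uM) (negPf nu) /= => /existsP[z /and4P[zA zM az uz]].
  by exists z.
case=> zM /attachedP[p pM zp] uz.
have [c [cM cp _ _]] := blob_many bM pM pM pM.
apply: (P5 (a := v) (b := u) (c := z) (d := p) (f := c)) => //; try exact: noat.
- by rewrite esy.
- by rewrite esy.
- apply/negP => vz; move/negP: nev; apply; apply/existsP; exists z; rewrite zA zM vz andbT.
  by apply/attachedP; exists p.
by apply: (out zA zM pM) => //; rewrite esy.
Qed.

(** Take [d] in the blob adjacent to [p] and to attachments of [y] and [y']: then [d] misses [y] and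
    [y'], and [d - p - z - y - y'] would be an induced P5. *)
Lemma blob_far z y y' p : z \in A -> z \notin M -> y \in A -> y \notin M -> y' \in A -> y' \notin M ->
  p \in M -> e z p -> ~~ e y p -> ~~ e y' p -> e z y -> e y y' -> e z y'.
Proof.
move=> zA zM yA yM y'A y'M pM zp yp y'p zy yy'; apply/negPn/negP => zy'.
have pick x : exists2 q, q \in M & attached x -> e x q.
  have [/attachedP[q qM xq]|nx] := boolP (attached x); first by exists q.
  by exists p.
have [q qM hq] := pick y; have [q' q'M hq'] := pick y'.
have [d [dM dp dq dq']] := blob_many bM pM qM q'M.
have nd x r : x \in A -> x \notin M -> r \in M -> (attached x -> e x r) -> e d r -> ~~ e d x.
  move=> xA xM rM hx dr; rewrite esy; apply/negP => xd.
  have ax : attached x by apply/attachedP; exists d.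
  by move: (out xA xM rM dM (hx ax)); rewrite esy dr xd => /(_ isT).
apply: (P5 (a := d) (b := p) (c := z) (d := y) (f := y')) => //.
- by rewrite esy.
- by rewrite esy; apply: (out zA zM pM dM zp); rewrite esy.
- exact: nd yA yM qM hq dq.
- exact: nd y'A y'M q'M hq' dq'.
- by rewrite esy.
by rewrite esy.
Qed.

Definition linked z y p q := [/\ z \in A, z \notin M, y \in A & y \notin M] /\
  [/\ p \in M, q \in M, e z p & e y q] /\ e p q.

Lemma linked_sym z y p q : linked z y p q -> linked y z q p.
Proof. by case=> -[? ? ? ?] [[? ? ? ?] h]; split=> //; split=> //; rewrite esy. Qed.

(** If [x] misses both ends of the edge, [x - r - p - z - y] is an induced P5; if it sees one end,
    [blob_far] yields the other. *)
Lemma linked_third z y p q x r : linked z y p q -> e z y -> x \in A -> x \notin M -> r \in M ->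
  e x r -> e r p -> e r q -> e x z /\ e x y.
Proof.
move=> L zy xA xM rM xr rp rq; have [[zA zM yA yM] [[pM qM zp yq] pq]] := L.
have qp : e q p by rewrite esy.
have zq := out zA zM pM qM zp pq; have yp := out yA yM qM pM yq qp.
have xp := out xA xM rM pM xr rp; have xq := out xA xM rM qM xr rq.
have zr : ~~ e z r by apply: (out zA zM pM rM zp); rewrite esy.
have yr : ~~ e y r by apply: (out yA yM qM rM yq); rewrite esy.
have yz : e y z by rewrite esy.
have /orP[xy|xy] := orbN (e x y).
  split=> //; rewrite esy; apply: (blob_far zA zM yA yM xA xM pM) => //; by rewrite esy.
have /orP[xz|xz] := orbN (e x z).
  split=> //; rewrite esy; apply: (blob_far yA yM zA zM xA xM qM) => //; by rewrite esy.
exfalso; apply: (P5 (a := x) (b := r) (c := p) (d := z) (f := y)) => //; rewrite esy //.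
Qed.

Lemma part_two p q r s : p \in M -> q \in M -> r \in M -> s \in M -> e p q -> e p r -> e q r ->
  [|| e s p && e s q, e s p && e s r | e s q && e s r].
Proof.
move=> pM qM rM sM pq pr qr.
have h a b : a \in M -> b \in M -> e a b -> e s a || e s b.
  move=> aM bM' ab; apply/negPn/negP; rewrite negb_or => /andP[sa sb].
  by move: (blob_part bM aM sM bM'); rewrite ab [e a s]esy => /(_ sa sb).
by move: (h p q pM qM pq) (h p r pM rM pr) (h q r qM rM qr);
  case: (e s p); case: (e s q); case: (e s r).
Qed.

(* One edge between vertices attached to different parts makes all such pairs adjacent. *)
Lemma linked_complete z y p q : linked z y p q -> e z y ->
  forall z1 z2 p1 p2, linked z1 z2 p1 p2 -> e z1 z2.
Proof.
move=> L zy z1 z2 p1 p2 L12.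
have [[zA zM yA yM] [[pM qM zp yq] pq]] := L.
have [[z1A z1M z2A z2M] [[p1M p2M zp1 zp2] p12]] := L12.
have [x [r [[xA xM rM xr] [rp rq]]]] := blob_third pM qM.
have [xz xy] := linked_third L zy xA xM rM xr rp rq.
have Lzx : linked z x p r by do !split=> //; rewrite esy.
have Lyx : linked y x q r by do !split=> //; rewrite esy.
have zx : e z x by rewrite esy.
have yx : e y x by rewrite esy.
have all3 v s : v \in A -> v \notin M -> s \in M -> e v s ->
    [/\ e s p -> e v z, e s q -> e v y & e s r -> e v x].
  move=> vA vM sM vs; have pr : e p r by rewrite esy.
  have qr : e q r by rewrite esy.
  have H1 sp sq := linked_third L zy vA vM sM vs sp sq.
  have H2 sp sr := linked_third Lzx zx vA vM sM vs sp sr.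
  have H3 sq sr := linked_third Lyx yx vA vM sM vs sq sr.
  have := part_two pM qM rM sM pq pr qr.
  case/or3P => /andP[a b]; split=> c; try (by case: (H1 a b)); try (by case: (H2 a b));
   try (by case: (H3 a b)); try (by case: (H1 c a)); try (by case: (H1 c b));
   try (by case: (H1 a c)); try (by case: (H1 b c)); try (by case: (H2 a c));
   try (by case: (H2 c b)); try (by case: (H3 a c)); try (by case: (H3 b c)); try (by case: (H3 c b)).
have [t [m [tA tM mM [tm mp1 mp2 zt]]]] : exists t m, [/\ t \in A, t \notin M, m \in M &
    [/\ e t m, e p1 m, e p2 m & e z1 t]].
  have pr : e p r by rewrite esy.
  have qr : e q r by rewrite esy.
  have [a1 b1 c1] := all3 z1 p1 z1A z1M p1M zp1.
  have := part_two pM qM rM p1M pq pr qr; have := part_two pM qM rM p2M pq pr qr.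
  case hp: (e p1 p && e p2 p).
    by case/andP: hp => h1 h2 _ _; exists z, p; split=> //; split=> //; apply: a1.
  case hq: (e p1 q && e p2 q).
    by case/andP: hq => h1 h2 _ _; exists y, q; split=> //; split=> //; apply: b1.
  case hr: (e p1 r && e p2 r).
    by case/andP: hr => h1 h2 _ _; exists x, r; split=> //; split=> //; apply: c1.
  move: hp hq hr; case: (e p1 p); case: (e p1 q); case: (e p1 r); case: (e p2 p);
  by case: (e p2 q); case: (e p2 r).
have L1 : linked z1 t p1 m by do !split=> //.
have p21 : e p2 p1 by rewrite esy.
by have [] := linked_third L1 zt z2A z2M p2M zp2 p21 mp2; rewrite esy.
Qed.

(** [w] has one attached neighbour by [blob_near]. Adjacency to [w] passes between vertices attached
    to different parts by [blob_far], and a third part connects any two attached vertices. *)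
Lemma linked_far_complete z y p q w n s : linked z y p q -> e z y ->
  w \in A -> w \notin M -> ~~ attached w -> n \in A -> n \notin M -> s \in M -> e n s -> e w n.
Proof.
move=> L zy wA wM nw nA nM sM ns; have [[zA zM yA yM] [[pM qM zp yq] pq]] := L.
have wno t : t \in M -> ~~ e w t.
  by move=> tM; apply: contra nw => wt; apply/attachedP; exists t.
have [z0 [z0A z0M /attachedP[p0 p0M zp0] wz0]] := blob_near pM wA wM nw.
have step a b t u : a \in A -> a \notin M -> b \in A -> b \notin M -> t \in M -> u \in M ->
    e a t -> e b u -> e t u -> e w a -> e w b.
  move=> aA aM bA bM' tM uM at' bu tu wa.
  have Lba : linked b a u t by do !split=> //; rewrite esy.
  have ba := linked_complete L zy Lba.
  have au := out aA aM tM uM at' tu.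
  rewrite esy; apply: (blob_far bA bM' aA aM wA wM uM) => //; first exact: wno.
  by rewrite esy.
have [n2 [m [[n2A n2M mM nm] [mp0 ms]]]] := blob_third p0M sM.
have wn2 : e w n2 by apply: (step z0 n2 p0 m) => //; rewrite esy.
exact: (step n2 n m s).
Qed.

(** The unattached vertices see nothing of the blob and all attached vertices outside it, so they
    form a module. *)
Lemma far_card z y p q : linked z y p q -> e z y ->
  #|[set w in A | (w \notin M) && ~~ attached w]| <= 1.
Proof.
move=> L zy; rewrite leqNgt; apply/negP => gt; have [[zA zM yA yM] [[pM qM zp yq] pq]] := L.
set C := [set w in A | _] in gt.
have mC : gmodule e A C.
  split; first by apply/subsetP => w; rewrite inE => /andP[].
  move=> v a b vA; rewrite !inE vA /= => vC /and3P[aA aM na] /and3P[bA bM' nb].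
  have [vM|vM] := boolP (v \in M).
    have h t : ~~ attached t -> e v t = false.
      by move=> nt; apply/negP => vt; move/negP: nt; apply; apply/attachedP; exists v; rewrite 1?esy.
    by rewrite !h.
  move: vC; rewrite vM /= negbK => /attachedP[s sM vs].
  by rewrite ![e v _]esy !(linked_far_complete L zy _ _ _ vA vM sM vs).
have CA := pA mC gt; have := MA pM; by rewrite -CA inE pM andbF.
Qed.

(* With no edge between vertices attached to different parts, every component of A - M is a module. *)
Lemma unlinked_indep p0 : p0 \in M -> (forall z y p q, linked z y p q -> ~~ e z y) ->
  forall u u', u \in A -> u \notin M -> u' \in A -> u' \notin M -> ~~ e u u'.
Proof.
move=> p0M unl u u' uA uM u'A u'M; apply/negP => uu'.
pose O := A :\: M; pose C := [set v in O | cn e O u v].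
have OP v : (v \in O) = (v \in A) && (v \notin M) by rewrite inE andbC.
have step p a b : p \in M -> a \in O -> b \in O -> e a b -> e a p -> e b p.
  rewrite !OP => pM /andP[aA aM] /andP[bA bM'] ab ap; apply/negPn/negP => bp.
  have [z [q [[zA zM qM zq] [qp _]]]] := blob_third pM pM.
  have pq : e p q by rewrite esy.
  have nza : ~~ e z a by apply: (unl z a q p).
  have nzp := out zA zM qM pM zq qp.
  have naq := out aA aM pM qM ap pq.
  have nbq : ~~ e b q.
    by apply/negP => bq; have /negP[] := unl a b p q (conj (And4 aA aM bA bM') (conj (And4 pM qM ap bq) pq)).
  have nzb : ~~ e z b.
    apply/negP => zb; have [/attachedP[r rM br]|nb] := boolP (attached b).
      have pr : ~~ e p r.
        apply/negP => pr; have /negP[] := unl a b p r (conj (And4 aA aM bA bM') (conj (And4 pM rM ap br) pr)).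
        exact: ab.
      have qr : e q r.
        by apply/negPn/negP => qr; move: (blob_part bM pM rM qM pr); rewrite [e r q]esy pq => /(_ qr).
      have /negP[] := unl z b q r (conj (And4 zA zM bA bM') (conj (And4 qM rM zq br) qr)).
      exact: zb.
    have nob t : t \in M -> ~~ e b t.
      by move=> tM; apply: contra nb => bt; apply/attachedP; exists t.
    have [c [cM cp cq _]] := blob_many bM pM qM qM.
    have pc : e p c by rewrite esy.
    have qc : e q c by rewrite esy.
    apply: (P5 (a := z) (b := b) (c := a) (d := p) (f := c)) => //.
    - by rewrite esy.
    - exact: out zA zM qM cM zq qc.
    - exact: nob.
    exact: out aA aM pM cM ap pc.
  apply: (P5 (a := z) (b := q) (c := p) (d := a) (f := b)) => //.
  - by rewrite esy.
  - by rewrite esy.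
  - by rewrite esy.
  by rewrite esy.
have far p v : p \in M -> cn e O u v -> e u p = e v p.
  move=> pM /connectP[s]; elim: s u {uA uM uu' C} => [|a s IH] x /=; first by move=> _ ->.
  move=> /andP[/and3P[xa xO aO] ps] vl; rewrite -(IH a) //.
  apply/idP/idP; first exact: step.
  by apply: step; rewrite // esy.
have uO : u \in O by rewrite OP uA.
have u'O : u' \in O by rewrite OP u'A.
have mC : gmodule e A C.
  split; first by apply/subsetP => v; rewrite inE OP => /andP[/andP[]].
  move=> z a b zA zC; rewrite ![_ \in C]in_set => /andP[aO ua] /andP[bO ub].
  have [zM|zM] := boolP (z \in M); first by rewrite ![e z _]esy -(far z a) // -(far z b).
  have zO : z \in O by rewrite OP zA.
  have h t : t \in O -> cn e O u t -> e z t = false.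
    move=> tO ut; apply/negP => zt; move: zC; rewrite [_ \in C]in_set zO /= => /negP; apply.
    by apply: (cn_trans ut); apply: cn_edge; rewrite // esy.
  by rewrite !h.
have CA : C = A.
  apply: (pA mC); apply/card_gt1P; exists u, u'; split.
  - by rewrite [_ \in C]in_set uO cn_refl.
  - by rewrite [_ \in C]in_set u'O cn_edge.
  by apply/eqP => h; move: uu'; rewrite h eirr.
by have := MA p0M; rewrite -CA [_ \in C]in_set OP p0M andbF.
Qed.

End OneBlob.

(* If z1 ~ z2 were attached to the same part, then with y, x attached to two further parts
   z1, z2, y, x is a K4; for its blob the pair p, p2 is linked, which forces p ~ p2. *)
Lemma linked_part_indep M z y p q : blob M -> linked M z y p q -> e z y ->
  forall z1 z2 p1 p2, z1 \in A -> z1 \notin M -> z2 \in A -> z2 \notin M -> p1 \in M -> p2 \in M ->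
  e z1 p1 -> e z2 p2 -> ~~ e p1 p2 -> ~~ e z1 z2.
Proof.
move=> bM L zy z1 z2 p1 p2 z1A z1M z2A z2M p1M p2M zp1 zp2 np12; apply/negP => z12.
have out v a b : v \in A -> v \notin M -> a \in M -> b \in M -> e v a -> e a b -> ~~ e v b.
  move=> vA vM aM bM' va ab; apply/negP => vb.
  by move: (blob_out bM vA vM aM bM' va vb); rewrite ab.
have MA a : a \in M -> a \in A by apply: (blob_sub bM).
have [y1 [q1 [[y1A y1M q1M yq1] [q1p1 _]]]] := blob_third bM p1M p1M.
have [x1 [r1 [[x1A x1M r1M xr1] [r1p1 r1q1]]]] := blob_third bM p1M q1M.
have other a : a \in M -> e a p1 -> e a p2.
  move=> aM ap; apply/negPn/negP => ap2; move: (blob_part bM aM p2M p1M ap2).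
  by rewrite ap [e p2 _]esy => /(_ np12).
have q1p2 := other _ q1M q1p1; have r1p2 := other _ r1M r1p1.
have lk a b t u : a \in A -> a \notin M -> b \in A -> b \notin M -> t \in M -> u \in M ->
    e a t -> e b u -> e t u -> e a b.
  by move=> *; apply: (linked_complete bM L zy (p1 := t) (p2 := u)).
have [p1q1 p2q1 p1r1 p2r1] : [/\ e p1 q1, e p2 q1, e p1 r1 & e p2 r1].
  by rewrite ![e _ q1]esy ![e _ r1]esy.
have z1y := lk z1 y1 _ _ z1A z1M y1A y1M p1M q1M zp1 yq1 p1q1.
have z2y := lk z2 y1 _ _ z2A z2M y1A y1M p2M q1M zp2 yq1 p2q1.
have z1x := lk z1 x1 _ _ z1A z1M x1A x1M p1M r1M zp1 xr1 p1r1.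
have z2x := lk z2 x1 _ _ z2A z2M x1A x1M p2M r1M zp2 xr1 p2r1.
have xy := lk x1 y1 _ _ x1A x1M y1A y1M r1M q1M xr1 yq1 r1q1.
have K : k4 z1 z2 y1 x1 by rewrite /k4 z12 z1y z1x z2y z2x esy xy.
have [bN [z1N z2N yN xN]] := blob4P z1A z2A y1A x1A K.
set N := blob4 _ _ _ _ in bN z1N z2N yN xN.
have nyp1 := out _ _ _ y1A y1M q1M p1M yq1 q1p1; have nyp2 := out _ _ _ y1A y1M q1M p2M yq1 q1p2.
have nxp1 := out _ _ _ x1A x1M r1M p1M xr1 r1p1; have nxp2 := out _ _ _ x1A x1M r1M p2M xr1 r1p2.
have nz1q := out _ _ _ z1A z1M p1M q1M zp1 p1q1; have nz2q := out _ _ _ z2A z2M p2M q1M zp2 p2q1.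
have nxq := out _ _ _ x1A x1M r1M q1M xr1 r1q1.
have degp1 : deg4 p1 z1 z2 y1 x1 = (1 + e p1 z2).
  by rewrite /deg4 [e p1 z1]esy zp1 [e p1 y1]esy (negPf nyp1) [e p1 x1]esy (negPf nxp1) !addn0.
have degp2 : deg4 p2 z1 z2 y1 x1 = (e p2 z1 + 1).
  by rewrite /deg4 [e p2 z2]esy zp2 [e p2 y1]esy (negPf nyp2) [e p2 x1]esy (negPf nxp2) !addn0.
have p1N : p1 \notin N by rewrite inE degp1; case: (e p1 z2); rewrite andbF.
have p2N : p2 \notin N by rewrite inE degp2; case: (e p2 z1); rewrite andbF.
have qN : q1 \notin N.
  rewrite inE /deg4 [e q1 z1]esy (negPf nz1q) [e q1 z2]esy (negPf nz2q) [e q1 x1]esy (negPf nxq).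
  by case: (e q1 y1); rewrite andbF.
have L1 : linked N p1 q1 z1 y1.
  by do !split; rewrite // ?MA // esy.
have L2 : linked N p1 p2 z1 z2.
  by do !split; rewrite // ?MA // esy.
by move/negP: np12; apply; apply: (linked_complete bN L1 p1q1 L2).
Qed.

(** With the K4 pebbled the blob [M] is type-closed. The classes are the parts of [M] with the
    outside vertices attached to them, and the class of unattached vertices. Across classes types
    decide adjacency; each class is bipartite with sides inside and outside [M], hence K4-free with
    independent types. *)
Lemma k4_prime_iso k B E a b c d : a \in A -> b \in A -> c \in A -> d \in A -> k4 a b c d ->
  bisim e e' k A B E -> E [::] [::] -> 8 <= k -> iso_on e e' A B E.
Proof.
move=> aA bA cA dA K bE E0 k8.
have [bM [aM bM' cM dM]] := blob4P aA bA cA dA K.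
set M := blob4 a b c d in bM aM bM' cM dM.
have MA p : p \in M -> p \in A by apply: (blob_sub bM).
have subp : {subset [:: a; b; c; d] <= A} by apply/allP; rewrite /= aA bA cA dA.
have kp : size [:: a; b; c; d] <= k by apply: leq_trans k8.
have [qs Epq] := bs_dom bE E0 kp subp.
have bP := bisim_params bE Epq; rewrite /= in bP.
set E1 := (fun xs ys => E (xs ++ _) (ys ++ _)) in bP.
have k4' : 3 < k - 4 by rewrite leq_subRL // (leq_trans _ k8).
have sT := selfE_self_bisim bP Epq.
have E1sub x y : E1 [:: x] [:: y] -> E [:: x] [:: y] by move=> h; apply: bs_head bE _ _ _ _ h.
apply: (iso_on_weaken E1sub).
have tyM u v : ty (selfE E1) u v -> (u \in M) = (v \in M).
  move=> h; have [uA vA] := sb_mem sT h; have h' := params_type bE h.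
  by rewrite !inE uA vA /deg4 !(selfE_adj bE h') // !inE eqxx ?orbT.
have Mcl : ty_closed (selfE E1) M by move=> u v h; rewrite (tyM _ _ h).
clearbody M.
have MsA : M \subset A by apply/subsetP.
have part u v w : u \in M -> v \in M -> w \in M -> ~~ e u v -> ~~ e v w -> ~~ e u w.
  exact: (blob_part bM).
have irr u : ~~ e u u by rewrite eirr.
pose bel x p := (x \in A) && (if x \in M then ~~ e x p else [exists q in M, e x q && ~~ e q p]).
have belM x p : x \in M -> bel x p = ~~ e x p by move=> xM; rewrite /bel MA // xM.
have belO x p : x \notin M -> bel x p -> exists q, [/\ q \in M, e x q & ~~ e q p].
  by move=> xM; rewrite /bel (negPf xM) => /andP[_ /existsP[q /and3P[]]]; exists q.
have belI x p q : x \in A -> x \notin M -> q \in M -> e x q -> ~~ e q p -> bel x p.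
  by move=> xA xM qM xq qp; rewrite /bel xA (negPf xM); apply/existsP; exists q; rewrite qM xq.
have bel_uniq x y y' : y \in M -> y' \in M -> bel x y -> bel x y' -> ~~ e y y'.
  move=> yM y'M b1 b2; have xA : x \in A by case/andP: b1.
  have [xM|xM] := boolP (x \in M).
    by move: b1 b2; rewrite !belM // => h1; apply: part => //; rewrite esy.
  have [q [qM xq qy]] := belO _ _ xM b1; have [q' [q'M xq' qy']] := belO _ _ xM b2.
  apply: (part y q y') => //; first by rewrite esy.
  by apply: (part q q' y') => //; apply: (blob_out bM xA xM).
have bel_part x y y' : y \in M -> y' \in M -> bel x y -> ~~ e y y' -> bel x y'.
  move=> yM y'M b1 yy'; have xA : x \in A by case/andP: b1.
  have [xM|xM] := boolP (x \in M).
    by move: b1; rewrite !belM // => h; apply: (part x y y').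
  have [q [qM xq qy]] := belO _ _ xM b1.
  by apply: (belI _ _ q) => //; apply: (part q y y').
have share x x' y y' : y \in M -> y' \in M -> bel x y -> bel x y' -> bel x' y -> bel x' y'.
  by move=> yM y'M b1 b2 b3; apply: (bel_part x' y) => //; apply: (bel_uniq x).
pose R := ixrel M bel.
have Req : equiv_on A R := ixrel_equiv share A.
have bel_inv x y u v : y \in M -> selfE E1 [:: x; y] [:: u; v] -> bel x y -> bel u v.
  move=> yM h b1; have xu := sb_hd sT h; have uA := (sb_mem sT xu).2.
  have [xM|xM] := boolP (x \in M).
    by move: b1; rewrite !belM -?(tyM _ _ xu) // (sb_adj sT h).
  have [q [qM xq qy]] := belO _ _ xM b1.
  have [q' hq] := sb_ext3 sT k4' h (MA _ qM).
  have h1 : selfE E1 [:: q; x] [:: q'; u] by have := @sb_map _ _ _ _ _ sT [:: 0; 1] _ _ q hq; apply.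
  have h2 : selfE E1 [:: q; y] [:: q'; v] by have := @sb_map _ _ _ _ _ sT [:: 0; 2] _ _ q hq; apply.
  apply: (belI _ _ q') => //.
  - by rewrite -(tyM _ _ xu).
  - by rewrite -(tyM _ _ (sb_hd sT h1)).
  - by rewrite -(sb_adj sT (sb_sw sT h1)).
  by rewrite -(sb_adj sT h2).
have Rinv x y u v : selfE E1 [:: x; y] [:: u; v] -> R x y -> R u v.
  exact: (ixrel_inv sT k4' MsA Mcl bel_inv).
have Rsym x y : R x y = R y x by apply: ixrel_sym.
have attE u : u \in A -> u \notin M -> indexed M bel u = attached M u.
  move=> uA uM; apply/indexedP/attachedP => [[p pM /(belO _ _ uM)[q [qM uq _]]]|[p pM up]].
    by exists q.
  by exists p => //; apply: (belI _ _ p).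
have att_inv u v : ty (selfE E1) u v -> attached M u -> attached M v.
  move=> h /attachedP[p pM up]; have [q hq] := sb_ext2 sT k4' h (MA _ pM).
  apply/attachedP; exists q; first by rewrite -(tyM _ _ (sb_hd sT hq)).
  by rewrite -(sb_adj sT (sb_sw sT hq)).
have RM x y : x \in M -> R x y = bel y x.
  by move=> xM; apply: (ixrelP share) => //; rewrite belM.
(* An edge outside [M] exists only in the linked case, where all vertices attached to different
   parts are adjacent. *)
have base u v : u \in A -> u \notin M -> v \in A -> v \notin M -> e u v ->
    exists z y p q, linked M z y p q /\ e z y.
  move=> uA uM vA vM uv; apply: contrapT => no.
  have := unlinked_indep bM aM _ uA uM vA vM; rewrite uv => /(_ _)/negP; apply=> // z y p q L.
  by apply/negP => zy; apply: no; exists z, y, p, q.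
have cross x y u v : x \in A -> y \in A -> ty (selfE E1) x u -> ty (selfE E1) y v ->
    ~~ R x y -> ~~ R u v -> e x y -> e u v.
  have inM p q s t : p \in A -> q \in A -> ty (selfE E1) p s -> ty (selfE E1) q t ->
      ~~ R p q -> ~~ R s t -> p \in M -> e p q -> e s t.
    move=> pA' qA ps qt nR nR' pM pq.
    have sM : s \in M by rewrite -(tyM _ _ ps).
    have [qM|qM] := boolP (q \in M).
      have tM : t \in M by rewrite -(tyM _ _ qt).
      by apply/negPn; move: nR'; rewrite RM // belM // esy.
    have bq : bel q p by apply: (belI _ _ p) => //; rewrite esy.
    by move: nR; rewrite RM // bq.
  move=> xA yA xu yv nR nR' xy.
  have uA := (sb_mem sT xu).2; have vA := (sb_mem sT yv).2.
  have [xM|xM] := boolP (x \in M); first exact: (inM x y).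
  have [yM|yM] := boolP (y \in M).
    by rewrite esy; apply: (inM y x) => //; rewrite 1?Rsym 1?esy.
  have [z0 [y0 [p0 [q0 [L zy]]]]] := base x y xA xM yA yM xy.
  have uM : u \notin M by rewrite -(tyM _ _ xu).
  have vM : v \notin M by rewrite -(tyM _ _ yv).
  have ny' s t : ty (selfE E1) s t -> ~~ attached M s -> ~~ attached M t.
    by move=> st; apply: contra; apply: att_inv; apply: selfE_sym.
  have [ax|nx] := boolP (attached M x); have [ay|ny] := boolP (attached M y).
  - have /attachedP[p pM up] := att_inv _ _ xu ax; have /attachedP[q qM vq] := att_inv _ _ yv ay.
    have pq : e p q.
      apply/negPn/negP => npq; move/negP: nR'; apply.
      have bu : bel u p by apply: (belI _ _ p).
      by rewrite /R (ixrelP share _ bu pM); apply: (belI _ _ q) => //; rewrite esy.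
    exact: (linked_complete bM L zy (z1 := u) (z2 := v) (p1 := p) (p2 := q)).
  - have /attachedP[p pM up] := att_inv _ _ xu ax.
    rewrite esy; exact: (linked_far_complete bM L zy vA vM (ny' _ _ yv ny) uA uM pM up).
  - have /attachedP[q qM vq] := att_inv _ _ yv ay.
    exact: (linked_far_complete bM L zy uA uM (ny' _ _ xu nx) vA vM qM vq).
  by move: nR; rewrite /R ixrel_none attE // ny.
apply: (decomposition bP (ltnW k4') Epq Req Rinv).
  move=> x y u v xA yA xu yv nR nR'.
  have uA := (sb_mem sT xu).2; have vA := (sb_mem sT yv).2.
  apply/idP/idP; first exact: (cross x y u v xA yA xu yv).
  apply: (cross u v x y) => //; exact: selfE_sym.
move=> x x' Ex E2 bE2 E20 sub; have [xA _] := bs_mem bP Ex.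
have bip u v : u \in cls A R x -> v \in cls A R x -> (u \in M) = (v \in M) -> ~~ e u v.
  rewrite !inE => /andP[uA Rxu] /andP[vA Rxv] uvM.
  have Ruv : R u v by apply: (eq_trans_on Req xA uA vA _ Rxv); rewrite Rsym.
  have [uM|uM] := boolP (u \in M).
    have vM : v \in M by rewrite -uvM.
    by move: Ruv; rewrite (RM _ _ uM) (belM _ _ vM) [e v u]esy.
  have vM : v \notin M by rewrite -uvM.
  apply/negP => uv; have [z0 [y0 [p0 [q0 [L zy]]]]] := base u v uA uM vA vM uv.
  have [/attachedP[p pM up]|nu] := boolP (attached M u).
    have bu : bel u p by apply: (belI _ _ p).
    move: Ruv; rewrite /R (ixrelP share _ bu pM) => /(belO _ _ vM)[q [qM vq qp]].
    move: uv; apply/negP; apply: (linked_part_indep bM L zy uA uM vA vM pM qM up vq).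
    by rewrite esy.
  have nv : ~~ attached M v by move: Ruv; rewrite /R ixrel_none ?attE.
  have := far_card bM L zy; rewrite leqNgt => /negP; apply.
  apply/card_gt1P; exists u, v; rewrite !inE uA uM nu vA vM nv; split=> //.
  by apply/eqP => h; move: uv; rewrite h eirr.
apply: (independent_types_iso esy P5 k4' bE2 E20).
  move=> s t u v sc tc uc vc st su _ tu _ _.
  move: (bip s t sc tc) (bip s u sc uc) (bip t u tc uc); rewrite st su tu.
  by case: (s \in M); case: (t \in M); case: (u \in M) => // h1 h2 h3;
    try (by move: (h1 erefl)); try (by move: (h2 erefl)); move: (h3 erefl).
move=> u v h; have [uc vc] := sb_mem (selfE_self_bisim bE2 E20) h.
apply: bip => //; case: h => ys h1 h2; apply: tyM; exists ys; exact: sub.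
Qed.

End Blobs.

Theorem prime_iso (U W : finType) (e : rel U) (e' : rel W) k A B E :
  symmetric e -> irreflexive e -> p5free e -> qfree e -> prime_on e A -> connected_on e A ->
  bisim e e' k A B E -> E [::] [::] -> 10 <= k -> iso_on e e' A B E.
Proof.
move=> esy eirr P5 Qf pA conA bE E0 k10.
have [[a [b [c [d [[aA bA cA dA] K]]]]]|no] := pselect (exists a b c d,
    [/\ a \in A, b \in A, c \in A & d \in A] /\ k4 e a b c d).
  exact: (k4_prime_iso esy eirr P5 Qf pA conA aA bA cA dA K bE E0 (ltnW (ltnW k10))).
apply: (k4free_prime_iso esy eirr P5 _ pA bE E0 k10) => a b c d aA bA cA dA ab ac ad bc bd cd.
by apply: no; exists a, b, c, d; split=> //; rewrite /k4 ab ac ad bc bd cd.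
Qed.

(** * Modular decomposition and the reduction to prime graphs *)

Definition co_rel (U : finType) (e : rel U) : rel U := [rel x y | (x != y) && ~~ e x y].

Lemma co_rel_sym (U : finType) (e : rel U) : symmetric e -> symmetric (co_rel e).
Proof. by move=> esy x y; rewrite /co_rel /= eq_sym esy. Qed.

Lemma bisim_co (U W : finType) (e : rel U) (e' : rel W) k A B E :
  bisim e e' k A B E -> bisim (co_rel e) (co_rel e') k A B E.
Proof.
case=> h1 h2 h3 h4 h5 h6 h7 h8; split=> // x y x' y' /h5[eq ad].
by split=> //; rewrite /co_rel /= eq ad.
Qed.

Section Modules.
Variables (U : finType) (e : rel U).
Hypotheses (esy : symmetric e) (eirr : irreflexive e).
Variable A : {set U}.
Hypotheses (conA : connected_on e A) (coA : connected_on (co_rel e) A).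

Lemma gmodule_union M N x : gmodule e A M -> gmodule e A N -> x \in M -> x \in N ->
  gmodule e A (M :|: N).
Proof.
move=> [MA hM] [NA hN] xM xN; split; first by rewrite subUset MA.
move=> z u v zA; rewrite inE negb_or => /andP[zM zN].
have h w : w \in M :|: N -> e z w = e z x.
  by rewrite inE => /orP[wM|wN]; [apply: hM | apply: hN].
by move=> /h -> /h ->.
Qed.

(* If two overlapping proper modules covered A, all pairs between M - N and N would have the same
   adjacency, so G[A] or its complement would be disconnected. *)
Lemma gmodule_cover M N x : gmodule e A M -> gmodule e A N -> x \in M -> x \in N ->
  M :|: N = A -> M = A \/ N = A.
Proof.
move=> [MA hM] [NA hN] xM xN cov.
have [->|nM] := eqVneq M A; [by left | right].
apply/eqP/negPn/negP => nN.
have sMA := subsetP MA; have sNA := subsetP NA.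
have [b bN bM] : exists2 b, b \in N & b \notin M.
  apply/subsetPn; apply/negP => sNM; move/negP: nM; apply.
  by rewrite -cov; apply/eqP/esym/setUidPl.
have [a aM aN] : exists2 a, a \in M & a \notin N.
  apply/subsetPn; apply/negP => sMN; move/negP: nN; apply.
  by rewrite -cov; apply/eqP/esym/setUidPr.
have inMN z : z \in A -> z \notin N -> z \in M.
  by rewrite -cov inE => /orP[//|->].
have same z w : z \in A -> z \notin N -> w \in N -> e z w = e a b.
  move=> zA zN wN; rewrite (hN z w b) // esy [e a b]esy; apply: hM => //.
    exact: sNA.
  exact: inMN.
have cross (r : rel U) : (forall z w, z \in A -> z \notin N -> w \in N -> ~~ r z w) ->
    (forall z w, z \in A -> w \in A -> cn r A z w) -> False.
  move=> nr con; have aA := sMA _ aM; have bA := sNA _ bN.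
  have nPb : ~~ [pred z | z \notin N] b by rewrite /= negbK.
  have [u [v [_ /and3P[uv uA vA] Pu Pv]]] := boundary_edge (P := [pred z | z \notin N]) (con a b aA bA) aN nPb.
  move: (nr u v uA Pu); rewrite uv => /(_ _)/negP; apply=> //; by rewrite negbK in Pv.
have [ab|ab] := boolP (e a b).
  by apply: (cross (co_rel e)) => // z w zA zN wN; rewrite /co_rel /= (same z w) // ab andbF.
by apply: (cross e) => // z w zA zN wN; rewrite (same z w).
Qed.

(* Closing {x, y} under adding vertices that distinguish a member from x. *)
Inductive in_closure (x y : U) : U -> Prop :=
| closure_left : in_closure x y x
| closure_right : in_closure x y y
| closure_step z t : t \in A -> in_closure x y t -> e z t != e z x -> in_closure x y z.

(** By [modrelP], membership in a common proper module. The form with the closure is the one the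
    pebble game can follow. *)
Definition modrel : rel U := [rel x y | [exists z in A, ~~ `[< in_closure x y z >]]].

Lemma modrelP x y : x \in A -> y \in A ->
  modrel x y <-> exists M, [/\ gmodule e A M, x \in M, y \in M & M != A].
Proof.
move=> xA yA; split=> [/existsP[z /andP[zA /asboolP nz]]|[M [[MA hM] xM yM nM]]].
  exists [set v in A | `[< in_closure x y v >]]; split.
  - split; first by apply/subsetP => v; rewrite inE => /andP[].
    have h v w : w \in A -> v \in A -> v \notin [set v in A | `[< in_closure x y v >]] ->
        in_closure x y w -> e v w = e v x.
      move=> wA; rewrite inE => -> /= /asboolP nv cw; apply/eqP/negPn/negP => ne; apply: nv.
      exact: closure_step cw ne.
    move=> v s t vA nv; rewrite inE => /andP[sA /asboolP cs]; rewrite inE => /andP[tA /asboolP ct].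
    by rewrite (h v s) // (h v t).
  - by rewrite inE xA; apply/asboolP; constructor.
  - by rewrite inE yA; apply/asboolP; constructor.
  by apply/eqP => h; move: zA; rewrite -{1}h inE => /andP[_ /asboolP].
have [z zA zM] : exists2 z, z \in A & z \notin M.
  by apply/subsetPn; apply: contra nM => s; rewrite eqEsubset MA.
apply/existsP; exists z; rewrite zA; apply/asboolP => cz; move/negP: zM; apply.
suff: forall v, in_closure x y v -> v \in A -> v \in M by apply.
move=> v; elim => // w t tA _ IH ne wA; apply/negPn/negP => wM.
by move: ne; rewrite (hM w t x) ?eqxx // IH.
Qed.

Hypothesis A2 : 1 < #|A|.

(** Transitivity: the union of two overlapping proper modules is a module, and proper by
    [gmodule_cover]. *)
Lemma modrel_equiv : equiv_on A modrel.
Proof.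
split.
- move=> x xA; apply/(modrelP xA xA); exists [set x]; rewrite inE eqxx; split=> //.
    by split; [rewrite sub1set | move=> z u v _ _ /set1P -> /set1P ->].
  by apply/eqP => h; move: A2; rewrite -h cards1.
- move=> x y xA yA /(modrelP xA yA)[M [hM xM yM nM]].
  by apply/(modrelP yA xA); exists M.
move=> y x z yA xA zA /(modrelP xA yA)[M [hM xM yM nM]].
move=> /(modrelP yA zA)[N [hN yN zN nN]].
apply/(modrelP xA zA); exists (M :|: N); split; first exact: gmodule_union yM yN.
- by rewrite inE xM.
- by rewrite inE zN orbT.
by apply/eqP => /(gmodule_cover hM hN yM yN)[]; apply/eqP.
Qed.

Lemma modrel_module x y u v : x \in A -> y \in A -> u \in A -> v \in A ->
  modrel x u -> modrel y v -> ~~ modrel x y -> e x y = e u v.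
Proof.
move=> xA yA uA vA xu yv nxy.
have [M [[MA hM] xM uM nM]] := (modrelP xA uA).1 xu.
have [N [[NA hN] yN vN nN]] := (modrelP yA vA).1 yv.
have yM : y \notin M by apply: contra nxy => yM; apply/(modrelP xA yA); exists M.
have uN : u \notin N.
  apply: contra nxy => uN; apply: (eq_trans_on modrel_equiv uA xA yA xu).
  by apply/(modrelP uA yA); exists N.
by rewrite esy (hM y x u) // esy (hN u y v).
Qed.

(** A largest proper module through [x] absorbs every other proper module through [x], so some
    vertex stays outside the class. *)
Lemma modrel_proper x : x \in A -> cls A modrel x != A.
Proof.
move=> xA; pose P (M : {set U}) := [&& `[< gmodule e A M >], x \in M & M != A].
have P1 : P [set x].
  rewrite /P inE eqxx /=; apply/andP; split.
    by apply/asboolP; split; [rewrite sub1set | move=> z u v _ _ /set1P -> /set1P ->].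
  by apply/eqP => h; move: A2; rewrite -h cards1.
case: (arg_maxnP (fun M : {set U} => #|M|) P1) => M /and3P[/asboolP hM xM nM] max.
have [y yA yM] : exists2 z, z \in A & z \notin M.
  by apply/subsetPn; apply: contra nM => s; rewrite eqEsubset hM.1.
apply/eqP => /setP/(_ y); rewrite inE yA => /(modrelP xA yA)[N [hN xN yN nN]].
have := max (M :|: N); rewrite /P inE xM /=.
have -> : `[< gmodule e A (M :|: N) >] by apply/asboolP; apply: gmodule_union xM xN.
case: eqP => [/(gmodule_cover hM hN xM xN)[] E|_ /(_ isT) /=].
- by rewrite E eqxx in nM.
- by rewrite E eqxx in nN.
rewrite leqNgt => /negP; apply; apply: proper_card; rewrite properE subsetUl /=.
by apply/subsetPn; exists y => //; rewrite inE yN orbT.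
Qed.

(** The classes met by a module of the quotient form a module of the graph. If it is proper, it lies
    in one class, so the module of the quotient had a single vertex. *)
Lemma modrel_prime : prime_on e (reps A modrel).
Proof.
have Req := modrel_equiv.
move=> M [MR hM] M2; pose N := [set a in A | rep A modrel a \in M].
have MN : M \subset N.
  apply/subsetP => m mM; have mR := subsetP MR _ mM.
  by rewrite inE (repsW mR) rep_id.
have [NA|nN] := eqVneq N A.
  apply/eqP; rewrite eqEsubset MR; apply/subsetP => m mR.
  by have := repsW mR; rewrite -{1}NA inE rep_id // => /andP[].
have hN : gmodule e A N.
  split; first by apply/subsetP => z; rewrite inE => /andP[].
  have h z x : z \in A -> z \notin N -> x \in N -> e z x = e (rep A modrel z) (rep A modrel x).
    move=> zA zN; rewrite inE => /andP[xA rx]; apply: modrel_module => //; rewrite ?rep_in ?rep_rel //.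
    by apply: contra zN => zx; rewrite inE zA (rep_eq Req zA xA zx).
  move=> z x y zA zN xN yN; rewrite h // [RHS]h //.
  move: xN yN; rewrite !inE => /andP[_ xM] /andP[_ yM]; apply: hM => //; first exact: rep_reps.
  by apply: contra zN => zM; rewrite inE zA.
have [x [y [xM yM nxy]]] := card_gt1P M2.
have xR := subsetP MR _ xM; have yR := subsetP MR _ yM.
have xA := repsW xR; have yA := repsW yR.
case/eqP: nxy; rewrite -(rep_id xR) -(rep_id yR); apply: rep_eq => //.
by apply/(modrelP xA yA); exists N; split=> //; apply: (subsetP MN).
Qed.

Lemma modrel_connected : connected_on e (reps A modrel).
Proof.
have Req := modrel_equiv.
suff h x y : cn e A x y -> x \in A -> y \in A ->
    cn e (reps A modrel) (rep A modrel x) (rep A modrel y).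
  move=> x y xR yR; rewrite -(rep_id xR) -(rep_id yR).
  have xA := repsW xR; have yA := repsW yR; apply: h => //; exact: conA.
case/connectP => p; elim: p x => [|z p IH] x /=; first by move=> _ -> _ _; apply: cn_refl.
move=> /andP[/and3P[xz _ zA] pp] yl xA yA; apply: (cn_trans _ (IH _ pp yl zA yA)).
have [r|nr] := boolP (modrel x z); first by rewrite (rep_eq Req xA zA r) cn_refl.
apply: cn_edge; rewrite ?rep_reps // -(modrel_module xA zA) // ?rep_in ?rep_rel //.
Qed.

Variables (k : nat) (T : seq U -> seq U -> Prop).
Hypotheses (sT : self_bisim e k A T) (k3 : 3 < k).

(** The derivation is followed with four pebbles: on [x], [y], [z] and the member [t] that [z] was
    derived from. *)
Lemma in_closure_inv x y u v z w : in_closure x y z -> T [:: z; x; y] [:: w; u; v] ->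
  in_closure u v w.
Proof.
move=> c; elim: c w => [w h|w h|{}z t tA _ IH ne w h].
- have := sb_eq sT (sb_map sT x (s := [:: 0; 1]) h isT isT); rewrite eqxx => /esym/eqP /= ->.
  exact: closure_left.
- have := sb_eq sT (sb_map sT x (s := [:: 0; 2]) h isT isT); rewrite eqxx => /esym/eqP /= ->.
  exact: closure_right.
have [s hs] := sb_ext4 sT k3 h tA.
have h3 : T [:: t; x; y] [:: s; u; v] by have := sb_map sT x (s := [:: 0; 2; 3]) hs; apply.
have htz : T [:: z; t] [:: w; s] by have := sb_map sT x (s := [:: 1; 0]) hs; apply.
have hzx : T [:: z; x] [:: w; u] by have := sb_map sT x (s := [:: 0; 1]) h; apply.
apply: closure_step (IH _ h3) _; first by apply: (sb_mem sT (sb_snd sT htz)).2.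
by rewrite -(sb_adj sT htz) -(sb_adj sT hzx).
Qed.

Lemma modrel_inv x y u v : T [:: x; y] [:: u; v] -> modrel x y -> modrel u v.
Proof.
move=> h /existsP[z /andP[zA /asboolP nz]].
have [w hw] := sb_ext3 sT k3 h zA.
have wz : T [:: w] [:: z].
  by apply: (sb_sym sT); have := sb_map sT x (s := [:: 0]) hw; apply.
apply/existsP; exists w; rewrite (sb_mem sT wz).1; apply/asboolP => cw; apply: nz.
exact: in_closure_inv cw (sb_sym sT hw).
Qed.

End Modules.

(** Induction on the size of [A]: components, co-components, or the modular quotient. The quotient
    game has one pebble less and [prime_iso] asks for ten, hence eleven. *)
Theorem bisim_iso (U W : finType) (e : rel U) (e' : rel W) k A B E :
  symmetric e -> irreflexive e -> irreflexive e' -> p5free e -> qfree e ->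
  bisim e e' k A B E -> E [::] [::] -> 10 < k -> iso_on e e' A B E.
Proof.
move=> esy eirr e'irr P5 Q bE E0 k10.
have k3 : 3 < k by apply: leq_trans k10.
have cosy := co_rel_sym esy.
have [n] := ubnP #|A|; elim: n A B E bE E0 => // n IH A B E bE E0 /ltnSE leAn.
have sT := selfE_self_bisim bE E0.
have tA : ty_closed (selfE E) A by move=> x u xu _; apply: (sb_mem sT xu).2.
have small (R : rel U) x : cls A R x != A -> #|cls A R x| < n.
  move=> ne; apply: leq_trans leAn; apply: proper_card; rewrite properEneq ne.
  by apply/subsetP => z; rewrite inE => /andP[].
have cn_equiv (r : rel U) : symmetric r -> equiv_on A (cn r A).
  by move=> rsy; split=> [x _|x y _ _|y x z _ _ _]; [apply: cn_refl | rewrite cn_sym | apply: cn_trans].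
have cn_small (r : rel U) x : symmetric r -> x \in A -> ~ connected_on r A -> cls A (cn r A) x != A.
  move=> rsy xA nc; apply/eqP => h; apply: nc => u v uA vA.
  have xc w : w \in A -> cn r A x w by rewrite -{1}h inE => /andP[].
  by apply: (cn_trans (y := x)); [rewrite cn_sym // xc | apply: xc].
have [conA|ncon] := pselect (connected_on e A); last first.
  apply: (decomposition bE (ltnW k3) E0 (cn_equiv e esy)).
  - by move=> x y u v h; apply: (cn_inv sT k3 (subxx A)).
  - move=> x y u v xA yA xu yv nR nR'.
    have uA := (sb_mem sT xu).2; have vA := (sb_mem sT yv).2.
    by rewrite (negbTE (ncn_edge xA yA nR)) (negbTE (ncn_edge uA vA nR')).
  move=> x x' Ex E' bE' E0' _; have [xA _] := bs_mem bE Ex.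
  by apply: IH bE' E0' _; apply: small; apply: cn_small.
have [coA|nco] := pselect (connected_on (co_rel e) A); last first.
  have sTc := selfE_self_bisim (bisim_co bE) E0.
  apply: (decomposition bE (ltnW k3) E0 (cn_equiv _ cosy)).
  - by move=> x y u v h; apply: (cn_inv sTc k3 (subxx A)).
  - move=> x y u v xA yA xu yv nR nR'.
    have uA := (sb_mem sT xu).2; have vA := (sb_mem sT yv).2.
    have full a b : a \in A -> b \in A -> ~~ cn (co_rel e) A a b -> e a b.
      move=> aA bA nab; have := ncn_edge aA bA nab; rewrite /co_rel /= negb_and !negbK.
      by case/orP => // /eqP ab; rewrite ab cn_refl in nab.
    by rewrite !full.
  move=> x x' Ex E' bE' E0' _; have [xA _] := bs_mem bE Ex.
  by apply: IH bE' E0' _; apply: small; apply: cn_small.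
have [A1|A2] := leqP #|A| 1.
  apply: discrete_iso bE E0 _ => // x y xy; have [xA yA] := sb_mem sT xy.
  exact: (card_le1_eqP A1).
have Req := modrel_equiv esy conA coA A2.
have Rinv x y u v : selfE E [:: x; y] [:: u; v] -> modrel e A x y -> modrel e A u v.
  exact: (modrel_inv sT k3).
have Rmod := modrel_module esy conA coA A2.
apply: (quotient_iso bE (ltnW k3) E0 Req Rinv) => //.
  have bQ := bisim_quotient bE (ltnW k3) E0 Req Rinv k3 eirr e'irr Rmod.
  apply: prime_iso bQ _ _ => //.
  - exact: modrel_prime.
  - exact: modrel_connected.
  - exact: quotE_nil.
  by case: (k) k10.
move=> x x' Ex E' bE' E0' _; have [xA _] := bs_mem bE Ex.
apply: IH bE' E0' _; apply: small; exact: modrel_proper.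
Qed.

(** * From excluded induced subgraphs to the local conditions *)

(** In the disjoint union 0 and 1 are the isolated vertices and 2, 3, 4 the consecutive vertices of
    the path. *)
Lemma adj_co_2P1_P3 (i j : 'I_5) : adj co_2P1_P3 i j =
  (i != j) && ~~ [&& 1 < i, 1 < j & (i.+1 == j :> nat) || (j.+1 == i :> nat)].
Proof.
congr (_ && ~~ _); rewrite /=; case: splitP => i' hi; case: splitP => j' hj.
- have hi' : i' < 2 := ltn_ord i'; rewrite hi [1 < i']ltnNge -ltnS hi' /=.
  by case: splitP => a _; case: splitP => b _ //; rewrite (ord1 a) (ord1 b).
- by have hi' : i' < 2 := ltn_ord i'; rewrite hi [1 < i']ltnNge -ltnS hi'.
- by have hj' : j' < 2 := ltn_ord j'; rewrite hj [1 < j']ltnNge -[j' <= 1]ltnS hj' andbF.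
by rewrite hi hj /= -!addnS !eqn_add2l.
Qed.

Section Transfer.
Variable G : graph.
Hypothesis sG : simple G.

(* H has no two vertices with the same neighbourhood, so any map preserving adjacency is injective. *)
Lemma induced_sub5 (h : rel 'I_5) (s : seq 'I_(nv G)) x0 :
  (forall i j, (forall z, h i z = h j z) -> i = j) ->
  (forall i j : 'I_5, h i j = adj G (nth x0 s i) (nth x0 s j)) ->
  induced_sub (Graph h) G.
Proof.
move=> tw hs; exists (fun i : 'I_5 => nth x0 s i); split=> // i j ij.
by apply: tw => z; rewrite !hs ij.
Qed.

Lemma simple_p5free : ~ induced_sub (path_graph 5) G -> p5free (adj G).
Proof.
move=> nP a b c d f ab bc cd df ac ad af bd bf cf; apply: nP.
have [sy ir] := sG.
apply: (induced_sub5 (s := [:: a; b; c; d; f]) (x0 := a)).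
  move=> i j h; apply/val_inj; move: (h ord0) (h (inord 1)) (h (inord 2)) (h (inord 3)) (h (inord 4)).
  by rewrite !inordK //; case: i j {h} => [[|[|[|[|[|?]]]]] ?] [[|[|[|[|[|?]]]]] ?].
move=> [[|[|[|[|[|?]]]]] ?] [[|[|[|[|[|?]]]]] ?] //=; rewrite ?ir //; apply/esym;
  by [| apply/negbTE | rewrite sy | rewrite sy; apply/negbTE].
Qed.

(** [p] and [q] are the dominating vertices, and [r], [v], [s] is the path of the complement. *)
Lemma induced_co_2P1_P3 p q r v s : let a := adj G in
  a p q -> a p r -> a p v -> a p s -> a q r -> a q v -> a q s -> a r s ->
  ~~ a v r -> ~~ a v s -> induced_sub co_2P1_P3 G.
Proof.
move=> a pq pr pv ps qr qv qs rs vr vs; have [sy ir] := sG.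
apply: (induced_sub5 (h := adj co_2P1_P3) (s := [:: p; q; r; v; s]) (x0 := p)).
  move=> i j h; apply/val_inj.
  move: (h ord0) (h (inord 1)) (h (inord 2)) (h (inord 3)) (h (inord 4)).
  rewrite !adj_co_2P1_P3 -!val_eqE /= !inordK //.
  by case: i j {h} => [[|[|[|[|[|?]]]]] ?] [[|[|[|[|[|?]]]]] ?].
move=> i j; rewrite adj_co_2P1_P3 -val_eqE.
move: i j => [[|[|[|[|[|?]]]]] ?] [[|[|[|[|[|?]]]]] ?] //=; rewrite ?ir //; apply/esym;
  by [| apply/negbTE | rewrite sy | rewrite sy; apply/negbTE].
Qed.

Lemma simple_qfree : ~ induced_sub co_2P1_P3 G -> qfree (adj G).
Proof.
move=> nQ a b c d v /and5P[ab ac ad bc /andP[bd cd]]; have [sy ir] := sG.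
have [ba ca da] : [/\ adj G b a, adj G c a & adj G d a] by split; rewrite sy.
have [cb db dc] : [/\ adj G c b, adj G d b & adj G d c] by split; rewrite sy.
rewrite /deg4; apply/negP => deg; apply: nQ.
case va : (adj G v a) deg; case vb : (adj G v b); case vc : (adj G v c);
  case vd : (adj G v d) => // _.
- by apply: (induced_co_2P1_P3 (p := a) (q := b) (r := c) (v := v) (s := d)); rewrite ?va ?vb ?vc ?vd // sy ?va ?vb ?vc ?vd.
- by apply: (induced_co_2P1_P3 (p := a) (q := c) (r := b) (v := v) (s := d)); rewrite ?va ?vb ?vc ?vd // sy ?va ?vb ?vc ?vd.
- by apply: (induced_co_2P1_P3 (p := a) (q := d) (r := b) (v := v) (s := c)); rewrite ?va ?vb ?vc ?vd // sy ?va ?vb ?vc ?vd.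
- by apply: (induced_co_2P1_P3 (p := b) (q := c) (r := a) (v := v) (s := d)); rewrite ?va ?vb ?vc ?vd // sy ?va ?vb ?vc ?vd.
- by apply: (induced_co_2P1_P3 (p := b) (q := d) (r := a) (v := v) (s := c)); rewrite ?va ?vb ?vc ?vd // sy ?va ?vb ?vc ?vd.
by apply: (induced_co_2P1_P3 (p := c) (q := d) (r := a) (v := v) (s := b)); rewrite ?va ?vb ?vc ?vd // sy ?va ?vb ?vc ?vd.
Qed.

End Transfer.

Theorem bisim_isomorphic G H k E : simple G -> simple H -> free2 co_2P1_P3 (path_graph 5) G ->
  bisim (adj G) (adj H) k setT setT E -> E [::] [::] -> 10 < k -> isomorphic G H.
Proof.
move=> sG sH [nQ nP] bE E0 k10.
have [sy ir] := sG; have [_ ir'] := sH.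
have [f [[finj fim] fe _]] := bisim_iso sy ir ir' (simple_p5free sG nP) (simple_qfree sG nQ) bE E0 k10.
exists f; split; last by move=> x y; apply: fe.
have fi : injective f by move=> x y; apply: finj.
have cf : #|'I_(nv G)| = #|'I_(nv H)|.
  by rewrite -!cardsT -fim card_imset.
by apply: inj_card_bij fi _; rewrite cf.
Qed.

(** * Structured tape programs and their Turing machines *)

Section Programs.
Variable Gam : finType.

Inductive tprog :=
| Act of (Gam -> Gam) & move
| Then of tprog & tprog
| Cond of (Gam -> bool) & tprog & tprog
| Loop of (Gam -> bool) & tprog.

Definition tape := nat -> Gam.
Definition wr (T : tape) h a : tape := fun i => if i == h then a else T i.
Definition mv m h := match m with MoveL => h.-1 | MoveR => h.+1 | Stay => h end.

(* runs p h T t h' T': started with head h on tape T, p takes t steps to head h' and tape T'. *)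
Inductive runs : tprog -> nat -> tape -> nat -> nat -> tape -> Prop :=
| runs_act f m h T : (m = MoveL -> 0 < h) ->
    runs (Act f m) h T 1 (mv m h) (wr T h (f (T h)))
| runs_then p q h T t h1 T1 t' h2 T2 :
    runs p h T t h1 T1 -> runs q h1 T1 t' h2 T2 -> runs (Then p q) h T (t + t') h2 T2
| runs_cond (b : Gam -> bool) p q h T t h1 T1 :
    runs (if b (T h) then p else q) h T t h1 T1 -> runs (Cond b p q) h T t.+1 h1 T1
| runs_stop (b : Gam -> bool) p h T : ~~ b (T h) -> runs (Loop b p) h T 1 h T
| runs_loop (b : Gam -> bool) p h T t h1 T1 t' h2 T2 : b (T h) ->
    runs p h T t h1 T1 -> runs (Loop b p) h1 T1 t' h2 T2 -> runs (Loop b p) h T (t + t').+1 h2 T2.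

Definition instr := Gam -> Gam * move * nat.

Fixpoint tsize p := match p with
  | Act _ _ => 1
  | Then p q => tsize p + tsize q
  | Cond _ p q => (tsize p + tsize q).+1
  | Loop _ p => (tsize p).+1
  end.

(** The code occupies the addresses from [s] on and leaves to [nxt]; addresses are machine
    states. *)
Fixpoint compile p (s nxt : nat) : seq instr := match p with
  | Act f m => [:: fun a => (f a, m, nxt)]
  | Then p q => compile p s (s + tsize p) ++ compile q (s + tsize p) nxt
  | Cond b p q => (fun a => (a, Stay, if b a then s.+1 else s.+1 + tsize p)) ::
      compile p s.+1 nxt ++ compile q (s.+1 + tsize p) nxt
  | Loop b p => (fun a => (a, Stay, if b a then s.+1 else nxt)) :: compile p s.+1 s
  end.

Lemma size_compile p s nxt : size (compile p s nxt) = tsize p.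
Proof.
elim: p s nxt => [f m|p IHp q IHq|b p IHp q IHq|b p IHp] s nxt //=;
  by rewrite ?size_cat ?IHp ?IHq.
Qed.

Variables (bl : Gam) (sy : sym -> Gam) (p0 : tprog) (b0 : Gam -> bool).

(** A final instruction tests the cell under the head. The two addresses just past the code are the
    accepting and the rejecting state. *)
Let C : seq instr :=
  rcons (compile p0 0 (tsize p0)) (fun a => (a, Stay, if b0 a then (tsize p0).+1 else (tsize p0).+2)).
Let state := 'I_(size C).+2.

Let sizeC : size C = (tsize p0).+1. Proof. by rewrite size_rcons size_compile. Qed.

Definition machine : TM state Gam := {|
  blank := bl; inp := sy; q0 := inord 0; qacc := inord (size C); qrej := inord (size C).+1;
  delta := fun q a => if q < size C
    then let: (a', m, pc) := nth (fun a => (a, Stay, 0)) C q a in (inord pc, a', m)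
    else (q, a, Stay) |}.

(** Cells are numbered from the start of the input. As programs never move left of cell 0, the head
    position is the length of the left list. *)
Definition represents (c : config state Gam) (pc h : nat) (T : tape) :=
  [/\ st c = inord pc, size (lft c) = h & forall i, nth bl (rev (lft c) ++ cur c :: rgt c) i = T i].

Lemma represents_cur c pc h T : represents c pc h T -> cur c = T h.
Proof. by case=> _ sz /(_ h) <-; rewrite nth_cat size_rev sz ltnn subnn. Qed.

Lemma represents_step c pc h T i g a m pc' : represents c pc h T -> pc < size C ->
  nth i C pc = g -> g (T h) = (a, m, pc') -> pc' <= (size C).+1 -> (m = MoveL -> 0 < h) ->
  represents (step machine c) pc' (mv m h) (wr T h a).
Proof.
move=> rc lt nC gT le' mh; have cc := represents_cur rc.
case: rc => sc sz hT; have vpc : (inord pc : state) = pc :> nat by rewrite inordK // (ltn_trans lt).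
rewrite /step /halted sc -!val_eqE /= vpc !inordK // (ltn_eqF lt) (ltn_eqF (ltn_trans lt (ltnSn _))) /=.
rewrite lt cc (set_nth_default i) // nC gT.
have hT' j : nth bl (rev (lft c) ++ a :: rgt c) j = wr T h a j.
  move: (hT j); rewrite /wr !nth_cat size_rev sz; case: ltngtP => // [jh <-|-> _]; last by rewrite subnn.
  by case: (j - h) (subn_gt0 h j) => //; rewrite jh.
case: m mh gT => [/(_ erefl) h0 _|_ _|_ _]; last by split.
  case: (lft c) sz hT' => [sz|b l /= sz hT']; first by rewrite -sz in h0.
  split=> //=; first by rewrite -sz.
  by move=> j; rewrite -hT' rev_cons cat_rcons.
case: (rgt c) hT' => [|b r] hT'; split=> //=; rewrite ?sz // => j; rewrite rev_cons cat_rcons -hT' //.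
rewrite -[a :: [:: bl]]/([:: a] ++ [:: bl]) catA cats1 nth_rcons.
by case: ltngtP => [_|jl|->] //; rewrite nth_default // ltnW.
Qed.

Definition segment s (D : seq instr) := exists D1 D2, C = D1 ++ D ++ D2 /\ size D1 = s.

Lemma segment_cat s D D' : segment s (D ++ D') -> segment s D /\ segment (s + size D) D'.
Proof.
case=> D1 [D2 [CE <-]]; split; first by exists D1, (D' ++ D2); rewrite CE -!catA.
by exists (D1 ++ D), D2; rewrite CE size_cat -!catA.
Qed.

Lemma segment_head s i D : segment s (i :: D) -> s < size C /\ nth i C s = i.
Proof.
case=> D1 [D2 [-> <-]]; rewrite !size_cat /= !addnS ltnS leq_addr; split=> //.
by rewrite nth_cat ltnn subnn.
Qed.

Lemma compile_correct p h T t h' T' : runs p h T t h' T' -> forall c s nxt,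
  segment s (compile p s nxt) -> nxt <= (size C).+1 -> represents c s h T ->
  represents (iter t (step machine) c) nxt h' T'.
Proof.
elim=> {p h T t h' T'}
  [f m h T mh|p q h T t h1 T1 t' h2 T2 _ IH1 _ IH2|b p q h T t h1 T1 _ IH|b p h T nb|
   b p h T t h1 T1 t' h2 T2 bT _ IH1 _ IH2] c s nxt /=.
- move=> /segment_head[lt nC] le rc; exact: (represents_step rc lt nC erefl le mh).
- move=> /segment_cat[sp]; rewrite size_compile => sq le rc.
  rewrite addnC iterD; apply: (IH2 _ _ _ sq le); apply: (IH1 _ _ _ sp _ rc).
  by case: sq => D1 [D2 [CE <-]]; rewrite CE size_cat ltnW // ltnS leq_addr.
- move=> sg le rc; have [lt nC] := segment_head sg.
  have := @segment_cat _ [:: _] _ sg; rewrite addn1 => -[_ /segment_cat[sp]].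
  rewrite size_compile => sq; rewrite -iterS iterSr.
  have le1 : s.+1 <= (size C).+1 by rewrite ltnS ltnW.
  have wT : wr T h (T h) = T.
    by apply: funext => i; rewrite /wr; case: eqP => [->|].
  have rc' : represents (step machine c) (if b (T h) then s.+1 else s.+1 + tsize p) h T.
    have le2 : (if b (T h) then s.+1 else s.+1 + tsize p) <= (size C).+1.
      case: ifP => // _; case: sq => D1 [D2 [CE <-]].
      by rewrite CE size_cat ltnW // ltnS leq_addr.
    by rewrite -[X in represents _ _ _ X]wT; have := represents_step (m := Stay) rc lt nC _ le2; apply.
  by case: (b (T h)) rc' IH => rc' IH; [apply: IH sp le rc' | apply: IH sq le rc'].
- move=> sg le rc; have [lt nC] := segment_head sg.
  have wT : wr T h (T h) = T by apply: funext => i; rewrite /wr; case: eqP => [->|].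
  by rewrite -[X in represents _ _ _ X]wT; have := represents_step (m := Stay) rc lt nC _ le; apply; rewrite // (negbTE nb).
move=> sg le rc; have [lt nC] := segment_head sg.
have := @segment_cat _ [:: _] _ sg; rewrite addn1 => -[_ sp].
have wT : wr T h (T h) = T by apply: funext => i; rewrite /wr; case: eqP => [->|].
have le1 : s.+1 <= (size C).+1 by rewrite ltnS ltnW.
have rc' : represents (step machine c) s.+1 h T.
  by rewrite -[X in represents _ _ _ X]wT; have := represents_step (m := Stay) rc lt nC _ le1; apply; rewrite // bT.
rewrite -iterS -addSn addnC iterD iterSr; apply: (IH2 _ _ _ sg le); apply: (IH1 _ _ _ sp _ rc').
by rewrite ltnW // ltnS ltnW.
Qed.

Theorem machine_correct w T0 t h T : runs p0 0 T0 t h T ->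
  (forall i, nth bl (map sy w) i = T0 i) -> 
  halted machine (run machine t.+1 w) /\ (st (run machine t.+1 w) = qacc machine <-> b0 (T h)).
Proof.
move=> r hT.
have r0 : represents (init machine w) 0 0 T0.
  case: w hT => [|x w] hT; split=> //= i; rewrite -hT //.
  by case: i => [|i] /=; rewrite ?nth_nil.
have sg : segment 0 (compile p0 0 (tsize p0)).
  by exists [::]; eexists; split=> //; rewrite /C -cats1.
have rt := compile_correct r sg (leqW (leq_trans (leqnSn _) (eq_leq (esym sizeC)))) r0.
have rf : represents (run machine t.+1 w) (if b0 (T h) then (size C) else (size C).+1) h (wr T h (T h)).
  have nC : nth (fun a => (a, Stay, 0)) C (tsize p0) =
      (fun a => (a, Stay, if b0 a then (tsize p0).+1 else (tsize p0).+2)).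
    by rewrite /C nth_rcons size_compile ltnn eqxx.
  have := represents_step (m := Stay) (h := h) (T := T) _ _ nC; rewrite -sizeC /=.
  by apply; rewrite ?sizeC //; case: ifP.
case: rf => sf _ _; rewrite /halted sf -!val_eqE /= !inordK //; last by case: ifP.
split; first by case: ifP; rewrite eqxx ?orbT.
case: ifP => // _; split=> // /(congr1 val); rewrite /= !inordK // => /eqP.
by rewrite gtn_eqF.
Qed.

End Programs.

(** * A language of counters and bit arrays and its compilation *)

Record store := Store { ctr : nat -> nat; arr : nat -> nat -> bool }.

Definition set_ctr s x v := Store (fun y => if y == x then v else ctr s y) (arr s).
Definition put s a i b :=
  Store (ctr s) (fun a' j => if (a' == a) && (j == i) then b else arr s a' j).

(** [Inc] saturates at the cap, so commands without [Grow] keep all counters below it; [Grow] serves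
    to build the cap itself. *)
Inductive cmd :=
| Skip
| Zero of nat
| Inc of nat
| Grow of nat
| Put of nat & nat & bool
| If of nat & nat & cmd & cmd
| Seq of cmd & cmd
| For of nat & nat & cmd.

Fixpoint asg c : seq nat := match c with
  | Skip | Put _ _ _ => [::]
  | Zero x | Inc x | Grow x => [:: x]
  | If _ _ c d | Seq c d => asg c ++ asg d
  | For x _ c => x :: asg c
  end.

Section Language.
Variables (NC K : nat).

(* Tracks below NC carry the single mark of a counter, the other ones are bit arrays. *)
Definition track s z i := if z < NC then ctr s z == i else arr s z i.

Fixpoint exec c s : store := match c with
  | Skip => s
  | Zero x => set_ctr s x 0
  | Inc x => set_ctr s x (if ctr s x == ctr s 1 then ctr s x else (ctr s x).+1)
  | Grow x => set_ctr s x (ctr s x).+1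
  | Put a x b => put s a (ctr s x) b
  | If x z c d => if track s z (ctr s x) then exec c s else exec d s
  | Seq c d => exec d (exec c s)
  | For x y c =>
      set_ctr (foldl (fun s v => exec c (set_ctr s x v)) s (iota 0 (ctr s y))) x (ctr s y)
  end.

(* Counter 0 marks the home cell, counter 1 caps [Inc]. *)
Fixpoint wf c : bool := match c with
  | Skip => true
  | Zero x | Inc x => 1 < x < NC
  | Grow x => 0 < x < NC
  | Put a x _ => (NC <= a <= K) && (x < NC)
  | If x z c d => [&& x < NC, z <= K, wf c & wf d]
  | Seq c d => wf c && wf d
  | For x y c => [&& 1 < x < NC, y < NC, x != y, x \notin asg c, y \notin asg c & wf c]
  end.

Definition loop x c s v := foldl (fun s v => exec c (set_ctr s x v)) s (iota 0 v).

Lemma loopS x c s v : loop x c s v.+1 = exec c (set_ctr (loop x c s v) x v).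
Proof. by rewrite /loop -addn1 iotaD foldl_cat. Qed.

Lemma exec_for x y c s : exec (For x y c) s = set_ctr (loop x c s (ctr s y)) x (ctr s y).
Proof. by []. Qed.

Lemma ctr_set s x v y : ctr (set_ctr s x v) y = if y == x then v else ctr s y.
Proof. by []. Qed.

Lemma set_set s x v w : set_ctr (set_ctr s x v) x w = set_ctr s x w.
Proof. by congr Store; apply: funext => y /=; case: eqP. Qed.

Lemma set_id s x : set_ctr s x (ctr s x) = s.
Proof. by case: s => f m; congr Store; apply: funext => y /=; case: eqP => // ->. Qed.

Lemma ctr_frame c s x : x \notin asg c -> ctr (exec c s) x = ctr s x.
Proof.
elim: c s => [|y|y|y|a y b|y z c IHc d IHd|c IHc d IHd|y z c IH] s //=;
  rewrite ?inE ?mem_cat ?negb_or; try by move=> /negbTE ->.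
- by case/andP => /IHc hc /IHd hd; case: ifP.
- by case/andP => /IHc hc /IHd hd; rewrite hd hc.
case/andP => /negbTE xy /IH h; rewrite xy -/(loop y c s (ctr s z)).
by elim: (ctr s z) => // v hv; rewrite loopS h /= xy.
Qed.

Lemma wf_zero c : wf c -> 0 \notin asg c.
Proof.
elim: c => [|y|y|y|a y b|y z c IHc d IHd|c IHc d IHd|y z c IH] //=;
  rewrite ?inE ?mem_cat ?negb_or; try by case: y.
- by case/and4P => _ _ /IHc -> /IHd ->.
- by case/andP => /IHc -> /IHd ->.
by case/and5P => yp _ _ _ /andP[_ /IH ->]; case: y yp.
Qed.

(** Every cell carries one bit for each track, so all counters and arrays share a single tape. *)
Definition cell : finType := {ffun 'I_K.+1 -> bool}.
Definition cbit (a : cell) z := a (inord z).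
Definition cset (a : cell) z b : cell := [ffun o : 'I_K.+1 => if o == z :> nat then b else a o].
Definition tape_of s : tape cell := fun i => [ffun z : 'I_K.+1 => track s z i].

Lemma cbit_set a x b z : z <= K -> cbit (cset a x b) z = if z == x then b else cbit a z.
Proof. by move=> zK; rewrite /cbit ffunE inordK. Qed.

Lemma cbit_tape s i z : z <= K -> cbit (tape_of s i) z = track s z i.
Proof. by move=> zK; rewrite /cbit ffunE inordK. Qed.

Lemma tape_ext (T T' : tape cell) : (forall i z, z <= K -> cbit (T i) z = cbit (T' i) z) -> T = T'.
Proof.
move=> h; apply: funext => i; apply/ffunP => z.
by have := h i z (leq_ord z); rewrite /cbit inord_val.
Qed.

Lemma cbit_wr (T : tape cell) h x b i z : z <= K ->
  cbit (wr T h (cset (T h) x b) i) z = if (i == h) && (z == x) then b else cbit (T i) z.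
Proof. by move=> zK; rewrite /wr; case: eqP => //= ->; rewrite cbit_set. Qed.

Definition home := Loop (fun a : cell => ~~ cbit a 0) (Act id MoveL).
Definition seek x := Loop (fun a : cell => ~~ cbit a x) (Act id MoveR).
Definition mark x b := Act (fun a : cell => cset a x b) Stay.
Definition shift x := Then (Act (fun a : cell => cset a x false) MoveR) (mark x true).

(** Every command starts and ends at the home cell. To access index x of an array, or to compare x
    with another counter, the head seeks the mark of x and reads the other track there. *)
Fixpoint low c : tprog cell := match c with
  | Skip => Act id Stay
  | Zero x => Then (seek x) (Then (mark x false) (Then home (mark x true)))
  | Inc x => Then (seek x) (Then (Cond (fun a => cbit a 1) (Act id Stay) (shift x)) home)
  | Grow x => Then (seek x) (Then (shift x) home)
  | Put a x b => Then (seek x) (Then (mark a b) home)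
  | If x z c d => Then (seek x) (Cond (fun a => cbit a z) (Then home (low c)) (Then home (low d)))
  | Seq c d => Then (low c) (low d)
  | For x y c => Then (Then (seek x) (Then (mark x false) (Then home (mark x true))))
      (Then (seek x) (Then (Loop (fun a => ~~ cbit a y)
        (Then home (Then (low c) (Then (Then (seek x) (Then (shift x) home)) (seek x))))) home))
  end.

Lemma wr_id (G : finType) (T : tape G) h : wr T h (T h) = T.
Proof. by apply: funext => i; rewrite /wr; case: eqP => [->|]. Qed.

Lemma scan_runs (b : cell -> bool) (T : tape cell) h p : h <= p ->
  (forall i, h <= i < p -> b (T i)) -> ~~ b (T p) ->
  runs (Loop b (Act id MoveR)) h T (2 * (p - h)).+1 p T.
Proof.
move/subnKC <-; rewrite addKn; move: (p - h) => d; elim: d h => [|d IH] h nx px.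
  by rewrite addn0 in px *; apply: runs_stop.
rewrite mulnS; apply: (runs_loop (t := 1) (h1 := h.+1) (T1 := T)); first by apply: nx; lia.
  by rewrite -[X in runs _ _ _ _ _ X](wr_id T h); apply: (@runs_act _ id MoveR).
by rewrite -addSnnS in px *; apply: IH => // i ip; apply: nx; lia.
Qed.

Lemma home_runs (T : tape cell) h : (forall i, 0 < i <= h -> ~~ cbit (T i) 0) -> cbit (T 0) 0 ->
  runs home h T (2 * h).+1 0 T.
Proof.
elim: h => [|h IH] nx px; first by apply: runs_stop; rewrite px.
rewrite mulnS; apply: (runs_loop (t := 1) (h1 := h) (T1 := T)); first by apply: nx; lia.
  by rewrite -[X in runs _ _ _ _ _ X](wr_id T h.+1); apply: (@runs_act _ id MoveL).
by apply: IH => // i ip; apply: nx; lia.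
Qed.

Lemma mark_runs (T : tape cell) x b h : runs (mark x b) h T 1 h (wr T h (cset (T h) x b)).
Proof. exact: (@runs_act _ (fun a => cset a x b) Stay). Qed.

Hypotheses (NCK : NC <= K) (NC1 : 1 < NC).

Lemma cbit_ctr s i x : x < NC -> cbit (tape_of s i) x = (ctr s x == i).
Proof. by move=> xN; rewrite cbit_tape ?/track ?xN // (leq_trans (ltnW xN)). Qed.

Lemma seek_store s x h : x < NC -> h <= ctr s x ->
  runs (seek x) h (tape_of s) (2 * (ctr s x - h)).+1 (ctr s x) (tape_of s).
Proof.
move=> xN hx; apply: scan_runs => //; last by rewrite cbit_ctr // eqxx.
by move=> i ip; rewrite cbit_ctr //; lia.
Qed.

Lemma home_store s h : ctr s 0 = 0 -> runs home h (tape_of s) (2 * h).+1 0 (tape_of s).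
Proof.
move=> s0; have N0 : 0 < NC by lia.
by apply: home_runs => [i ip|]; rewrite cbit_ctr // s0; lia.
Qed.

Lemma move_mark s x q : x < NC ->
  let T := wr (tape_of s) (ctr s x) (cset (tape_of s (ctr s x)) x false) in
  wr T q (cset (T q) x true) = tape_of (set_ctr s x q).
Proof.
move=> xN T; apply: tape_ext => i z zK; rewrite !cbit_wr // !cbit_tape // /track /=.
have [->|nzx] := eqVneq z x; last by rewrite !andbF.
by rewrite xN !andbT; do 2?[case: eqP => // ?]; subst; lia.
Qed.

Definition lzero x := Then (seek x) (Then (mark x false) (Then home (mark x true))).
Definition lgrow x := Then (seek x) (Then (shift x) home).

Lemma zero_runs s x : ctr s 0 = 0 -> 0 < x < NC ->
  runs (lzero x) 0 (tape_of s) (4 * ctr s x + 4) 0 (tape_of (set_ctr s x 0)).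
Proof.
move=> s0 /andP[x0 xN]; rewrite -(move_mark s 0 xN).
have -> : 4 * ctr s x + 4 = (2 * (ctr s x - 0)).+1 + (1 + ((2 * ctr s x).+1 + 1)) by lia.
apply: runs_then (seek_store _ _) _ => //; apply: runs_then (mark_runs _ _ _ _) _.
apply: runs_then (mark_runs _ _ _ _).
apply: home_runs => [i ip|]; rewrite cbit_wr // (ltn_eqF x0) andbF cbit_ctr ?s0; lia.
Qed.

Lemma shift_runs s x : x < NC -> runs (shift x) (ctr s x) (tape_of s) 2 (ctr s x).+1
  (tape_of (set_ctr s x (ctr s x).+1)).
Proof.
move=> xN; rewrite -(move_mark s _ xN).
by apply: (runs_then (t := 1) _ (mark_runs _ _ _ _)); apply: (@runs_act _ (fun a => cset a x false) MoveR).
Qed.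

Lemma grow_runs s x : ctr s 0 = 0 -> 0 < x < NC ->
  runs (lgrow x) 0 (tape_of s) (4 * ctr s x + 6) 0 (tape_of (set_ctr s x (ctr s x).+1)).
Proof.
move=> s0 /andP[x0 xN].
have -> : 4 * ctr s x + 6 = (2 * (ctr s x - 0)).+1 + (2 + (2 * (ctr s x).+1).+1) by lia.
apply: runs_then (seek_store _ _) _ => //; apply: runs_then (shift_runs _ _) _ => //.
by apply: home_store; rewrite ctr_set (ltn_eqF x0).
Qed.

(** Bounds the counters throughout the execution, so that each seek takes time linear in [B]. *)
Fixpoint good B c s : Prop := match c with
  | Skip => True
  | Zero x | Inc x | Grow x | Put x _ _ => forall y, y < NC -> ctr s y <= B
  | If x z c d => (forall y, y < NC -> ctr s y <= B) /\
      if track s z (ctr s x) then good B c s else good B d s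
  | Seq c d => good B c s /\ good B d (exec c s)
  | For x y c => (forall y, y < NC -> ctr s y <= B) /\
      forall v, v < ctr s y -> good B c (set_ctr (loop x c s v) x v)
  end.

Fixpoint tm B c := match c with
  | Skip | Zero _ | Inc _ | Grow _ | Put _ _ _ => 10 * B.+1
  | If _ _ c d => 10 * B.+1 + (tm B c + tm B d)
  | Seq c d => tm B c + tm B d
  | For _ _ c => B.+1 * (20 * B.+1 + tm B c)
  end.

Theorem low_runs B c s : wf c -> good B c s -> ctr s 0 = 0 ->
  exists2 t, t <= tm B c & runs (low c) 0 (tape_of s) t 0 (tape_of (exec c s)).
Proof.
elim: c s => [|x|x|x|a x b|x z c IHc d IHd|c IHc d IHd|x y c IH] s /=.
- move=> _ _ _; exists 1; first by lia.
  by rewrite -[X in runs _ _ _ _ _ X](wr_id (tape_of s) 0); apply: (@runs_act _ id Stay).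
- move=> /andP[x1 xN] /(_ x xN) le s0; exists (4 * ctr s x + 4); first by lia.
  by apply: zero_runs; rewrite // xN (ltn_trans _ x1).
- move=> /andP[x1 xN] /(_ x xN) le s0.
  have [full|free] := eqVneq (ctr s x) (ctr s 1).
    exists ((2 * (ctr s x - 0)).+1 + (2 + (2 * ctr s x).+1)); first by lia.
    apply: runs_then (seek_store _ _) _ => //; rewrite set_id.
    apply: runs_then (home_store _ s0); apply: runs_cond; rewrite cbit_ctr // full eqxx.
    by rewrite -[X in runs _ _ _ _ _ X](wr_id (tape_of s) (ctr s 1)); apply: (@runs_act _ id Stay).
  exists ((2 * (ctr s x - 0)).+1 + (3 + (2 * (ctr s x).+1).+1)); first by lia.
  apply: runs_then (seek_store _ _) _ => //.
  apply: runs_then (home_store _ _); last by rewrite ctr_set; case: eqP x1 => // <-.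
  by apply: runs_cond; rewrite cbit_ctr // eq_sym (negbTE free); apply: shift_runs.
- move=> /andP[x1 xN] /(_ x xN) le s0; exists (4 * ctr s x + 6); first by lia.
  by apply: grow_runs; rewrite // xN x1.
- move=> /andP[/andP[aN aK] xN] /(_ x xN) le s0.
  exists ((2 * (ctr s x - 0)).+1 + (1 + (2 * ctr s x).+1)); first by lia.
  apply: runs_then (seek_store _ _) _ => //.
  have E : wr (tape_of s) (ctr s x) (cset (tape_of s (ctr s x)) a b) = tape_of (put s a (ctr s x) b).
    apply: tape_ext => i z zK; rewrite cbit_wr // !cbit_tape // /track /=.
    have [->|nza] := eqVneq z a; last by rewrite andbF.
    by rewrite andbT ltnNge aN.
  by apply: (runs_then (mark_runs _ _ _ _)); rewrite E; apply: home_store.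
- move=> /and4P[xN zK wc wd] [/(_ x xN) le g] s0.
  have [t [lt rt]] : exists t, t <= (2 * ctr s x).+1 + (tm B c + tm B d) /\
      runs (if track s z (ctr s x) then Then home (low c) else Then home (low d))
        (ctr s x) (tape_of s) t 0 (tape_of (if track s z (ctr s x) then exec c s else exec d s)).
    case: ifP g => _ g; [have [t tl tr] := IHc s wc g s0 | have [t tl tr] := IHd s wd g s0];
      exists ((2 * ctr s x).+1 + t); split; try lia; by apply: runs_then tr; apply: home_store.
  exists ((2 * (ctr s x - 0)).+1 + t.+1); first by lia.
  apply: runs_then (seek_store _ _) _ => //.
  by apply: runs_cond; rewrite cbit_tape.
- move=> /andP[wc wd] [gc gd] s0; have [t tl tr] := IHc s wc gc s0.
  have s0' : ctr (exec c s) 0 = 0 by rewrite ctr_frame // wf_zero.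
  have [t' tl' tr'] := IHd _ wd gd s0'.
  by exists (t + t'); [lia | apply: runs_then tr tr'].
move=> /and5P[/andP[x1 xN] yN nxy nxc /andP[nyc wc]] [bd g] s0.
have [le ley] := (bd x xN, bd y yN).
pose S v := set_ctr (loop x c s v) x v.
have x0 : 0 < x by lia.
have ctr_loop z v : z \notin x :: asg c -> ctr (loop x c s v) z = ctr s z.
  rewrite inE negb_or => /andP[zx zc]; elim: v => // v hv.
  by rewrite loopS ctr_frame // ctr_set (negbTE zx).
have S0 v : ctr (S v) 0 = 0.
  rewrite /S ctr_set (ltn_eqF x0) ctr_loop // inE negb_or (ltn_eqF x0) /=; exact: wf_zero.
have Sy v : ctr (S v) y = ctr s y.
  by rewrite /S ctr_set eq_sym (negbTE nxy) ctr_loop // inE negb_or eq_sym nxy.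
have Sx v : ctr (S v) x = v by rewrite /S ctr_set eqxx.
pose body := Then home (Then (low c) (Then (lgrow x) (seek x))).
(* Loop invariant: the head stands at cell [v] on the mark of [x], the store is [S v], and [d]
   rounds remain. *)
have lp d v : v + d = ctr s y -> exists2 t, t <= (d * (8 * B + 12 + tm B c)).+1 &
    runs (Loop (fun a => ~~ cbit a y) body) v (tape_of (S v)) t (ctr s y) (tape_of (S (ctr s y))).
  elim: d v => [|d IHd] v vd.
    rewrite addn0 in vd; exists 1 => //; rewrite -vd; apply: runs_stop.
    by rewrite cbit_ctr // Sy vd eqxx.
  have vy : v < ctr s y by lia.
  have [t tl tr] := IH (S v) wc (g v vy) (S0 v).
  have [t' tl' tr'] := IHd v.+1 (etrans (addSnnS v d) vd).
  exists (((2 * v).+1 + (t + (4 * v + 6 + (2 * (v.+1 - 0)).+1))) + t').+1; first by lia.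
  apply: (runs_loop (h1 := v.+1) (T1 := tape_of (S v.+1))) => //.
    by rewrite cbit_ctr // Sy; lia.
  apply: runs_then (home_store _ (S0 v)) _; apply: runs_then tr _.
  have Ex : ctr (exec c (S v)) x = v by rewrite ctr_frame ?Sx.
  have -> : S v.+1 = set_ctr (exec c (S v)) x v.+1 by rewrite /S loopS.
  have gr := @grow_runs (exec c (S v)) x; rewrite Ex in gr; apply: runs_then (gr _ _) _.
  - by rewrite ctr_frame ?wf_zero.
  - by rewrite x0.
  have sk := @seek_store (set_ctr (exec c (S v)) x v.+1) x 0 xN.
  by rewrite ctr_set eqxx in sk; apply: sk.
have [t tl tr] := lp (ctr s y) 0 (add0n _).
exists ((4 * ctr s x + 4) + (1 + (t + (2 * ctr s y).+1))).
  have : ctr s y * (8 * B + 12 + tm B c) <= B * (8 * B + 12 + tm B c) by rewrite leq_mul2r ley orbT.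
  nia.
apply: runs_then (zero_runs s0 _) _; first by rewrite x0.
have -> : set_ctr s x 0 = S 0 by [].
apply: (runs_then (h1 := 0) (T1 := tape_of (S 0))).
  by have := @seek_store (S 0) x 0 xN; rewrite Sx; apply.
apply: runs_then tr _; exact: home_store.
Qed.

Lemma tm_poly c : exists a d, forall B, tm B c <= a * B.+1 ^ d.
Proof.
have prim : exists a d, forall B, 10 * B.+1 <= a * B.+1 ^ d by exists 10, 1 => B; rewrite expn1.
have up a d d' B t : t <= a * B.+1 ^ d -> d <= d' -> t <= a * B.+1 ^ d'.
  by move=> ta dd; apply: leq_trans ta _; rewrite leq_mul2l leq_pexp2l ?orbT.
elim: c => [|x|x|x|a x b|x z c [a [d h]] c' [a' [d' h']]|c [a [d h]] c' [a' [d' h']]|x y c [a [d h]]] //=.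
- exists (10 + (a + a')), (1 + d + d') => B; rewrite !mulnDl.
  apply: leq_add; first by apply: (up 10 1); rewrite ?expn1 //; lia.
  by apply: leq_add; [apply: up (h B) _ | apply: up (h' B) _]; lia.
- exists (a + a'), (d + d') => B; rewrite !mulnDl.
  by apply: leq_add; [apply: up (h B) _ | apply: up (h' B) _]; lia.
exists (20 + a), (2 + d) => B; rewrite mulnDr mulnDl; apply: leq_add.
  by apply: (up 20 2); [rewrite mulnCA mulnn | lia].
by rewrite addSn expnS mulnCA leq_mul2l; apply/orP; right; apply: up (h B) _; lia.
Qed.

Fixpoint grows c := match c with
  | Grow _ => true
  | Skip | Zero _ | Inc _ | Put _ _ _ => false
  | If _ _ c d | Seq c d => grows c || grows d
  | For _ _ c => grows c
  end.

Definition capped s := forall x, x < NC -> ctr s x <= ctr s 1.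

Lemma exec_cap c s : wf c -> ~~ grows c -> ctr (exec c s) 1 = ctr s 1.
Proof.
move=> wc gc; apply: ctr_frame.
elim: c wc gc => [|x|x|x|a x b|x z c IHc d IHd|c IHc d IHd|x y c IH] //=;
  rewrite ?inE ?mem_cat ?negb_or.
- by case/andP; case: x => [|[]].
- by case/andP; case: x => [|[]].
- by move=> /and4P[_ _ wc wd] /andP[gc gd]; rewrite IHc ?IHd.
- by move=> /andP[wc wd] /andP[gc gd]; rewrite IHc ?IHd.
by move=> /and5P[/andP[x1 _] _ _ _ /andP[_ wc]] gc; rewrite IH // andbT; case: x x1 => [|[]].
Qed.

Lemma capped_set s x v : x != 1 -> v <= ctr s 1 -> capped s -> capped (set_ctr s x v).
Proof. by move=> x1 le cs y yN; rewrite !ctr_set [1 == x]eq_sym (negbTE x1); case: eqP => // _; apply: cs. Qed.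

Lemma capped_exec c s : wf c -> ~~ grows c -> capped s -> capped (exec c s).
Proof.
elim: c s => [|x|x|x|a x b|x z c IHc d IHd|c IHc d IHd|x y c IH] s //=; rewrite ?negb_or.
- by move=> /andP[x1 _] _; apply: capped_set; first by case: x x1 => [|[]].
- move=> /andP[x1 xN] _ cs; apply: capped_set => //; first by case: x x1 {xN} => [|[]].
  by have := cs x xN; case: eqP => //; lia.
- by move=> /and4P[_ _ wc wd] /andP[gc gd] cs; case: ifP => _; [apply: IHc | apply: IHd].
- by move=> /andP[wc wd] /andP[gc gd] cs; apply: IHd => //; apply: IHc.
move=> /and5P[/andP[x1 xN] yN nxy nxc /andP[nyc wc]] gc cs.
have x1' : x != 1 by case: x x1 {xN nxy nxc} => [|[]].
have lp v : v <= ctr s y -> capped (loop x c s v) /\ ctr (loop x c s v) 1 = ctr s 1.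
  elim: v => // v hv vy; have [cv ev] := hv (ltnW vy); rewrite loopS; split.
    by apply: IH => //; apply: capped_set => //; rewrite ev (leq_trans (ltnW vy)) ?cs.
  by rewrite exec_cap // ctr_set eq_sym (negbTE x1').
have [cl el] := lp _ (leqnn _).
by apply: capped_set => //; rewrite -/(loop x c s (ctr s y)) el cs.
Qed.

(** Without [Grow] the cap is constant, [Inc] stops at it, and a loop counter is bounded by another
    counter. *)
Lemma capped_good c s : wf c -> ~~ grows c -> capped s -> good (ctr s 1) c s.
Proof.
elim: c s => [|x|x|x|a x b|x z c IHc d IHd|c IHc d IHd|x y c IH] s //=; rewrite ?negb_or.
- by move=> /and4P[_ _ wc wd] /andP[gc gd] cs; split=> //; case: ifP => _; [apply: IHc | apply: IHd].
- move=> /andP[wc wd] /andP[gc gd] cs; split; first exact: IHc.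
  by rewrite -(exec_cap s wc gc); apply: IHd => //; apply: capped_exec.
move=> wx gc cs; split=> // v vy.
move: (wx) => /and5P[/andP[x1 xN] yN nxy nxc /andP[nyc wc]].
have x1' : x != 1 by case: x x1 {xN nxy nxc wx} => [|[]].
have cv : capped (set_ctr (loop x c s v) x v) /\ ctr (loop x c s v) 1 = ctr s 1.
  elim: v vy => [|v IHv] vy; first by split=> //; apply: capped_set.
  have [cv ev] := IHv (ltnW vy); have e1 : ctr (loop x c s v.+1) 1 = ctr s 1.
    by rewrite loopS exec_cap // ctr_set eq_sym (negbTE x1').
  split=> //; apply: capped_set => //; first by rewrite e1 (leq_trans (ltnW vy)) ?cs.
  by rewrite loopS; apply: capped_exec.
have -> : ctr s 1 = ctr (set_ctr (loop x c s v) x v) 1.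
  by rewrite ctr_set eq_sym (negbTE x1') cv.2.
by apply: IH => //; apply: cv.1.
Qed.

End Language.

(** * Installing the input and a polynomial cap *)

Section Bootstrap.
Variables (NC K : nat).
Hypotheses (NCK : NC <= K) (NC5 : 5 < NC).

Local Notation exec := (exec NC).
Local Notation loop := (loop NC).
Local Notation good := (good NC).
Local Notation wf := (wf NC K).

Definition bounded B s := forall y, y < NC -> ctr s y <= B.

(* s' arises from s by setting counter x to v and using the counters zs as scratch space. *)
Definition sets B (zs : seq nat) s x v s' := [/\ bounded B s', arr s' = arr s, ctr s' x = v &
  forall z, z != x -> z \notin zs -> ctr s' z = ctr s z].

Lemma bounded_set B s x v : bounded B s -> v <= B -> bounded B (set_ctr s x v).
Proof. by move=> b le y yN; rewrite ctr_set; case: eqP => // _; apply: b. Qed.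

Lemma sets_trans B' B zs ws s (x : nat) v s' w s'' : sets B' zs s x v s' -> sets B ws s' x w s'' ->
  {subset zs <= ws} -> sets B ws s x w s''.
Proof.
move=> [_ m1 _ c1] [b m2 c2 d2] sub; split; rewrite ?m2 // => z zx zw.
by rewrite d2 // c1 //; apply: contra zw; apply: sub.
Qed.

Lemma grow_for B (i y x : nat) s : uniq [:: i; y; x] -> i < NC -> x < NC -> bounded B s ->
  ctr s x + ctr s y <= B ->
  good B (For i y (Grow x)) s /\ sets B [:: i] s x (ctr s x + ctr s y) (exec (For i y (Grow x)) s).
Proof.
rewrite [uniq _]/= !inE negb_or andbT => /andP[/andP[iy ix] yx] iN xN bs le.
have lp v : v <= ctr s y -> sets B [:: i] s x (ctr s x + v) (loop i (Grow x) s v).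
  elim: v => [_|v IH vy]; first by split; rewrite ?addn0.
  have [b m c d] := IH (ltnW vy); rewrite loopS /= [x == i]eq_sym (negbTE ix) c.
  have ? : v <= B by lia.
  split=> //; first by apply: bounded_set; [apply: bounded_set | lia].
    by rewrite ctr_set eqxx addnS.
  by move=> z zx; rewrite inE => zi; rewrite !ctr_set (negbTE zx) (negbTE zi) d // inE.
split.
  split=> // v vy; have [b m c d] := lp _ (ltnW vy).
  by apply: bounded_set => //; lia.
have [b m c d] := lp _ (leqnn _); rewrite exec_for; split=> //.
- by apply: bounded_set => //; lia.
- by rewrite ctr_set [x == i]eq_sym (negbTE ix).
by move=> z zx; rewrite inE => zi; rewrite ctr_set (negbTE zi) d // inE.
Qed.

(** Multiplies counter 1 by m + 1, for m in counter 2: a copy of it, kept in counter 3, is added m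
    times. *)
Definition cap_mul := Seq (Zero 3) (Seq (For 4 1 (Grow 3)) (For 4 2 (For 5 3 (Grow 1)))).

Lemma good_mono B B' c s : B <= B' -> good B c s -> good B' c s.
Proof.
move=> BB; have bd t : bounded B t -> bounded B' t by move=> b y yN; apply: leq_trans (b y yN) BB.
elim: c s => [|x|x|x|a x b|x z c IHc d IHd|c IHc d IHd|x y c IH] s //=; try exact: bd.
- by case=> /bd b h; split=> //; move: h; case: ifP => _; [apply: IHc | apply: IHd].
- by case=> /IHc hc /IHd hd.
by case=> /bd b h; split=> // v /h; apply: IH.
Qed.

Lemma cap_mul_correct s (c := ctr s 1) (m := ctr s 2) (B := c * m.+1) : bounded c s ->
  good B cap_mul s /\ sets B [:: 3; 4; 5] s 1 B (exec cap_mul s).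
Proof.
move=> bs; have [N1 N2 N3 N4] : [/\ 1 < NC, 2 < NC, 3 < NC & 4 < NC] by split; lia.
have bB : bounded B s by move=> y yN; apply: leq_trans (bs y yN) _; rewrite leq_pmulr.
have mB : m <= B by apply: bB.
pose s1 := set_ctr s 3 0.
have b1 : bounded B s1 by apply: bounded_set.
have cB : c <= B by rewrite leq_pmulr.
have [g2 st2] := @grow_for B 4 1 3 s1 isT N4 N3 b1 cB.
set s2 := exec _ s1 in st2.
have [b2 m2 c2 d2] := st2.
have c2' : ctr s2 3 = c by rewrite c2.
have lp v : v <= m -> sets B [:: 3; 4; 5] s 1 (c + v * c) (loop 4 (For 5 3 (Grow 1)) s2 v) /\
    ctr (loop 4 (For 5 3 (Grow 1)) s2 v) 3 = c.
  elim: v => [_|v IH vm].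
    split; last exact: c2'; split=> //.
    - by rewrite addn0 d2.
    - by move=> z z1; rewrite !inE !negb_or => /and3P[z3 z4 z5]; rewrite d2 ?inE // ctr_set (negbTE z3).
  have [[b mm cc d] t] := IH (ltnW vm); rewrite loopS.
  have vB : c + v.+1 * c <= B by rewrite /B mulnS leq_add2l [c * m]mulnC leq_mul2r vm orbT.
  set s3 := set_ctr (loop 4 _ s2 v) 4 v.
  have b3 : bounded B s3 by apply: bounded_set => //; lia.
  have le3 : ctr s3 1 + ctr s3 3 <= B by rewrite /s3 !ctr_set /= cc t -addnA addnC; lia.
  have [_ [b4 m4 c4 d4]] := @grow_for B 5 3 1 s3 isT NC5 N1 b3 le3.
  split; last by rewrite d4 ?inE //.
  split=> //; first by rewrite m4.
  - by rewrite c4 /s3 !ctr_set /= cc t mulSn; lia.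
  - move=> z z1 zz; move: (zz); rewrite !inE !negb_or => /and3P[z3 z4 z5].
    by rewrite d4 ?inE // ctr_set (negbTE z4) d.
have m2' : ctr s2 2 = m by rewrite d2 ?inE.
split.
  split; first exact: bB.
  split; first exact: g2.
  split=> // v; rewrite -/s1 -/s2 m2' => vm.
  have [[b mm cc d] t] := lp _ (ltnW vm).
  apply: (grow_for _ _ _ _ _).1 => //; first by apply: bounded_set => //; lia.
  rewrite !ctr_set /= cc t.
  have -> : c + v * c + c = c + v.+1 * c by lia.
  by rewrite /B mulnS leq_add2l [c * m]mulnC leq_mul2r vm orbT.
have [[b mm cc d] t] := lp _ (leqnn m).
have -> : exec cap_mul s = set_ctr (loop 4 (For 5 3 (Grow 1)) s2 (ctr s2 2)) 4 (ctr s2 2) by [].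
rewrite m2'.
split=> //; first by apply: bounded_set.
- by rewrite ctr_set /= cc /B mulnS [c * m]mulnC.
by move=> z z1 zz; rewrite ctr_set d //; move: zz; rewrite !inE !negb_or => /and3P[_ /negbTE ->].
Qed.

Definition cap_init := Seq (For 4 2 (Grow 1)) (Grow 1).
(** Started with counter 1 at zero, this raises it to (m + 1)^(e + 1), where m is the input length
    in counter 2. *)
Definition cap_cmd e := iter e (fun c => Seq c cap_mul) cap_init.

Lemma cap_cmd_correct e s (m := ctr s 2) (B := m.+1 ^ e.+1) : ctr s 1 = 0 -> bounded m s ->
  good B (cap_cmd e) s /\ sets B [:: 3; 4; 5] s 1 B (exec (cap_cmd e) s).
Proof.
move=> s1 bs; have [N1 N4] : 1 < NC /\ 4 < NC by split; lia.
have gen e' : let B' := m.+1 ^ e'.+1 in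
    good B' (cap_cmd e') s /\ sets B' [:: 3; 4; 5] s 1 B' (exec (cap_cmd e') s).
  elim: e' => [|e' IH] B'.
    rewrite /B' expn1; have b1 : bounded m.+1 s by move=> y /bs; lia.
    have le : ctr s 1 + ctr s 2 <= m by rewrite s1.
    have [g [b mm cc d]] := @grow_for m 4 2 1 s isT N4 N1 bs le.
    have b' : bounded m.+1 (exec (For 4 2 (Grow 1)) s) by move=> y /b; lia.
    split; first by split; [apply: good_mono g |].
    rewrite [exec _ _]/(set_ctr (exec (For 4 2 (Grow 1)) s) 1 _); rewrite cc s1 add0n.
    split=> //; first exact: bounded_set.
    by move=> z z1 zz; rewrite ctr_set (negbTE z1) d //; move: zz; rewrite !inE !negb_or => /and3P[].
  have [g st] := IH; have [b mm cc d] := st.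
  have m2 : ctr (exec (cap_cmd e') s) 2 = m by rewrite d.
  have b2 : bounded (ctr (exec (cap_cmd e') s) 1) (exec (cap_cmd e') s) by rewrite cc.
  have [g2 st2] := cap_mul_correct b2; rewrite cc m2 -expnSr in g2 st2.
  split; last by apply: sets_trans st st2 _.
  by split=> //; apply: good_mono g; rewrite leq_pexp2l.
exact: gen.
Qed.

Lemma start_capped e s : ctr s 1 = 0 -> bounded (ctr s 2) s -> capped NC (exec (cap_cmd e) s).
Proof. by move=> s1 bs; have [_ [b _ c _]] := cap_cmd_correct e s1 bs; rewrite /capped c. Qed.

Hypothesis NCK2 : NC.+2 <= K.

Definition in_track x := match x with S0 => NC | S1 => NC.+1 | Sep => NC.+2 end.
Definition in_cell x : cell K := [ffun o : 'I_K.+1 => o == in_track x :> nat].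
Definition input_store w := Store (fun x => if x == 2 then size w else 0)
  (fun z i => (i < size w) && (z == in_track (nth Sep w i))).

Definition is_input (a : cell K) := [|| cbit a NC, cbit a NC.+1 | cbit a NC.+2].
(** All counters but counter 2 get their mark on the home cell. [boot] puts that of counter 2 on the
    first cell after the input, so it holds the input length. *)
Definition init_cell (a : cell K) : cell K :=
  [ffun o : 'I_K.+1 => if o < NC then o != 2 :> nat else a o].
Definition boot : tprog (cell K) := Then (Act init_cell Stay)
    (Then (Loop is_input (Act id MoveR)) (Then (mark K 2 true) (home K))).

Lemma boot_runs w : runs boot 0 (nth [ffun=> false] (map in_cell w)) (4 * size w + 4) 0
  (tape_of NC K (input_store w)).
Proof.
set T0 := nth _ _; have N2 : 2 < NC by lia.
have cT0 i z : z <= K -> cbit (T0 i) z = (i < size w) && (z == in_track (nth Sep w i)).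
  move=> zK; rewrite /T0; case: ltnP => iw /=.
    by rewrite (nth_map Sep) // /cbit ffunE inordK.
  by rewrite nth_default ?size_map // /cbit ffunE.
pose T1 := wr T0 0 (init_cell (T0 0)).
have cT1 i z : z <= K -> cbit (T1 i) z =
    if z < NC then (i == 0) && (z != 2) else (i < size w) && (z == in_track (nth Sep w i)).
  move=> zK; rewrite /T1 /wr; case: eqP => [->|ne] /=.
    by rewrite /cbit ffunE inordK //; case: ifP => // zN; rewrite -cT0.
  rewrite cT0 //; case: ifP => // zN; case: ltnP => //= iw; apply/eqP => E; move: zN.
  by rewrite E; case: (nth _ _ _) => /=; lia.
have in1 i : is_input (T1 i) = (i < size w).
  rewrite /is_input !cT1; try lia.
  have -> : NC < NC = false by lia.
  have -> : NC.+1 < NC = false by lia.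
  have -> : NC.+2 < NC = false by lia.
  by case: ltnP => //= iw; case: (nth _ _ _) => /=; rewrite eqxx ?orbT.
have -> : 4 * size w + 4 = 1 + ((2 * (size w - 0)).+1 + (1 + (2 * size w).+1)) by lia.
apply: (runs_then (@runs_act _ init_cell Stay 0 T0 _)); first by [].
apply: (runs_then (h1 := size w) (T1 := T1)).
  by apply: scan_runs => //= [i|]; rewrite in1 // ltnn.
apply: runs_then (mark_runs _ _ _ _) _.
have -> : wr T1 (size w) (cset (T1 (size w)) 2 true) = tape_of NC K (input_store w).
  apply: tape_ext => i z zK; rewrite cbit_wr // cT1 // cbit_tape // /track /=.
  case: (ltnP z NC) => [zN|zN]; last by rewrite (gtn_eqF (leq_trans N2 zN)) andbF.
  by have [_|_] := eqVneq z 2; rewrite ?andbT ?andbF eq_sym; case: eqP.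
by apply: home_store => //; lia.
Qed.

(** [cap_cmd] stays below the cap it builds and [c] cannot pass it, so the time is polynomial in the
    cap, which is a fixed power of the input length plus one. *)
Theorem cmd_machine c f e : wf c -> ~~ grows c -> f <= K ->
  exists (Q Gam : finType) (M : TM Q Gam) a d, forall w,
    exists t, t <= a * (size w).+1 ^ d /\ halted M (run M t w) /\
      (st (run M t w) = qacc M <->
       track NC (exec c (exec (cap_cmd e) (input_store w))) f 0).
Proof.
move=> wc gc fK; pose p := Then boot (low K (Seq (cap_cmd e) c)).
have [N1 N2 N3 N4] : [/\ 1 < NC, 2 < NC, 3 < NC & 4 < NC] by split; lia.
have wcap : wf (cap_cmd e).
  by elim: (e) => [|e' IH] /=; rewrite ?IH N1 ?N2 ?N3 ?N4 ?NC5.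
have [a1 [d1 h1]] := tm_poly NCK N1 (cap_cmd e); have [a2 [d2 h2]] := tm_poly NCK N1 c.
exists _, _, (machine [ffun=> false] in_cell p (fun a => cbit a f)).
exists (5 + a1 * 2 ^ d1 + a2 * 2 ^ d2), (1 + e.+1 * d1 + e.+1 * d2) => w.
pose s := input_store w; pose s' := exec (cap_cmd e) s; pose B := (size w).+1 ^ e.+1.
have b0 : bounded (ctr s 2) s by move=> y _ /=; case: eqP.
have [g0 st0] := cap_cmd_correct e (erefl : ctr s 1 = 0) b0.
have [b1 m1 c1 d1'] := st0.
have z1 : ctr s' 0 = 0 by rewrite d1'.
have [t tl tr] := low_runs NCK N1 wcap g0 (erefl : ctr s 0 = 0).
have [t' tl' tr'] := low_runs NCK N1 wc (capped_good NCK N1 wc gc (start_capped e (erefl : ctr s 1 = 0) b0)) z1.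
rewrite c1 in tl'.
have rr := runs_then (boot_runs w) (runs_then tr tr').
have [hh ha] := machine_correct (fun a => cbit a f) (sy := in_cell) rr (fun i => erefl).
exists (4 * size w + 4 + (t + t')).+1; split; last by split=> //; rewrite ha cbit_tape.
(* [B.+1] is at most twice [B], which accounts for the factor 2^d. *)
have part a d T : T <= a * B.+1 ^ d -> T <= a * 2 ^ d * (size w).+1 ^ (e.+1 * d).
  move=> h; apply: leq_trans h _; rewrite -mulnA leq_mul2l expnM -expnMn; apply/orP; right.
  have : 0 < B by rewrite expn_gt0.
  case: d => [|d] // B0; rewrite leq_exp2r //; rewrite -/B; lia.
have up T d d' : d <= d' -> T * (size w).+1 ^ d <= T * (size w).+1 ^ d'.
  by move=> dd; rewrite leq_mul2l leq_pexp2l ?orbT.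
have lt1 := leq_trans (part _ _ _ (leq_trans tl (h1 B))) (up _ _ (1 + e.+1 * d1 + e.+1 * d2) _).
have lt2 := leq_trans (part _ _ _ (leq_trans tl' (h2 B))) (up _ _ (1 + e.+1 * d1 + e.+1 * d2) _).
have lt3 := up 5 1 (1 + e.+1 * d1 + e.+1 * d2) _.
have -> : (4 * size w + 4 + (t + t')).+1 = 5 * (size w).+1 ^ 1 - size w + (t + t') by rewrite expn1; lia.
rewrite !mulnDl -addnA leq_add //; last by rewrite leq_add ?lt1 ?lt2 //; lia.
by apply: leq_trans (leq_subr _ _) (lt3 _); lia.
Qed.

End Bootstrap.

(** * Frame rules, arithmetic on counters and addresses of tuples *)

Fixpoint puts c : seq nat := match c with
  | Skip | Zero _ | Inc _ | Grow _ => [::]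
  | Put a _ _ => [:: a]
  | If _ _ c d | Seq c d => puts c ++ puts d
  | For _ _ c => puts c
  end.

Definition seqs cs := foldr Seq Skip cs.

Section Frames.
Variable NC : nat.
Local Notation exec := (exec NC).
Local Notation loop := (loop NC).

Lemma exec_seq c d s : exec (Seq c d) s = exec d (exec c s). Proof. by []. Qed.

Lemma arr_frame c s (a : nat) : a \notin puts c -> arr (exec c s) a = arr s a.
Proof.
elim: c s => [|y|y|y|a' y b|y z c IHc d IHd|c IHc d IHd|y z c IH] s //=;
  rewrite ?inE ?mem_cat ?negb_or.
- by move=> /negbTE aa; apply: funext => i; rewrite aa.
- by case/andP => /IHc hc /IHd hd; case: ifP.
- by case/andP => /IHc hc /IHd hd; rewrite hd hc.
move=> /IH h; rewrite -/(loop y c s (ctr s z)).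
by elim: (ctr s z) => // v hv; rewrite loopS h.
Qed.

(** For series of checks: position 0 of array [a] accumulates the conjunction of their outcomes. *)
Lemma exec_seqs (T : eqType) (P : store -> Prop) (f : T -> cmd) (b : T -> bool) a (js : seq T) s :
  {in js, forall i s, P s -> P (exec (f i) s) /\ arr (exec (f i) s) a 0 = arr s a 0 && b i} -> P s ->
  P (exec (seqs (map f js)) s) /\ arr (exec (seqs (map f js)) s) a 0 = arr s a 0 && all b js.
Proof.
elim: js s => [|i js IH] s h Ps /=; first by rewrite andbT.
have [P1 e1] := h i (mem_head _ _) s Ps.
have [|P2 ->] := IH (exec (f i) s) _ P1; last by rewrite e1 andbA.
by move=> j jj; apply: h; rewrite inE jj orbT.
Qed.

Section Arithmetic.
Variables (cap n : nat).

Definition add x y := For 5 y (Inc x).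
Definition set_to x y := Seq (Zero x) (add x y).
Definition mul_to x y z := Seq (Zero x) (For 4 y (add x z)).

Lemma add_correct x y s : 5 != x -> 5 != y -> x != y -> 1 != x ->
  ctr s x + ctr s y <= ctr s 1 -> ctr (exec (add x y) s) x = ctr s x + ctr s y.
Proof.
move=> x5 y5 xy x1 le; rewrite exec_for ctr_set eq_sym (negbTE x5).
suff h v : v <= ctr s y -> ctr (loop 5 (Inc x) s v) x = ctr s x + v /\
    ctr (loop 5 (Inc x) s v) 1 = ctr s 1 by apply: (h _ (leqnn _)).1.
elim: v => [_|v IH vy]; first by rewrite addn0.
have [e1 e2] := IH (ltnW vy); rewrite loopS /= eqxx [x == 5]eq_sym (negbTE x5) (negbTE x1) e1 e2.
by split=> //; case: eqP; lia.
Qed.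

Lemma set_to_correct x y s : 5 != x -> 5 != y -> x != y -> 1 != x ->
  ctr s y <= ctr s 1 -> ctr (exec (set_to x y) s) x = ctr s y.
Proof.
move=> x5 y5 xy x1 le; rewrite exec_seq add_correct //;
  by rewrite !ctr_set eqxx [y == x]eq_sym (negbTE xy) // (negbTE x1).
Qed.

Lemma for_add_correct x y z s : x \notin [:: 1; 4; 5; y; z] -> y \notin [:: 4; 5] ->
  z \notin [:: 4; 5] -> ctr s x + ctr s y * ctr s z <= ctr s 1 ->
  ctr (exec (For 4 y (add x z)) s) x = ctr s x + ctr s y * ctr s z.
Proof.
rewrite !inE !negb_or => /and5P[x1 x4 x5 xy xz] /andP[y4 y5] /andP[z4 z5] le.
rewrite exec_for ctr_set (negbTE x4).
suff h v : v <= ctr s y -> ctr (loop 4 (add x z) s v) x = ctr s x + v * ctr s z.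
  exact: h (leqnn _).
elim: v => [_|v IH vy]; first by rewrite mul0n addn0.
have fr u w : u \notin [:: 4; 5; x] -> ctr (loop 4 (add x z) s w) u = ctr s u.
  rewrite !inE !negb_or => /and3P[u4 u5 ux]; elim: w => // w IHw.
  by rewrite loopS ctr_frame ?ctr_set ?(negbTE u4) //= !inE negb_or u5 ux.
have z' : z \notin [:: 4; 5; x] by rewrite !inE !negb_or z4 z5 eq_sym xz.
have o' : 1 \notin [:: 4; 5; x] by rewrite !inE [1 == x]eq_sym (negbTE x1).
rewrite loopS; set s' := set_ctr _ 4 v.
have ex : ctr s' x = ctr s x + v * ctr s z by rewrite ctr_set (negbTE x4) IH // ltnW.
have ez : ctr s' z = ctr s z by rewrite ctr_set (negbTE z4) fr.
have e1 : ctr s' 1 = ctr s 1 by rewrite ctr_set fr.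
rewrite add_correct // 1?eq_sym // ?ex ?ez ?e1 ?mulSn; last first.
  by apply: leq_trans le; rewrite -addnA leq_add2l addnC -mulSn leq_mul2r vy orbT.
by lia.
Qed.

(** The number with base-n digits [ds], most significant first: the array address of a tuple. *)
Definition horner (ds : seq nat) := foldl (fun p d => p * n + d) 0 ds.

Lemma horner_rcons ds d : horner (rcons ds d) = horner ds * n + d.
Proof. by rewrite /horner -cats1 foldl_cat. Qed.

Lemma horner_lt ds : all (gtn n) ds -> horner ds < n ^ size ds.
Proof.
elim/last_ind: ds => // ds d IH; rewrite all_rcons size_rcons horner_rcons expnSr.
move=> /andP[/= dn /IH lt]; apply: (@leq_trans ((horner ds).+1 * n)); last by rewrite leq_mul2r lt orbT.
by rewrite mulSn addnC ltn_add2r.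
Qed.

Fixpoint digits l a := if l is l'.+1 then rcons (digits l' (a %/ n)) (a %% n) else [::].

Lemma size_digits l a : size (digits l a) = l.
Proof. by elim: l a => //= l IH a; rewrite size_rcons IH. Qed.

Lemma digits_lt l a : 0 < n -> all (gtn n) (digits l a).
Proof. by move=> n0; elim: l a => //= l IH a; rewrite all_rcons IH /= ltn_mod n0. Qed.

Lemma digitsK ds : all (gtn n) ds -> digits (size ds) (horner ds) = ds.
Proof.
elim/last_ind: ds => // ds d IH; rewrite all_rcons size_rcons horner_rcons /= => /andP[dn /IH E].
have n0 : 0 < n by apply: leq_ltn_trans dn.
by rewrite divnMDl // divn_small // addn0 E modnMDl modn_small.
Qed.

Lemma hornerK l a : a < n ^ l -> horner (digits l a) = a.
Proof.
elim: l a => [|l IH] a /=; first by case: a.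
move=> lt; have n0 : 0 < n by case: (n) lt => //; rewrite exp0n.
by rewrite horner_rcons IH -?divn_eq // ltn_divLR // -expnSr.
Qed.

(** One Horner step on counter 6, with the base in counter 3 and counter 7 as accumulator. *)
Definition mac d := Seq (Zero 7) (Seq (For 4 6 (add 7 3)) (Seq (add 7 d) (set_to 6 7))).
Definition addr ds := foldl (fun c d => Seq c (mac d)) (Zero 6) ds.

Lemma addr_rcons ds d : addr (rcons ds d) = Seq (addr ds) (mac d).
Proof. by rewrite /addr -cats1 foldl_cat. Qed.

Lemma addr_asg ds x : x \in asg (addr ds) -> x \in [:: 4; 5; 6; 7].
Proof.
elim/last_ind: ds => [|ds d IH]; first by rewrite !inE => ->; rewrite !orbT.
by rewrite addr_rcons /= mem_cat !inE => /orP[/IH|]; rewrite ?inE //; do !case: eqP => //.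
Qed.

Lemma addr_puts ds : puts (addr ds) = [::].
Proof. by elim/last_ind: ds => // ds d IH; rewrite addr_rcons /= IH. Qed.

(** All intermediate values are below n ^ size ds, so the bound by the cap keeps [Inc] from
    saturating. *)
Lemma addr_correct ds s : {in ds, forall d, d \notin [:: 4; 5; 6; 7]} -> all (gtn n) (map (ctr s) ds) ->
  ctr s 3 = n -> n ^ size ds <= ctr s 1 ->
  ctr (exec (addr ds) s) 6 = horner (map (ctr s) ds).
Proof.
elim/last_ind: ds s => // ds d IH s nd; rewrite map_rcons all_rcons => /andP[/= dn al] s3 le.
have fr u c' : u \notin [:: 4; 5; 6; 7] -> ctr (exec (addr c') s) u = ctr s u.
  by move=> nu; rewrite ctr_frame //; apply: contra nu; apply: addr_asg.
have lt : horner (map (ctr s) (rcons ds d)) < ctr s 1.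
  apply: leq_trans le; rewrite -(size_map (ctr s)); apply: horner_lt.
  by rewrite map_rcons all_rcons /= dn.
have le' : n ^ size ds <= ctr s 1.
  by apply: leq_trans le; rewrite size_rcons leq_pexp2l // (leq_ltn_trans _ dn).
have nd' : d \notin [:: 4; 5; 6; 7] by apply: nd; rewrite mem_rcons mem_head.
rewrite map_rcons horner_rcons in lt *.
rewrite addr_rcons exec_seq.
have {}IH : ctr (exec (addr ds) s) 6 = horner (map (ctr s) ds).
  by apply: IH => // x xd; apply: nd; rewrite mem_rcons inE xd orbT.
have [s1 [s3' sd]] : ctr (exec (addr ds) s) 1 = ctr s 1 /\ ctr (exec (addr ds) s) 3 = n /\
  ctr (exec (addr ds) s) d = ctr s d by rewrite !fr.
move: (exec (addr ds) s) IH s1 s3' sd => {}s' E s1' s3' sd.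
move: nd'; rewrite !inE !negb_or => /and4P[d4 d5 d6 d7].
rewrite /mac 3!exec_seq; set s2 := exec (For _ _ _) _.
have f2 u : u \notin [:: 4; 5; 7] -> ctr s2 u = ctr s' u.
  move=> nu; rewrite ctr_frame ?ctr_set; last by move: nu; rewrite /= !inE.
  by case: eqP nu => // ->.
have E2 : ctr s2 7 = horner (map (ctr s) ds) * n.
  by rewrite for_add_correct // !ctr_set /= s3' E ?s1' add0n // ltnW // (leq_ltn_trans _ lt) ?leq_addr.
have E2d : ctr s2 d = ctr s d by rewrite f2 // !inE !negb_or d4 d5 d7.
have E3 : ctr (exec (add 7 d) s2) 7 = horner (map (ctr s) ds) * n + ctr s d.
  by rewrite add_correct // 1?eq_sym // ?E2 ?E2d // f2 // s1' ltnW.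
by rewrite set_to_correct // E3 // ctr_frame // f2 // s1' ltnW.
Qed.

End Arithmetic.
End Frames.

(** * Greedy matching along a difunctional relation *)

Section Greedy.
Variables (n : nat) (M : nat -> nat -> bool).

Definition free_partners (us : seq nat) v := [seq w <- iota 0 n | (w \notin us) && M v w].

Definition greedy_step (st : seq nat * bool) v :=
  if free_partners st.1 v is w :: _ then (w :: st.1, st.2) else (st.1, false).

Definition greedy := (foldl greedy_step ([::], true) (iota 0 n)).2.

Definition matching f := [/\ forall v, v < n -> f v < n, forall v, v < n -> M v (f v) &
  {in gtn n &, injective f}].

Definition difunctional := forall v w v' w', v < n -> w < n -> v' < n -> w' < n ->
  M v w -> M v' w -> M v' w' -> M v w'.

Let greedy_upto v := foldl greedy_step ([::], true) (iota 0 v).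

Let greedy_uptoS v : greedy_upto v.+1 = greedy_step (greedy_upto v) v.
Proof. by rewrite /greedy_upto -addn1 iotaD foldl_cat. Qed.

Let partial v (us : seq nat) := [/\ uniq us, size us = v, all (gtn n) us &
  forall i, i < v -> M i (nth 0 (rev us) i)].

Let partialS v us w : partial v us -> w \in free_partners us v -> partial v.+1 (w :: us).
Proof.
case=> u sz al hM; rewrite mem_filter mem_iota => /andP[/andP[nw Mw] /andP[_ wn]].
split=> /=; rewrite ?nw ?sz ?al ?andbT //.
move=> i; rewrite ltnS leq_eqVlt rev_cons nth_rcons size_rev sz => /orP[/eqP ->|lt].
  by rewrite ltnn eqxx.
by rewrite lt hM.
Qed.

Let partial_matching us : partial n us -> matching (nth 0 (rev us)).
Proof.
case=> u sz al hM; split=> // [v vn|v w vn wn E].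
  by apply: (allP al); rewrite -mem_rev mem_nth // size_rev sz.
by apply/eqP; rewrite -(nth_uniq 0 (s := rev us)) ?size_rev ?sz ?rev_uniq // E.
Qed.

Lemma greedy_sound : greedy -> exists f, matching f.
Proof.
suff h v : v <= n -> (greedy_upto v).2 -> partial v (greedy_upto v).1.
  by move=> g; exists (nth 0 (rev (greedy_upto n).1)); apply: partial_matching; apply: h.
elim: v => [|v IH] vn; first by [].
rewrite greedy_uptoS /greedy_step; case E : free_partners => [//|w ws] /= ok.
by apply: partialS (IH (ltnW vn) ok) _; rewrite E mem_head.
Qed.

(* If v found no free partner, its partners all went to vertices of the same class as v, but f
   matches that class and v itself into these partners. *)
Lemma greedy_complete f : difunctional -> matching f -> greedy.
Proof.
move=> dM [fn fM fI].
suff h v : v <= n -> (greedy_upto v).2 /\ partial v (greedy_upto v).1 by apply: (h n (leqnn n)).1.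
elim: v => [|v IH] vn; first by [].
have [ok pa] := IH (ltnW vn); rewrite greedy_uptoS /greedy_step.
case E : free_partners => [|w ws] /=; last first.
  by split=> //; apply: partialS pa _; rewrite E mem_head.
set us := (greedy_upto v).1 in pa E *; have [u sz al hM] := pa.
pose W := [seq w <- iota 0 n | M v w]; pose C := [seq x <- iota 0 v | M x (f v)].
have sW w : w \in W -> w \in us /\ w < n.
  rewrite mem_filter mem_iota => /andP[Mw /andP[_ wn]]; split=> //; apply/negPn/negP => nw.
  have : w \in free_partners us v by rewrite mem_filter mem_iota nw Mw wn.
  by rewrite E.
have le1 : size W <= size C.
  rewrite -(size_map (index^~ (rev us))); apply: uniq_leq_size.
    rewrite map_inj_in_uniq ?filter_uniq ?iota_uniq // => x y /sW[xu _] /sW[yu _] /= e.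
    have /= <- := @nth_index _ 0 x (rev us); rewrite ?mem_rev // e nth_index ?mem_rev //.
  move=> _ /mapP[w wW ->]; have [wu wn] := sW w wW.
  have iv : index w (rev us) < v by rewrite -sz -size_rev index_mem mem_rev.
  rewrite mem_filter mem_iota /= iv andbT.
  apply: (dM _ w v) => //; rewrite ?fn ?fM ?(ltn_trans iv) //.
    by have := hM _ iv; rewrite nth_index ?mem_rev.
  by move: wW; rewrite mem_filter => /andP[].
suff : size (v :: C) <= size W by rewrite /= ltnNge le1.
rewrite -(size_map f); apply: uniq_leq_size.
  rewrite map_inj_in_uniq.
    by rewrite /= filter_uniq ?iota_uniq // andbT /C mem_filter mem_iota ltnn !andbF.
  have lt x : x \in v :: C -> x < n.
    by rewrite inE mem_filter mem_iota => /orP[/eqP ->//|/and3P[_ _]]; lia.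
  by move=> x y /lt xn /lt yn; apply: fI.
move=> _ /mapP[x xC ->]; rewrite mem_filter mem_iota /=.
move: xC; rewrite inE mem_filter mem_iota => /orP[/eqP ->|/and3P[Mx _ xv]]; first by rewrite fM ?fn.
have xn : x < n by lia.
by rewrite fn // andbT; apply: (dM _ (f v) x); rewrite ?fn ?fM.
Qed.

End Greedy.

Lemma greedy_ext n M M' : (forall v w, v < n -> w < n -> M v w = M' v w) -> greedy n M = greedy n M'.
Proof.
move=> h; rewrite /greedy; move: ([::], true).
have : all (gtn n) (iota 0 n) by apply/allP => v; rewrite mem_iota.
elim: (iota 0 n) => //= v s IH /andP[vn sn] st.
have -> : greedy_step n M st v = greedy_step n M' st v; last exact: IH.
rewrite /greedy_step; suff -> : free_partners n M st.1 v = free_partners n M' st.1 v by [].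
by apply/eq_in_filter => w; rewrite mem_iota => /andP[_ wn]; rewrite h.
Qed.

(** * Weisfeiler-Leman refinement as a relation between tuples of two graphs *)

Section WL.
Variables (k n : nat) (eG eH : rel nat).

Definition valid (r : seq nat) := (size r == k) && all (gtn n) r.

Definition atomic r s := all (fun i => all (fun j =>
  ((nth 0 r i == nth 0 r j) == (nth 0 s i == nth 0 s j)) &&
  (eG (nth 0 r i) (nth 0 r j) == eH (nth 0 s i) (nth 0 s j))) (iota 0 k)) (iota 0 k).

Definition matches (E : seq nat -> seq nat -> bool) r s i :=
  greedy n (fun v w => E (set_nth 0 r i v) (set_nth 0 s i w)).

Definition wl_step (E : seq nat -> seq nat -> bool) r s := E r s && all (matches E r s) (iota 0 k).

(** Colours stay unnamed: related tuples are those of equal colour after [t] rounds. Comparing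
    multisets of colours becomes matching the replacements of one coordinate, which [greedy] can do
    since the relation is difunctional. *)
Definition wl t := iter t wl_step atomic.

Lemma atomicP r s : reflect (forall i j, i < k -> j < k ->
   (nth 0 r i == nth 0 r j) = (nth 0 s i == nth 0 s j) /\
   eG (nth 0 r i) (nth 0 r j) = eH (nth 0 s i) (nth 0 s j)) (atomic r s).
Proof.
apply: (iffP allP) => [h i j ik jk|h i].
  have ii : i \in iota 0 k by rewrite mem_iota.
  by have /allP/(_ j) := h i ii; rewrite mem_iota jk => /(_ isT)/andP[/eqP -> /eqP ->].
move=> ii; have ik : i < k by move: ii; rewrite mem_iota.
apply/allP => j jj; have jk : j < k by move: jj; rewrite mem_iota.
by have [-> ->] := h i j ik jk; rewrite !eqxx.
Qed.

Lemma valid_nth r i : valid r -> i < k -> nth 0 r i < n.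
Proof. by move=> /andP[/eqP sz /allP al] ik; apply: al; rewrite mem_nth // sz. Qed.

Lemma valid_set r i v : valid r -> i < k -> v < n -> valid (set_nth 0 r i v).
Proof.
move=> vr ik vn; have /andP[/eqP sz _] := vr; apply/andP; split.
  by rewrite size_set_nth sz; apply/eqP/maxn_idPr.
apply/allP => x /(nthP 0)[j]; rewrite size_set_nth sz (maxn_idPr ik) => jk <-.
by rewrite nth_set_nth /=; case: eqP => // _; apply: valid_nth.
Qed.

Definition difun (E : seq nat -> seq nat -> bool) := forall r s r' s', valid r -> valid s -> valid r' ->
  valid s' -> E r s -> E r' s -> E r' s' -> E r s'.

Lemma difun_matches E r s i : difun E -> valid r -> valid s -> i < k ->
  difunctional n (fun v w => E (set_nth 0 r i v) (set_nth 0 s i w)).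
Proof.
move=> dE vr vs ik v w v' w' vn wn v'n w'n; apply: dE; exact: valid_set.
Qed.

Lemma matching_surj M f w : matching n M f -> w < n -> exists2 v, v < n & f v = w.
Proof.
case=> fn _ fI wn; have : w \in map f (iota 0 n).
  have u : uniq (map f (iota 0 n)).
    by rewrite map_inj_in_uniq ?iota_uniq // => x y; rewrite !mem_iota; apply: fI.
  have sub : {subset map f (iota 0 n) <= iota 0 n}.
    by move=> _ /mapP[v vn ->]; move: vn; rewrite !mem_iota => /andP[_ /fn].
  have sz : size (iota 0 n) <= size (map f (iota 0 n)) by rewrite size_map.
  by rewrite (uniq_min_size u sub sz) mem_iota.
by case/mapP => v; rewrite mem_iota => /andP[_ vn] ->; exists v.
Qed.

Lemma wl_valid_ext E E' r s : valid r -> valid s ->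
  (forall r s, valid r -> valid s -> E r s = E' r s) -> wl_step E r s = wl_step E' r s.
Proof.
move=> vr vs h; rewrite /wl_step h //; congr (_ && _); apply: eq_in_all => i.
rewrite mem_iota => /andP[_ ik]; apply: greedy_ext => v w vn wn.
by rewrite h //; apply: valid_set.
Qed.

(** Of the three matchings at a coordinate, the first, the inverse of the second and the third
    compose to the required one. *)
Lemma difun_wl t : difun (wl t).
Proof.
elim: t => [|t IH] r s r' s' vr vs vr' vs'.
  move=> /atomicP h1 /atomicP h2 /atomicP h3; apply/atomicP => i j ik jk.
  have [a1 b1] := h1 i j ik jk; have [a2 b2] := h2 i j ik jk; have [a3 b3] := h3 i j ik jk.
  by rewrite a1 -a2 a3 b1 -b2 b3.
move=> /andP[e1 /allP m1] /andP[e2 /allP m2] /andP[e3 /allP m3]; apply/andP; split.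
  exact: IH e1 e2 e3.
apply/allP => i ii; have ik : i < k by move: ii; rewrite mem_iota.
have [f1 F1] := greedy_sound (m1 i ii).
have [f2 F2] := greedy_sound (m2 i ii).
have [f3 F3] := greedy_sound (m3 i ii).
pose g w := head 0 [seq u <- iota 0 n | f2 u == w].
have gP w : w < n -> g w < n /\ f2 (g w) = w.
  move=> wn; have [u un fu] := matching_surj F2 wn.
  have : u \in [seq u <- iota 0 n | f2 u == w] by rewrite mem_filter fu eqxx mem_iota.
  rewrite /g; case E : [seq u <- iota 0 n | f2 u == w] => [//|x ys] _ /=.
  have : x \in [seq u <- iota 0 n | f2 u == w] by rewrite E mem_head.
  by rewrite mem_filter mem_iota => /andP[/eqP -> /andP[]].
have [n1 M1 I1] := F1; have [n2 M2 I2] := F2; have [n3 M3 I3] := F3.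
apply: (greedy_complete (f := fun v => f3 (g (f1 v)))); first exact: difun_matches.
split=> [v vn|v vn|v w vn wn].
- by apply: n3; apply: (gP _ (n1 _ vn)).1.
- have [gn gE] := gP _ (n1 _ vn).
  have m := M2 _ gn; rewrite gE in m.
  by apply: IH (M1 _ vn) m (M3 _ gn); apply: valid_set => //; [apply: n1 | apply: n3].
have [gn gE] := gP _ (n1 _ vn); have [gn' gE'] := gP _ (n1 _ wn).
by move/(I3 _ _ gn gn')/(congr1 f2); rewrite gE gE'; apply: I1.
Qed.

(* Reindexing a tuple by any self-map h of the positions, injective or not: position i of the new
   tuple is pebbled through a position l of the old one that h does not use elsewhere. *)
Lemma wl_reindex t r s h : valid r -> valid s -> size h = k -> all (gtn k) h -> wl t r s ->
  wl t [seq nth 0 r i | i <- h] [seq nth 0 s i | i <- h].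
Proof.
have vh r' h' : valid r' -> size h' = k -> all (gtn k) h' -> valid [seq nth 0 r' i | i <- h'].
  move=> vr sz /allP al; rewrite /valid size_map sz eqxx; apply/allP => _ /mapP[i /al ik ->].
  exact: valid_nth.
elim: t r s h => [|t IH] r s h vr vs sz al.
  move=> /atomicP a; apply/atomicP => i j ik jk; rewrite !(nth_map 0) ?sz //.
  by apply: a; apply: (allP al); rewrite mem_nth ?sz.
move=> /andP[e /allP m]; apply/andP; split; first exact: IH.
apply/allP => i ii; have ik : i < k by move: ii; rewrite mem_iota.
have [l lk nl] : exists2 l, l < k & forall j, j < k -> j != i -> nth 0 h j != l.
  pose h' := [seq nth 0 h j | j <- iota 0 k & j != i].
  have [|] := boolP (all [in h'] (iota 0 k)).
    move=> /allP sub; have := uniq_leq_size (iota_uniq 0 k) sub.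
    rewrite size_map size_filter size_iota -{1}(size_iota 0 k) -(count_predC (pred1 i)).
    by rewrite (count_uniq_mem _ (iota_uniq 0 k)) ii add1n ltnn.
  case/allPn => l; rewrite mem_iota => /andP[_ lk] nh; exists l => // j jk ji.
  apply: contra nh => /eqP <-; apply/mapP; exists j => //.
  by rewrite mem_filter ji mem_iota.
have il : l \in iota 0 k by rewrite mem_iota.
have [f [fn fM fI]] := greedy_sound (m l il).
have re r' v : valid r' -> v < n -> set_nth 0 [seq nth 0 r' i | i <- h] i v =
    [seq nth 0 (set_nth 0 r' l v) j | j <- set_nth 0 h i l].
  move=> vr' vn; apply: (@eq_from_nth _ 0); rewrite !size_set_nth ?size_map ?size_set_nth ?sz //.
  rewrite (maxn_idPr ik) => j jk; rewrite nth_set_nth /= (nth_map 0) ?sz //.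
  rewrite (nth_map 0) ?size_set_nth ?sz ?(maxn_idPr ik) // !nth_set_nth /=.
  case: eqP => [_|/eqP ji]; first by rewrite eqxx.
  by rewrite (negbTE (nl j jk ji)).
apply: (greedy_complete (f := f)).
  by apply: difun_matches => //; [apply: difun_wl | apply: vh | apply: vh].
split=> // v vn; rewrite !re ?fn //; apply: IH; rewrite ?valid_set ?fn //.
- by rewrite size_set_nth sz (maxn_idPr ik).
- apply/allP => x /(nthP 0)[j]; rewrite size_set_nth sz (maxn_idPr ik) => jk <-.
  by rewrite nth_set_nth /=; case: eqP => // _; apply: (allP al); rewrite mem_nth ?sz.
exact: fM.
Qed.

Lemma wl_anti t t' r s : t <= t' -> wl t' r s -> wl t r s.
Proof. by move=> /subnK <-; elim: (t' - t) => // d IH /andP[/IH]. Qed.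

Definition stable t := forall r s, valid r -> valid s -> wl t r s -> wl t.+1 r s.

Lemma stableW t t' : t <= t' -> stable t -> stable t'.
Proof.
move=> /subnK <-; elim: (t' - t) => // d IH /IH st r s vr vs h.
suff -> : wl (d.+1 + t).+1 r s = wl (d.+1 + t) r s by [].
apply: wl_valid_ext => // r' s' vr' vs'; apply/idP/idP; first by case/andP.
exact: st.
Qed.

Lemma valid_tuple r : valid r -> exists p : k.-tuple 'I_n, map val p = r.
Proof.
move=> vr; exists [tuple Ordinal (valid_nth vr (ltn_ord i)) | i < k].
have /andP[/eqP sz _] := vr.
apply: (@eq_from_nth _ 0) => [|j]; rewrite size_map size_tuple ?sz // => jk.
by rewrite -[map _ _]/(tval (map_tuple val _)) -(tnth_nth 0 _ (Ordinal jk)) tnth_map tnth_mktuple.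
Qed.

Lemma tuple_valid (p : k.-tuple 'I_n) : valid (map val p).
Proof.
rewrite /valid size_map size_tuple eqxx; apply/allP => _ /mapP[i _ ->]; exact: ltn_ord.
Qed.

(** Every round that changes something loses one of the n^(2k) pairs of tuples. *)
Lemma wl_stable t : n ^ (2 * k) < t -> stable t.
Proof.
move=> lt; apply/not_notP => ns.
have ns' t' : t' <= t -> ~ stable t' by move=> le /(stableW le).
pose X t' := [set p : k.-tuple 'I_n * k.-tuple 'I_n | wl t' (map val p.1) (map val p.2)].
have dec t' : t' <= t -> #|X t'| + t' <= n ^ (2 * k).
  elim: t' => [_|t' IH tt].
    by rewrite addn0 (leq_trans (max_card _)) // card_prod !card_tuple !card_ord mul2n -addnn expnD.
  rewrite addnS; apply: leq_trans (IH (ltnW tt)); rewrite ltn_add2r; apply: proper_card.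
  apply/properP; split; first by apply/subsetP => p; rewrite !inE => /andP[].
  have := ns' _ (ltnW tt); rewrite /stable; move=> /existsNP[r /existsNP[s]].
  case/not_implyP => vr /not_implyP[vs] /not_implyP[h /negP nh].
  have [p pr] := valid_tuple vr; have [q qs] := valid_tuple vs.
  by exists (p, q); rewrite inE /= pr qs.
by have := dec t (leqnn t); lia.
Qed.

(** The isomorphism itself is a matching at every coordinate in every round. *)
Lemma wl_map f t r : (forall v, v < n -> f v < n) -> {in gtn n &, injective f} ->
  (forall v w, v < n -> w < n -> eG v w = eH (f v) (f w)) -> valid r -> wl t r (map f r).
Proof.
move=> fn fI fe; elim: t r => [|t IH] r vr; have /andP[/eqP sz al] := vr.
  apply/atomicP => i j ik jk; rewrite !(nth_map 0) ?sz // -fe ?valid_nth //; split=> //.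
  by apply/eqP/eqP => [->//|]; apply: fI; apply: valid_nth.
rewrite /= /wl_step IH //; apply/allP => i; rewrite mem_iota => /andP[_ ik].
have vf : valid (map f r).
  by rewrite /valid size_map sz eqxx; apply/allP => _ /mapP[v /(allP al) vn ->]; apply: fn.
apply: (greedy_complete (f := f)); first by apply: difun_matches => //; apply: difun_wl.
split=> // v vn.
have -> : set_nth 0 (map f r) i (f v) = map f (set_nth 0 r i v).
  apply: (@eq_from_nth _ 0); rewrite ?size_map !size_set_nth ?size_map // sz (maxn_idPr ik) => j jk.
  rewrite (nth_map 0) ?size_set_nth ?sz ?(maxn_idPr ik) // !nth_set_nth /=.
  by case: eqP => // _; rewrite (nth_map 0) ?sz.
by apply: IH; apply: valid_set.
Qed.

End WL.

(** * From the stable refinement to the pebble game and to isomorphism *)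

Definition nadj G : rel nat := fun i j =>
  if (insub i, insub j) is (Some x, Some y) then adj G x y else false.

Lemma nadj_val G (x y : 'I_(nv G)) : nadj G x y = adj G x y.
Proof. by rewrite /nadj !valK. Qed.

Section WLBisim.
Variables (k : nat) (G H : graph) (t : nat).
Local Notation n := (nv G).
Hypothesis nGH : nv H = n.
Local Notation E := (wl k n (nadj G) (nadj H) t).
Hypothesis st : stable k n (nadj G) (nadj H) t.

(** Positions with fewer pebbles, or repeated ones, are read off related [k]-tuples at the
    coordinates [ps]; the other coordinates are free for new pebbles. *)
Definition wl_bisim (xs : seq 'I_(nv G)) (ys : seq 'I_(nv H)) := exists r s ps,
  [/\ valid k n r, valid k n s, E r s & [/\ size ps <= k, all (gtn k) ps,
    map val xs = [seq nth 0 r i | i <- ps] & map val ys = [seq nth 0 s i | i <- ps]]].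

(* Every witness can be normalized to the tuple padded with its own first vertex. *)
Let pad (us : seq nat) := us ++ nseq (k - size us) (head 0 us).

Let wl_bisim_pad xs ys : wl_bisim xs ys -> xs != [::] ->
  [/\ valid k n (pad (map val xs)), valid k n (pad (map val ys)) & E (pad (map val xs)) (pad (map val ys))].
Proof.
case=> r [s [ps [vr vs e [sz al Ex Ey]]]] x0.
have s0 : 0 < size ps.
  by move: (congr1 size Ex); rewrite !size_map => <-; case: (xs) x0.
pose h := ps ++ nseq (k - size ps) (head 0 ps).
have hk : size h = k by rewrite size_cat size_nseq subnKC.
have ha : all (gtn k) h.
  rewrite all_cat al all_nseq; apply/orP; right.
  by case: (ps) al s0 => //= i ps' /andP[].
have ph u us : map val (us : seq 'I_u) = [seq nth 0 r i | i <- ps] -> pad (map val us) = [seq nth 0 r i | i <- h].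
  move=> ->; rewrite /pad /h map_cat map_nseq size_map; congr (_ ++ nseq _ _).
  by case: (ps) s0.
have ph' u us : map val (us : seq 'I_u) = [seq nth 0 s i | i <- ps] -> pad (map val us) = [seq nth 0 s i | i <- h].
  move=> ->; rewrite /pad /h map_cat map_nseq size_map; congr (_ ++ nseq _ _).
  by case: (ps) s0.
have vh r' : valid k n r' -> valid k n [seq nth 0 r' i | i <- h].
  move=> vr'; rewrite /valid size_map hk eqxx; apply/allP => _ /mapP[i /(allP ha) ik ->].
  exact: (valid_nth vr').
rewrite (ph _ _ Ex) (ph' _ _ Ey); split; [exact: vh | exact: vh | exact: wl_reindex].
Qed.

Theorem wl_bisimP r0 s0 : valid k n r0 -> valid k n s0 -> E r0 s0 ->
  bisim (adj G) (adj H) k setT setT wl_bisim /\ wl_bisim [::] [::].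
Proof.
move=> vr0 vs0 e0; split; last by exists r0, s0, [::].
split.
- move=> xs ys [r [s [ps [_ _ _ [_ _ /(congr1 size) Ex /(congr1 size) Ey]]]]].
  by move: Ex Ey; rewrite !size_map => -> ->.
- by move=> xs ys [r [s [ps [_ _ _ [sz _ /(congr1 size)]]]]]; rewrite !size_map => ->.
- by move=> xs ys _ x _; rewrite inE.
- by move=> xs ys _ x _; rewrite inE.
- move=> x y x' y' [r [s [ps [vr vs e [sz al Ex Ey]]]]].
  case: ps sz al Ex Ey => [|i [|j [|? ?]]] //= sz /and3P[ik jk _] [xi yj] [x'i y'j].
  have a0 : wl k n (nadj G) (nadj H) 0 r s := wl_anti (leq0n t) e.
  have [] := atomicP _ _ _ _ _ a0 i j ik jk.
  by rewrite -xi -yj -x'i -y'j !nadj_val.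
- move=> xs ys [r [s [ps [vr vs e [sz al Ex Ey]]]]] lt.
  (* Fewer than [k] coordinates are in use; a free one carries the new pebble, and its matching is
     Duplicator's bijection. *)
  have [l lk li] : exists2 l, l < k & l \notin ps.
    have [|] := boolP (all [in ps] (iota 0 k)).
      move=> /allP sub; have := uniq_leq_size (iota_uniq 0 k) sub.
      by move: (congr1 size Ex); rewrite !size_map size_iota => <-; rewrite leqNgt lt.
    by case/allPn => l; rewrite mem_iota => /andP[_ lk] nl; exists l.
  have /andP[_ /allP m] := st vr vs e.
  have lI : l \in iota 0 k by rewrite mem_iota.
  have [f [fn fM fI]] := greedy_sound (m l lI).
  have fH (v : 'I_n) : f v < nv H by rewrite nGH fn.
  exists (fun v => Ordinal (fH v)); first split.
  + by move=> v w _ _ [] /fI h; apply/val_inj/h; rewrite inE.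
  + apply/eqP; rewrite eqEcard subsetT card_in_imset ?cardsT ?card_ord ?nGH ?leqnn //.
    by move=> v w _ _ [] /fI h; apply/val_inj/h; rewrite inE.
  move=> v _; exists (set_nth 0 r l v), (set_nth 0 s l (f v)), (l :: ps); split.
  + exact: valid_set.
  + by apply: valid_set; rewrite ?fn.
  + exact: fM.
  have keep r' u : [seq nth 0 r' i | i <- ps] = [seq nth 0 (set_nth 0 r' l u) i | i <- ps].
    apply/eq_in_map => i ii; rewrite nth_set_nth /=; case: eqP => // il.
    by rewrite -il ii in li.
  split; rewrite /= ?lk //.
  + by move: (congr1 size Ex); rewrite !size_map => <-.
  + by rewrite Ex nth_set_nth /= eqxx (keep r v).
  + by rewrite Ey nth_set_nth /= eqxx (keep s (f v)).
- move=> xs ys [r [s [ps [vr vs e [sz al Ex Ey]]]]] x0 y0 h hal hs.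
  have szx : size xs = size ps by move: (congr1 size Ex); rewrite !size_map.
  have szy : size ys = size ps by move: (congr1 size Ey); rewrite !size_map.
  exists r, s, [seq nth 0 ps i | i <- h]; split=> //; split.
  + by rewrite size_map (leq_trans hs) // szx.
  + apply/allP => _ /mapP[i /(allP hal) ix ->]; apply: (allP al); by rewrite mem_nth // -szx.
  + rewrite -!map_comp; apply/eq_in_map => i /(allP hal) ix /=.
    by rewrite -(nth_map x0 0 val) // Ex (nth_map 0) // -szx.
  + rewrite -!map_comp; apply/eq_in_map => i /(allP hal) ix /=.
    by rewrite -(nth_map y0 0 val) ?szy -?szx // Ey (nth_map 0) // -szx.
move=> xs ys us vs h1 h2 h3.
have sz1 : size xs = size ys by case: h1 => r [s [ps [_ _ _ [_ _ /(congr1 size) Ex /(congr1 size) Ey]]]];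
  move: Ex Ey; rewrite !size_map => -> ->.
have sz2 : size us = size ys by case: h2 => r [s [ps [_ _ _ [_ _ /(congr1 size) Ex /(congr1 size) Ey]]]];
  move: Ex Ey; rewrite !size_map => -> ->.
have sz3 : size us = size vs by case: h3 => r [s [ps [_ _ _ [_ _ /(congr1 size) Ex /(congr1 size) Ey]]]];
  move: Ex Ey; rewrite !size_map => -> ->.
have szk : size xs <= k by case: h1 => r [s [ps [_ _ _ [sz _ /(congr1 size) Ex _]]]]; move: Ex sz;
  rewrite !size_map => ->.
case: (posnP (size xs)) => [x0|xp].
  have -> : xs = [::] by apply: size0nil.
  have -> : vs = [::] by apply: size0nil; rewrite -sz3 sz2 -sz1.
  by exists r0, s0, [::].
have nx : xs != [::] by case: (xs) xp.
have nu : us != [::] by move: xp; rewrite sz1 -sz2; case: (us).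
have [a1 b1 c1] := wl_bisim_pad h1 nx; have [a2 b2 c2] := wl_bisim_pad h2 nu.
have [a3 b3 c3] := wl_bisim_pad h3 nu.
exists (pad (map val xs)), (pad (map val vs)), (iota 0 (size xs)); split=> //.
  exact: difun_wl c1 c2 c3.
have take_pad m (zs : seq 'I_m) : size zs = size xs ->
    map val zs = [seq nth 0 (pad (map val zs)) i | i <- iota 0 (size xs)].
  move=> <-; rewrite -[LHS](mkseq_nth 0) /mkseq size_map; apply/eq_in_map => i.
  by rewrite mem_iota => /andP[_ iz]; rewrite nth_cat size_map iz.
split; rewrite ?size_iota //.
- by apply/allP => i; rewrite mem_iota => /andP[_] /leq_trans; apply.
- exact: take_pad.
by apply: take_pad; rewrite -sz3 sz2 -sz1.
Qed.

End WLBisim.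

Theorem wl_decides G H t : simple G -> simple H -> free2 co_2P1_P3 (path_graph 5) G ->
  nv H = nv G -> nv G ^ (2 * 11) < t ->
  (exists r s, [/\ valid 11 (nv G) r, valid 11 (nv G) s & wl 11 (nv G) (nadj G) (nadj H) t r s]) ->
  isomorphic G H.
Proof.
move=> sG sH fG nGH lt [r [s [vr vs e]]].
have [b e0] := wl_bisimP nGH (wl_stable lt) vr vs e.
exact: bisim_isomorphic sG sH fG b e0 _.
Qed.

(** The constant tuple at vertex 0 and its image survive. *)
Lemma isomorphic_wl k G H t : isomorphic G H -> 0 < nv G -> nv H = nv G /\
  exists r s, [/\ valid k (nv G) r, valid k (nv G) s & wl k (nv G) (nadj G) (nadj H) t r s].
Proof.
case=> f [fb fe] n0; have nGH : nv H = nv G by rewrite -[LHS]card_ord -(bij_eq_card fb) card_ord.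
split=> //; pose g i := if insub i is Some x then val (f x) else 0.
have gE (x : 'I_(nv G)) : g x = f x by rewrite /g valK.
have vr : valid k (nv G) (nseq k 0) by rewrite /valid size_nseq eqxx all_nseq /= n0 orbT.
have gn v : v < nv G -> g v < nv G.
  by move=> vn; apply: leq_trans (eq_leq nGH); rewrite (gE (Ordinal vn)).
have gI : {in gtn (nv G) &, injective g}.
  move=> v w vn wn; rewrite (gE (Ordinal vn)) (gE (Ordinal wn)) => /val_inj/(bij_inj fb).
  by case.
have ge v w : v < nv G -> w < nv G -> nadj G v w = nadj H (g v) (g w).
  by move=> vn wn; rewrite (gE (Ordinal vn)) (gE (Ordinal wn)) nadj_val -fe -nadj_val.
exists (nseq k 0), (map g (nseq k 0)); split=> //; last exact: wl_map.
rewrite /valid size_map size_nseq eqxx; apply/allP => _ /mapP[v vv ->]; apply: gn.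
by case/andP: vr => _ /allP/(_ v vv).
Qed.

(** * The decision program *)

(* Counters: 3 holds n, 11 holds n^2, 4-7 are used by arithmetic, 8 and 9 hold the vertices tried by
   the greedy matching, 10 counts rounds, 13-23 and 24-34 hold the two tuples.
   Arrays: 35-37 the input, 38 the current relation, 39 the next one, 40 the vertices already
   matched; 41-43 are flags, read at position 0. *)
Local Notation safe c := (all [in [:: 4; 5; 6; 7; 8; 9]] (asg c) && all [in [:: 40; 41; 42]] (puts c)).

Definition tupG := iota 13 11.
Definition tupH := iota 24 11.

(** Counter 0 is always zero, so it addresses position 0 of a flag array. *)
Definition fail := Put 42 0 false.
(** On a counter track [If] tests the equality of two counters. *)
Definition check_eq i j :=
  If (13 + i) (13 + j) (If (24 + i) (24 + j) Skip fail) (If (24 + i) (24 + j) fail Skip).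
(** The matrix of the second graph starts after the n * n entries of the first and one separator. *)
Definition addr_H ds := Seq (addr ds) (Seq (add 6 11) (Inc 6)).
Definition check_adj i j := Seq (addr [:: 13 + i; 13 + j])
  (If 6 36 (Seq (addr_H [:: 24 + i; 24 + j]) (If 6 36 Skip fail))
           (Seq (addr_H [:: 24 + i; 24 + j]) (If 6 36 fail Skip))).
Definition check_atomic :=
  seqs [seq seqs [seq Seq (check_eq i j) (check_adj i j) | j <- iota 0 11] | i <- iota 0 11].
Definition init_tuple := Seq (Put 42 0 true) (Seq check_atomic
  (Seq (addr (tupG ++ tupH)) (If 0 42 (Put 38 6 true) (Put 38 6 false)))).

(** Inner step of the greedy matching at coordinate [i]: flag 41 says that the vertex in counter 8
    already has a partner. *)
Definition try_partner i := If 0 41 Skip (If 9 40 Skip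
  (Seq (addr (set_nth 0 tupG i 8 ++ set_nth 0 tupH i 9))
    (If 6 38 (Seq (Put 41 0 true) (Put 40 9 true)) Skip))).
Definition find_partner i :=
  Seq (Put 41 0 false) (Seq (For 9 3 (try_partner i)) (If 0 41 Skip fail)).
Definition check_matching i := Seq (For 9 3 (Put 40 9 false)) (For 8 3 (find_partner i)).
(** The outcome goes to array 39, so that the whole round reads the old relation in 38. *)
Definition step_tuple := Seq (Put 42 0 true) (Seq (seqs [seq check_matching i | i <- iota 0 11])
  (Seq (addr (tupG ++ tupH))
    (If 6 38 (If 0 42 (Put 39 6 true) (Put 39 6 false)) (Put 39 6 false)))).

Definition nest xs c := foldr (fun x c => For x 3 c) c xs.
Definition all_tuples c := nest (tupG ++ tupH) c.
Definition round := Seq (all_tuples step_tuple)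
  (For 4 1 (If 4 39 (Put 38 4 true) (Put 38 4 false))).
(** The number of rounds is the cap, which exceeds n^22 and so ensures stability. Acceptance means
    that some pair is left. *)
Definition main := Seq (all_tuples init_tuple) (Seq (For 10 1 round)
  (For 4 1 (If 4 38 (Put 43 0 true) Skip))).
(** The separator sits at position n * n, which reveals n. The second graph has n vertices as well
    exactly when the input length is n * n + 1 + n * n. *)
Definition decide := Seq (For 12 2 (Seq (mul_to 6 12 12) (If 6 37 (set_to 3 12) Skip)))
  (Seq (mul_to 11 3 3) (Seq (set_to 7 11) (Seq (Inc 7) (Seq (add 7 11)
  (If 7 2 (If 3 0 (Put 43 0 true) main) Skip))))).

Lemma decide_wf : wf 35 43 decide && ~~ grows decide.
Proof. by vm_compute. Qed.

Lemma exec_inc x s : exec 35 (Inc x) s =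
  set_ctr s x (if ctr s x == ctr s 1 then ctr s x else (ctr s x).+1).
Proof. by []. Qed.

Lemma exec_if x z c d s : exec 35 (If x z c d) s = if track 35 s z (ctr s x) then exec 35 c s else exec 35 d s.
Proof. by []. Qed.

Lemma track_ctr s z i : z < 35 -> track 35 s z i = (ctr s z == i).
Proof. by rewrite /track => ->. Qed.

Lemma track_arr s z i : 35 <= z -> track 35 s z i = arr s z i.
Proof. by rewrite /track => h; case: ltnP => //; lia. Qed.

Lemma arr_put s a i b : arr (put s a i b) = fun a' j => if (a' == a) && (j == i) then b else arr s a' j.
Proof. by []. Qed.

Definition same s0 s := (forall x : nat, x \notin [:: 4; 5; 6; 7; 8; 9] -> ctr s x = ctr s0 x) /\
  (forall a : nat, a \notin [:: 40; 41; 42] -> arr s a = arr s0 a).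

Lemma safe_seq c d : safe (Seq c d) = safe c && safe d.
Proof. by rewrite /= !all_cat andbACA. Qed.

Lemma safe_if x z c d : safe (If x z c d) = safe c && safe d.
Proof. by rewrite /= !all_cat andbACA. Qed.

Lemma safe_for x y c : safe (For x y c) = (x \in [:: 4; 5; 6; 7; 8; 9]) && safe c.
Proof. by rewrite /= andbA. Qed.

Lemma safe_addr ds : safe (addr ds).
Proof.
rewrite addr_puts andbT; apply/allP => x /addr_asg; rewrite !inE.
by case/or4P => ->; rewrite ?orbT.
Qed.

Lemma same_exec c s0 s : safe c -> same s0 s -> same s0 (exec 35 c s).
Proof.
move=> /andP[/allP ca /allP cp] [h1 h2]; split=> [x nx|a na].
  by rewrite ctr_frame ?h1 //; apply: contra nx; apply: ca.
by rewrite arr_frame ?h2 //; apply: contra na; apply: cp.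
Qed.

Lemma same_refl s : same s s. Proof. by []. Qed.

Local Opaque addr.

(** * Correctness of the work on a single pair of tuples *)

Section Tuple.
Variables (s0 : store) (n : nat) (eG eH : rel nat).
Hypotheses (n0 : 0 < n) (home0 : ctr s0 0 = 0) (n_s0 : ctr s0 3 = n) (sq_s0 : ctr s0 11 = n * n).
Hypotheses (cap22 : n ^ 22 <= ctr s0 1) (cap2 : n * n + 1 + n * n <= ctr s0 1).
Hypothesis readG : forall i j, i < n -> j < n -> arr s0 36 (i * n + j) = eG i j.
Hypothesis readH : forall i j, i < n -> j < n -> arr s0 36 (n * n + 1 + (i * n + j)) = eH i j.
Hypothesis digits_ok : forall x, 13 <= x < 35 -> ctr s0 x < n.

Let r := map (ctr s0) tupG.
Let t := map (ctr s0) tupH.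

Let r_nth i : i < 11 -> nth 0 r i = ctr s0 (13 + i).
Proof. by move=> i11; rewrite (nth_map 0) ?size_iota // nth_iota. Qed.

Let t_nth i : i < 11 -> nth 0 t i = ctr s0 (24 + i).
Proof. by move=> i11; rewrite (nth_map 0) ?size_iota // nth_iota. Qed.

Let r_valid : valid 11 n r.
Proof.
rewrite /valid size_map size_iota eqxx; apply/allP => _ /mapP[x xx ->]; move: xx; rewrite mem_iota => xx.
by apply: digits_ok; lia.
Qed.

Let t_valid : valid 11 n t.
Proof.
rewrite /valid size_map size_iota eqxx; apply/allP => _ /mapP[x xx ->]; move: xx; rewrite mem_iota => xx.
by apply: digits_ok; lia.
Qed.

Lemma same_addr ds s : same s0 s -> same s0 (exec 35 (addr ds) s).
Proof. by apply: same_exec; apply: safe_addr. Qed.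

Lemma fail_correct s : same s0 s -> same s0 (exec 35 fail s) /\ arr (exec 35 fail s) 42 0 = false.
Proof.
move=> sm; split; first exact: same_exec.
by rewrite [exec 35 _ _]/(put _ _ _ _) arr_put /= sm.1 // home0.
Qed.

Lemma check_eq_correct i j s : i < 11 -> j < 11 -> same s0 s ->
  same s0 (exec 35 (check_eq i j) s) /\ arr (exec 35 (check_eq i j) s) 42 0 =
    arr s 42 0 && ((nth 0 r i == nth 0 r j) == (nth 0 t i == nth 0 t j)).
Proof.
move=> i11 j11 sm; have [fs fv] := fail_correct sm; have sc := sm.1.
have nscr x : 13 <= x -> x \notin [:: 4; 5; 6; 7; 8; 9] by rewrite !inE; lia.
rewrite /check_eq !exec_if !track_ctr; try lia.
rewrite !sc ?nscr //; try lia.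
rewrite !r_nth // !t_nth // [ctr s0 (13 + j) == _]eq_sym [ctr s0 (24 + j) == _]eq_sym.
by case: (_ == _); case: (_ == _) => //=; rewrite ?andbT ?andbF.
Qed.

Lemma check_adj_correct i j s : i < 11 -> j < 11 -> same s0 s ->
  same s0 (exec 35 (check_adj i j) s) /\ arr (exec 35 (check_adj i j) s) 42 0 =
    arr s 42 0 && (eG (nth 0 r i) (nth 0 r j) == eH (nth 0 t i) (nth 0 t j)).
Proof.
move=> i11 j11 sm.
have addrP u v s1 : same s0 s1 -> 13 <= u < 35 -> 13 <= v < 35 ->
    ctr (exec 35 (addr [:: u; v]) s1) 6 = ctr s0 u * n + ctr s0 v.
  move=> sm1 u1 v1; have nscr x : 13 <= x -> x \notin [:: 4; 5; 6; 7; 8; 9] by rewrite !inE; lia.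
  have [eu ev] : ctr s1 u = ctr s0 u /\ ctr s1 v = ctr s0 v by rewrite !sm1.1 ?nscr //; lia.
  rewrite (@addr_correct 35 n).
  - by rewrite /horner /= mul0n add0n eu ev.
  - by move=> x; rewrite !inE => /orP[] /eqP ->; lia.
  - by rewrite /= eu ev !digits_ok.
  - by rewrite sm1.1.
  by rewrite sm1.1 // (leq_trans _ cap22) // leq_pexp2l.
have [ri rj] : ctr s0 (13 + i) < n /\ ctr s0 (13 + j) < n by split; apply: digits_ok; lia.
have [ti tj] : ctr s0 (24 + i) < n /\ ctr s0 (24 + j) < n by split; apply: digits_ok; lia.
have posn a b : a < n -> b < n -> a * n + b < n * n.
  move=> an bn; apply: (@leq_trans (a.+1 * n)); last by rewrite leq_mul2r an orbT.
  by rewrite mulSn addnC ltn_add2r.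
have hP s1 : same s0 s1 -> let s2 := exec 35 (addr_H [:: 24 + i; 24 + j]) s1 in
    [/\ same s0 s2, arr s2 42 = arr s1 42 &
       arr s2 36 (ctr s2 6) = eH (nth 0 t i) (nth 0 t j)].
  move=> sm1 s2; have sa : safe (addr_H [:: 24 + i; 24 + j]) by rewrite /addr_H safe_seq safe_addr.
  have sm2 : same s0 s2 by apply: same_exec.
  split=> //; first by rewrite /s2 arr_frame // /addr_H /= addr_puts.
  rewrite (sm2.2 36) // !t_nth // -readH //; congr (arr s0 36 _).
  have smA := same_addr [:: 24 + i; 24 + j] sm1.
  rewrite /s2 /addr_H !exec_seq; set s3 := exec 35 (addr _) s1 in smA *.
  have e6 : ctr s3 6 = ctr s0 (24 + i) * n + ctr s0 (24 + j) by apply: addrP => //; lia.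
  have lt := posn _ _ ti tj.
  have e6' : ctr (exec 35 (add 6 11) s3) 6 = ctr s0 (24 + i) * n + ctr s0 (24 + j) + n * n.
    by rewrite add_correct // e6 !smA.1 // sq_s0 //; lia.
  have c1 : ctr (exec 35 (add 6 11) s3) 1 = ctr s0 1 by rewrite ctr_frame // smA.1.
  rewrite exec_inc ctr_set eqxx c1 e6' ifF; first by lia.
  by apply/eqP; lia.
have hB b s1 : same s0 s1 ->
    let s' := exec 35 (Seq (addr_H [:: 24 + i; 24 + j])
      (If 6 36 (if b then Skip else fail) (if b then fail else Skip))) s1 in
    same s0 s' /\ arr s' 42 0 = arr s1 42 0 && (b == eH (nth 0 t i) (nth 0 t j)).
  move=> sm1; rewrite exec_seq exec_if; have := hP s1 sm1.
  move: (exec 35 (addr_H _) s1) => s2 [sm2 <- e2]; have := fail_correct sm2.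
  rewrite track_arr // e2; move: (eH _ _) => b'.
  by case: b; case: b' => -[sm3 e3] s'; rewrite ?andbT ?andbF; split.
have sm1 := same_addr [:: 13 + i; 13 + j] sm.
rewrite /check_adj exec_seq.
have a42 : arr (exec 35 (addr [:: 13 + i; 13 + j]) s) 42 = arr s 42 by rewrite arr_frame // addr_puts.
have e6 : ctr (exec 35 (addr [:: 13 + i; 13 + j]) s) 6 = ctr s0 (13 + i) * n + ctr s0 (13 + j).
  by apply: addrP => //; lia.
move: (exec 35 (addr [:: 13 + i; 13 + j]) s) sm1 a42 e6 => s1 sm1 <- e6.
rewrite exec_if track_arr // e6 sm1.2 // readG // -!r_nth //.
by case: (eG _ _); [apply: (hB true) | apply: (hB false)].
Qed.

Lemma check_atomic_correct s : same s0 s ->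
  same s0 (exec 35 check_atomic s) /\
  arr (exec 35 check_atomic s) 42 0 = arr s 42 0 && atomic 11 eG eH r t.
Proof.
apply: exec_seqs => i ii s1; apply: exec_seqs => j jj {}s1 sm; rewrite exec_seq.
have i11 : i < 11 by move: ii; rewrite mem_iota.
have j11 : j < 11 by move: jj; rewrite mem_iota.
have [sm1 e1] := check_eq_correct i11 j11 sm.
by have [sm2 e2] := check_adj_correct i11 j11 sm1; rewrite e2 e1 andbA.
Qed.

Lemma addr_tuple s : same s0 s -> ctr (exec 35 (addr (tupG ++ tupH)) s) 6 = horner n (r ++ t).
Proof.
move=> sm; have E : map (ctr s) (tupG ++ tupH) = r ++ t.
  rewrite map_cat; congr (_ ++ _); apply/eq_in_map => x; rewrite mem_iota => xx;
    by apply: sm.1; rewrite !inE; lia.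
have /andP[_ ar] := r_valid; have /andP[_ at_] := t_valid.
rewrite (@addr_correct 35 n) ?E ?all_cat ?ar ?at_ //.
- by move=> x; rewrite mem_cat !mem_iota !inE; lia.
- by rewrite sm.1.
by rewrite sm.1.
Qed.

Lemma put_flag b s : same s0 s -> same s0 (exec 35 (Put 42 0 b) s) /\ arr (exec 35 (Put 42 0 b) s) 42 0 = b.
Proof. by move=> sm; split; [apply: same_exec | rewrite arr_put /= sm.1 // home0]. Qed.

Lemma init_tuple_correct x : arr (exec 35 init_tuple s0) 38 x =
  if x == horner n (r ++ t) then atomic 11 eG eH r t else arr s0 38 x.
Proof.
rewrite /init_tuple 3!exec_seq; have [sm1 e1] := put_flag true (same_refl s0).
move: (exec 35 (Put _ _ _) s0) sm1 e1 => s1 sm1 e1.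
have [sm2 e2] := check_atomic_correct sm1; rewrite e1 in e2.
move: (exec 35 check_atomic s1) sm2 e2 => s2 sm2 e2.
have e6 := addr_tuple sm2; have sm3 := same_addr (tupG ++ tupH) sm2.
have e3 : arr (exec 35 (addr (tupG ++ tupH)) s2) 42 0 = atomic 11 eG eH r t.
  by rewrite arr_frame ?addr_puts.
move: (exec 35 (addr _) s2) sm3 e6 e3 => s3 sm3 e6 e3.
rewrite exec_if track_arr // sm3.1 // home0 e3.
by case: (atomic _ _ _ _ _); rewrite arr_put /= e6; case: eqP => // _; rewrite sm3.2.
Qed.

Variable e : seq nat -> seq nat -> bool.
Hypothesis arr_e : forall r' t', valid 11 n r' -> valid 11 n t' -> arr s0 38 (horner n (r' ++ t')) = e r' t'.

Let M i v w := e (set_nth 0 r i v) (set_nth 0 t i w).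

Let uses s (us : seq nat) := forall x, x < n -> arr s 40 x = (x \in us).

Lemma clear_correct s : same s0 s -> let s' := exec 35 (For 9 3 (Put 40 9 false)) s in
  [/\ same s0 s', uses s' [::] & arr s' 42 = arr s 42].
Proof.
move=> sm s'; split; [exact: same_exec | | exact: arr_frame].
rewrite /s' exec_for sm.1 // n_s0 => x xn; rewrite in_nil.
suff h v x' : x' < v -> arr (loop 35 9 (Put 40 9 false) s v) 40 x' = false by apply: h xn.
by elim: v => // v IH; rewrite ltnS leq_eqVlt loopS /=; case: (x' =P v) => //= _ /IH.
Qed.

Lemma set_tupG s i v : same s0 s -> ctr s 8 = v -> i < 11 ->
  map (ctr s) (set_nth 0 tupG i 8) = set_nth 0 r i v.
Proof.
move=> sm s8 i11; have sz m (l : seq nat) : size l = 11 -> size (set_nth 0 l i m) = 11.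
  by move=> zl; rewrite size_set_nth zl (maxn_idPr i11).
apply: (@eq_from_nth _ 0); rewrite size_map !sz ?size_map ?size_iota // => j j11.
rewrite (nth_map 0) ?sz ?size_iota // !nth_set_nth /=; case: eqP => // _.
by rewrite r_nth // nth_iota // sm.1 // !inE; lia.
Qed.

Lemma set_tupH s i v : same s0 s -> ctr s 9 = v -> i < 11 ->
  map (ctr s) (set_nth 0 tupH i 9) = set_nth 0 t i v.
Proof.
move=> sm s8 i11; have sz m (l : seq nat) : size l = 11 -> size (set_nth 0 l i m) = 11.
  by move=> zl; rewrite size_set_nth zl (maxn_idPr i11).
apply: (@eq_from_nth _ 0); rewrite size_map !sz ?size_map ?size_iota // => j j11.
rewrite (nth_map 0) ?sz ?size_iota // !nth_set_nth /=; case: eqP => // _.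
by rewrite t_nth // nth_iota // sm.1 // !inE; lia.
Qed.

Lemma try_partner_correct i s us v w : i < 11 -> v < n -> w < n -> same s0 s ->
  ctr s 8 = v -> ctr s 9 = w -> uses s us -> let s' := exec 35 (try_partner i) s in
  let b := [&& ~~ arr s 41 0, w \notin us & M i v w] in
  arr s' 41 0 = arr s 41 0 || b /\ uses s' (if b then w :: us else us).
Proof.
move=> i11 vn wn sm s8 s9 us_s s'; rewrite /s' /try_partner exec_if track_arr // sm.1 // home0.
case fnd : (arr s 41 0); first by [].
rewrite exec_if track_arr // s9 us_s //; case wu : (w \in us); first by split; rewrite ?fnd.
rewrite !andTb orFb exec_seq.
set ds := _ ++ _.
have E : map (ctr s) ds = set_nth 0 r i v ++ set_nth 0 t i w.
  by rewrite map_cat (set_tupG sm s8 i11) (set_tupH sm s9 i11).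
have vr := valid_set r_valid i11 vn; have vt := valid_set t_valid i11 wn.
have e6 : ctr (exec 35 (addr ds) s) 6 = horner n (set_nth 0 r i v ++ set_nth 0 t i w).
  have /andP[_ ar] := vr; have /andP[_ at_] := vt.
  rewrite (@addr_correct 35 n) ?E ?all_cat ?ar ?at_ //.
  - have mem_set (l : seq nat) m y : i < size l -> y \in set_nth 0 l i m -> (y == m) || (y \in l).
      move=> il /(nthP 0)[j]; rewrite size_set_nth (maxn_idPr il) => jl <-.
      by rewrite nth_set_nth /=; case: (j =P i) => [_|_]; [rewrite eqxx | rewrite mem_nth ?orbT].
    move=> y; rewrite mem_cat => /orP[] /mem_set; rewrite size_iota => /(_ i11);
      by rewrite mem_iota !inE; lia.
  - by rewrite sm.1.
  by rewrite sm.1 // size_cat !size_set_nth !size_iota (maxn_idPr i11).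
have e8 := ctr_frame 35 s (c := addr ds) (x := 9); rewrite s9 in e8.
have {}e8 : ctr (exec 35 (addr ds) s) 9 = w.
  by apply: e8; apply/negP => /addr_asg.
have ea a : arr (exec 35 (addr ds) s) a = arr s a by rewrite arr_frame ?addr_puts.
have sm1 := same_addr ds sm.
move: (exec 35 (addr ds) s) e6 e8 ea sm1 => s1 e6 e8 ea sm1.
rewrite exec_if track_arr // e6 sm1.2 // arr_e // -/(M i v w).
case: (M i v w); last by split=> [|x xn]; rewrite ?ea ?fnd ?us_s.
rewrite exec_seq /= sm1.1 // home0 e8; split=> // x xn.
by rewrite /= inE ea us_s //; case: eqP.
Qed.

Lemma safe_try i : safe (try_partner i).
Proof. by rewrite /try_partner 2!safe_if safe_seq safe_addr. Qed.

Lemma safe_find i : safe (find_partner i).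
Proof. by rewrite /find_partner !safe_seq safe_for safe_try. Qed.

Lemma same_set x v s : x \in [:: 4; 5; 6; 7; 8; 9] -> same s0 s -> same s0 (set_ctr s x v).
Proof.
by move=> xs [h1 h2]; split=> // y ny; rewrite ctr_set; case: eqP ny => [->|_] ny; [rewrite xs in ny | exact: h1].
Qed.

Lemma find_partner_correct i s us v : i < 11 -> v < n -> same s0 s -> ctr s 8 = v -> uses s us ->
  let s' := exec 35 (find_partner i) s in let g := greedy_step n (M i) (us, true) v in
  [/\ same s0 s', uses s' g.1 & arr s' 42 0 = arr s 42 0 && g.2].
Proof.
move=> i11 vn sm s8 us_s s' g.
(* The free partners below [w]: the flag is up once this list is nonempty, and its head, the least
   free partner, is the one [greedy_step] takes. *)
pose F w := [seq x <- iota 0 w | (x \notin us) && M i v x].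
pose us' w := if F w is z :: _ then z :: us else us.
rewrite /s' /find_partner 2!exec_seq; set s1 := exec 35 (Put 41 0 false) s.
have sm1 : same s0 s1 by apply: same_exec.
have s18 : ctr s1 8 = v by [].
have us1 : uses s1 us by move=> x xn; rewrite -us_s.
have f1 : arr s1 41 0 = false by rewrite /s1 [exec 35 _ _]/(put _ _ _ _) arr_put /= sm.1 // home0.
have a1 : arr s1 42 = arr s 42 by [].
have lp w : w <= n -> let s2 := loop 35 9 (try_partner i) s1 w in
    [/\ same s0 s2, ctr s2 8 = v, arr s2 42 = arr s 42, arr s2 41 0 = (F w != [::]) & uses s2 (us' w)].
  elim: w => [_|w IH wn]; first by split.
  have [sm2 e8 a2 e2 us2] := IH (ltnW wn).
  move=> s2; rewrite /s2 loopS; set s3 := set_ctr _ 9 w.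
  have sm3 : same s0 s3 by apply: same_set.
  have u3 : uses s3 (us' w) by [].
  have [e4 u4] := try_partner_correct i11 vn wn sm3 e8 (erefl : ctr s3 9 = w) u3.
  have FS : F w.+1 = F w ++ (if (w \notin us) && M i v w then [:: w] else [::]).
    by rewrite /F -addn1 iotaD filter_cat.
  have a4 : arr (exec 35 (try_partner i) s3) 42 = arr s 42.
    by rewrite -a2 -/(arr s3 42) arr_frame // /try_partner /= addr_puts.
  have sm4 := same_exec (safe_try i) sm3.
  have e8' : ctr (exec 35 (try_partner i) s3) 8 = v.
    rewrite -e8 -/(ctr s3 8) ctr_frame // /try_partner /= ?cats0; by apply/negP => /addr_asg.
  have e2' : arr s3 41 0 = (F w != [::]) by [].
  rewrite e2' in e4 u4; split=> //.
    rewrite e4 FS /us'; case: (F w) => //=; case: (w \notin us) => //=; by case: (M i v w).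
  move=> x xn; rewrite u4 // /us' FS; case: (F w) => [|z zs] //=.
  by case: (w \notin us) => //=; case: (M i v w).
rewrite exec_for sm1.1 // n_s0; have [sm2 e8 a2 e2 us2] := lp n (leqnn n).
set s3 := set_ctr _ 9 n; have sm3 : same s0 s3 by apply: same_set.
have u3 : uses s3 (us' n) by [].
have a3 : arr s3 42 = arr s 42 by [].
have e3 : arr s3 41 0 = (F n != [::]) by [].
rewrite exec_if track_arr // sm3.1 // home0 e3 /g /greedy_step -/(F n).
have [sm4 e4] := fail_correct sm3; move: u3; rewrite /us'.
rewrite -[free_partners _ _ _ _]/(F n); case: (F n) => [|z zs] u3 /=; last by rewrite andbT -a3.
by rewrite andbF.
Qed.

Lemma check_matching_correct i s : i < 11 -> same s0 s ->
  same s0 (exec 35 (check_matching i) s) /\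
  arr (exec 35 (check_matching i) s) 42 0 = arr s 42 0 && matches n e r t i.
Proof.
move=> i11 sm; rewrite /check_matching exec_seq; have [] := clear_correct sm.
move: (exec 35 (For 9 3 _) s) => s1 sm1 u1 a1.
pose g v := foldl (greedy_step n (M i)) ([::], true) (iota 0 v).
have lp v : v <= n -> let s2 := loop 35 8 (find_partner i) s1 v in
    [/\ same s0 s2, uses s2 (g v).1 & arr s2 42 0 = arr s 42 0 && (g v).2].
  elim: v => [_|v IH vn]; first by split; rewrite ?a1 ?andbT.
  have [sm2 u2 e2] := IH (ltnW vn); rewrite loopS; set s3 := set_ctr _ 8 v.
  have sm3 : same s0 s3 by apply: same_set.
  have [sm4 u4 e4] := find_partner_correct i11 vn sm3 (erefl : ctr s3 8 = v) (u2 : uses s3 _).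
  have gS : g v.+1 = greedy_step n (M i) (g v) v by rewrite /g -addn1 iotaD foldl_cat.
  have e3 : arr s3 42 0 = arr s 42 0 && (g v).2 by [].
  rewrite e3 in e4; move: u4 e4; rewrite gS /greedy_step; case: free_partners => [|w ws] u4 e4.
    by split=> //; rewrite e4 /= !andbF.
  by split=> //; rewrite e4 /= andbT.
rewrite exec_for sm1.1 // n_s0; have [sm2 u2 e2] := lp n (leqnn n).
by split=> //; apply: same_set.
Qed.

Lemma step_tuple_correct x : arr (exec 35 step_tuple s0) 39 x =
  if x == horner n (r ++ t) then wl_step 11 n e r t else arr s0 39 x.
Proof.
rewrite /step_tuple 3!exec_seq; have [sm1 e1] := put_flag true (same_refl s0).
move: (exec 35 (Put _ _ _) s0) sm1 e1 => s1 sm1 e1.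
have [sm2 e2] : same s0 (exec 35 (seqs [seq check_matching i | i <- iota 0 11]) s1) /\
    arr (exec 35 (seqs [seq check_matching i | i <- iota 0 11]) s1) 42 0 =
      arr s1 42 0 && all (matches n e r t) (iota 0 11).
  apply: exec_seqs sm1 => i ii s sm.
  by apply: check_matching_correct => //; move: ii; rewrite mem_iota.
move: (exec 35 (seqs _) s1) sm2 e2 => s2 sm2 e2.
have e6 := addr_tuple sm2; have sm3 := same_addr (tupG ++ tupH) sm2.
have e3 : arr (exec 35 (addr (tupG ++ tupH)) s2) 42 0 = all (matches n e r t) (iota 0 11).
  by rewrite arr_frame ?addr_puts // e2 e1.
move: (exec 35 (addr _) s2) sm3 e6 e3 => s3 sm3 e6 e3.
rewrite exec_if track_arr // sm3.2 // e6 arr_e // /wl_step.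
case: (e r t); last by rewrite arr_put /= e6; case: eqP => // _; rewrite sm3.2.
rewrite exec_if track_arr // sm3.1 // home0 e3.
by case: (all _ _); rewrite arr_put /= e6; case: eqP => // _; rewrite sm3.2.
Qed.

End Tuple.

Local Opaque addr init_tuple step_tuple.

(** * Nested loops over all tuples *)

Section Nest.
Variables (n : nat) (c : cmd) (o : nat) (vars : seq nat) (Q : store -> Prop) (Phi : nat -> bool).
Hypotheses (n0 : 0 < n) (uv : uniq vars) (nv : {in vars, forall x : nat, x \notin asg c}) .
Hypotheses (Qset : forall s x v, x \in vars -> Q s -> Q (set_ctr s x v)) (Q3 : forall s, Q s -> ctr s 3 = n).
Hypothesis body : forall s, Q s -> {in vars, forall x, ctr s x < n} ->
  Q (exec 35 c s) /\ forall a, arr (exec 35 c s) o a =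
    if a == horner n (map (ctr s) vars) then Phi a else arr s o a.

Lemma nest_asg xs x : x \in asg (nest xs c) -> (x \in xs) || (x \in asg c).
Proof.
elim: xs => [|y xs IH] /=; first by [].
by rewrite !inE => /orP[->//|/IH /orP[->|->]]; rewrite !orbT.
Qed.

(** With the outer counters [ps] fixed, the remaining loops rewrite exactly the addresses whose
    leading base-n digits are the values of [ps]. *)
Lemma nest_correct ps xs s : ps ++ xs = vars -> Q s -> {in ps, forall x, ctr s x < n} ->
  Q (exec 35 (nest xs c) s) /\ forall a, arr (exec 35 (nest xs c) s) o a =
    if a %/ n ^ size xs == horner n (map (ctr s) ps) then Phi a else arr s o a.
Proof.
elim: xs ps s => [|x xs IH] ps s.
  rewrite cats0 => -> Qs ok; rewrite [nest _ _]/= expn0; have [Q1 e1] := body Qs ok.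
  by split=> // a; rewrite e1 divn1.
move=> pE Qs ok; have xv : x \in vars by rewrite -pE mem_cat mem_head orbT.
have pxE : rcons ps x ++ xs = vars by rewrite cat_rcons.
have sub y : y \in ps -> y \notin asg (nest xs c) /\ y != x.
  move=> yp; have := uv; rewrite -pxE cat_uniq rcons_uniq => /and3P[/andP[xp _] /hasPn hp _].
  split; last by apply: contra xp => /eqP <-.
  apply/negP => /nest_asg/orP[/hp|].
    by rewrite mem_rcons inE yp orbT.
  by apply/negP; apply: nv; rewrite -pE mem_cat yp.
have -> : nest (x :: xs) c = For x 3 (nest xs c) by [].
rewrite exec_for (Q3 Qs).
(* After [v] rounds the rewritten addresses are those whose next digit is below [v]. *)
suff lp v : v <= n -> [/\ Q (loop 35 x (nest xs c) s v),
    {in ps, forall y, ctr (loop 35 x (nest xs c) s v) y = ctr s y} &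
    forall a, arr (loop 35 x (nest xs c) s v) o a =
      if (a %/ n ^ (size xs).+1 == horner n (map (ctr s) ps)) && ((a %/ n ^ size xs) %% n < v)
      then Phi a else arr s o a].
  have [Q1 _ e1] := lp n (leqnn n); split=> [|a]; first exact: Qset.
  by have := e1 a; rewrite ltn_mod n0 andbT.
elim: v => [_|v IHv vn]; first by split=> // a; rewrite ltn0 andbF.
have [Q1 c1 e1] := IHv (ltnW vn); rewrite loopS; set s1 := set_ctr _ x v.
have Q1' : Q s1 by apply: Qset.
have ms : map (ctr s1) (rcons ps x) = rcons (map (ctr s) ps) v.
  rewrite map_rcons ctr_set eqxx; congr (rcons _ _); apply/eq_in_map => y yp.
  by rewrite ctr_set (negbTE (sub y yp).2) c1.
have [|Q2 e2] := IH (rcons ps x) s1 pxE Q1'.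
  move=> y; rewrite mem_rcons inE ctr_set; case: eqP => //= _ yp; rewrite c1 //; exact: ok.
split=> // [y yp|a]; first by rewrite ctr_frame ?(sub y yp).1 // ctr_set (negbTE (sub y yp).2) c1.
rewrite e2 ms horner_rcons (e1 a : arr s1 o a = _) ltnS.
have -> : a %/ n ^ (size xs).+1 = a %/ n ^ size xs %/ n by rewrite -divnMA -expnSr.
move: (a %/ n ^ size xs) (horner n (map (ctr s) ps)) => b p.
have -> : (b == p * n + v) = (b %/ n == p) && (b %% n == v).
  apply/eqP/andP => [->|[/eqP <- /eqP <-]]; last exact: divn_eq.
  by rewrite divnMDl // divn_small // addn0 modnMDl modn_small.
by rewrite [b %% n <= v]leq_eqVlt; case: (b %/ n == p) => //=; case: (b %% n == v).
Qed.

End Nest.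

Local Opaque expn.

(** * Correctness of the refinement rounds *)

Section Main.
Variables (n cap : nat) (eG eH : rel nat) (inp : nat -> bool).
Hypotheses (n0 : 0 < n) (cap22 : n ^ 22 < cap) (cap2 : n * n + 1 + n * n <= cap).
Hypothesis readG : forall i j, i < n -> j < n -> inp (i * n + j) = eG i j.
Hypothesis readH : forall i j, i < n -> j < n -> inp (n * n + 1 + (i * n + j)) = eH i j.

Definition base s := [/\ ctr s 0 = 0, ctr s 1 = cap, ctr s 3 = n, ctr s 11 = n * n & arr s 36 = inp].

Lemma base_set s x v : x \notin [:: 0; 1; 3; 11] -> base s -> base (set_ctr s x v).
Proof.
rewrite !inE !negb_or => /and4P[h0 h1 h3 h11] [b0 b1 b3 b11 i].
by split; rewrite ?ctr_set // eq_sym; [rewrite (negbTE h0) | rewrite (negbTE h1) |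
  rewrite (negbTE h3) | rewrite (negbTE h11)].
Qed.

Definition keeps_base c := all (fun x => x \notin asg c) [:: 0; 1; 3; 11] && (36 \notin puts c).

Lemma base_exec s c : keeps_base c -> base s -> base (exec 35 c s).
Proof.
move=> /andP[/and5P[h0 h1 h3 h11 _] h36] [b0 b1 b3 b11 i].
by split; rewrite ?ctr_frame ?arr_frame.
Qed.

Lemma init_frame : [&& keeps_base init_tuple, all (fun x => x \notin asg init_tuple) (tupG ++ tupH) &
  39 \notin puts (all_tuples init_tuple)].
Proof. by vm_compute. Qed.

Lemma step_frame : [&& keeps_base step_tuple, all (fun x => x \notin asg step_tuple) (tupG ++ tupH) &
  38 \notin puts (all_tuples step_tuple)].
Proof. by vm_compute. Qed.

Definition at_tuple (E : seq nat -> seq nat -> bool) a :=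
  E (take 11 (digits n 22 a)) (drop 11 (digits n 22 a)).

Lemma at_tuple_horner E r t : valid 11 n r -> valid 11 n t -> at_tuple E (horner n (r ++ t)) = E r t.
Proof.
move=> /andP[/eqP zr ar] /andP[/eqP zt at_].
have := @digitsK n (r ++ t); rewrite all_cat ar at_ size_cat zr zt => /(_ isT) E22.
by rewrite /at_tuple E22 take_cat drop_cat zr ltnn subnn take0 drop0 cats0.
Qed.

Lemma horner_bound r t : valid 11 n r -> valid 11 n t -> horner n (r ++ t) < n ^ 22.
Proof.
move=> /andP[/eqP zr ar] /andP[/eqP zt at_].
by have := @horner_lt n (r ++ t); rewrite all_cat ar at_ size_cat zr zt; apply.
Qed.

Lemma valid_tuples s : {in tupG ++ tupH, forall x, ctr s x < n} ->
  [/\ forall x, 13 <= x < 35 -> ctr s x < n, valid 11 n (map (ctr s) tupG) & valid 11 n (map (ctr s) tupH)].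
Proof.
move=> h; split=> [x xx||]; first by apply: h; rewrite mem_cat !mem_iota; lia.
  rewrite /valid size_map size_iota eqxx; apply/allP => _ /mapP[x xx ->]; apply: h.
  by rewrite mem_cat xx.
rewrite /valid size_map size_iota eqxx; apply/allP => _ /mapP[x xx ->]; apply: h.
by rewrite mem_cat xx orbT.
Qed.

Lemma all_tuples_correct c o (Q : store -> Prop) E s : all (fun x => x \notin asg c) (tupG ++ tupH) ->
  (forall s x v, x \notin [:: 0; 1; 3; 11] -> Q s -> Q (set_ctr s x v)) -> (forall s, Q s -> base s) ->
  (forall s, Q s -> Q (exec 35 c s)) ->
  (forall s, Q s -> (forall x, 13 <= x < 35 -> ctr s x < n) -> forall a, arr (exec 35 c s) o a =
     if a == horner n (map (ctr s) tupG ++ map (ctr s) tupH) then E (map (ctr s) tupG) (map (ctr s) tupH)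
     else arr s o a) ->
  Q s -> Q (exec 35 (all_tuples c) s) /\ forall a, arr (exec 35 (all_tuples c) s) o a =
    if a < n ^ 22 then at_tuple E a else arr s o a.
Proof.
move=> /allP fr Qset Qb Qc hE Qs; rewrite /all_tuples.
have sz : size (tupG ++ tupH) = 22 by [].
have := @nest_correct n c o (tupG ++ tupH) Q (at_tuple E) n0 isT fr _ _ _ [::] _ s erefl Qs.
rewrite sz; case.
- move=> s1 x v xv; apply: Qset; apply/negP; move: xv; rewrite mem_cat !mem_iota !inE; lia.
- by move=> s1 /Qb[].
- move=> s1 Q1 lt; have [dg vr vt] := valid_tuples lt; split; first exact: Qc.
  by move=> a; rewrite hE // map_cat; case: eqP => // ->; rewrite at_tuple_horner.
- by [].
move=> Q2 e2; split=> // a; rewrite e2 -[horner n (map _ [::])]/0; congr (if _ then _ else _).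
by rewrite -leqn0 -ltnS ltn_divLR ?mul1n // expn_gt0 n0.
Qed.

Lemma init_all_correct s : base s -> base (exec 35 (all_tuples init_tuple) s) /\
  forall a, arr (exec 35 (all_tuples init_tuple) s) 38 a =
    if a < n ^ 22 then at_tuple (atomic 11 eG eH) a else arr s 38 a.
Proof.
move=> bs; have /and3P[kb fr _] := init_frame.
apply: (all_tuples_correct fr base_set _ _ _ bs); first by move=> s1.
  by move=> s1; apply: base_exec kb.
move=> s1 [z0 z1 z3 z11 z36] dg a.
have c22 : n ^ 22 <= ctr s1 1 by rewrite z1 ltnW.
have c2 : n * n + 1 + n * n <= ctr s1 1 by rewrite z1.
by apply: (init_tuple_correct n0 z0 z3 z11 c22 c2 _ _ dg); rewrite z36.
Qed.

Lemma step_all_correct E s : base s ->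
  (forall r t, valid 11 n r -> valid 11 n t -> arr s 38 (horner n (r ++ t)) = E r t) ->
  let s' := exec 35 (all_tuples step_tuple) s in [/\ base s', arr s' 38 = arr s 38 &
  forall a, arr s' 39 a = if a < n ^ 22 then at_tuple (wl_step 11 n E) a else arr s 39 a].
Proof.
move=> bs eE; have /and3P[kb fr _] := step_frame.
pose Q s1 := base s1 /\ arr s1 38 = arr s 38.
have n38 : 38 \notin puts step_tuple by vm_compute.
have [] := @all_tuples_correct step_tuple 39 Q (wl_step 11 n E) s fr; last by case.
- by move=> s1 x v nx [b1 e1]; split; [apply: base_set nx b1 | exact: e1].
- by move=> s1 [].
- move=> s1 [b1 e1]; split; first exact: base_exec kb b1.
  by rewrite (arr_frame 35 s1 n38).
- move=> s1 [[z0 z1 z3 z11 z36] e1] dg a.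
  have c22 : n ^ 22 <= ctr s1 1 by rewrite z1 ltnW.
  have c2 : n * n + 1 + n * n <= ctr s1 1 by rewrite z1.
  by apply: (step_tuple_correct n0 z0 z3 z11 c22 c2 dg); rewrite e1.
by split.
Qed.

(** The last clause is there for the copy at the end of a round, which runs over all addresses below
    the cap. *)
Definition holds v s := [/\ base s,
  forall a, arr s 38 a = (a < n ^ 22) && at_tuple (wl 11 n eG eH v) a &
  forall a, n ^ 22 <= a -> arr s 39 a = false].

Lemma copy_correct s v : v <= cap -> base s ->
  let s' := loop 35 4 (If 4 39 (Put 38 4 true) (Put 38 4 false)) s v in
  [/\ base s', arr s' 39 = arr s 39 &
     forall a, arr s' 38 a = if a < v then arr s 39 a else arr s 38 a].
Proof.
elim: v => [_ bs|v IH vc bs]; first by [].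
have [b1 e1 h1] := IH (ltnW vc) bs; rewrite loopS; set s1 := set_ctr _ 4 v.
have b2 : base s1 by apply: base_set.
have h1' a : arr s1 38 a = if a < v then arr s 39 a else arr s 38 a by exact: h1.
split; first exact: base_exec.
  by rewrite arr_frame.
move=> a; rewrite exec_if track_arr // (_ : ctr s1 4 = v) // (_ : arr s1 39 v = arr s 39 v); last by rewrite -e1.
have E b : arr (exec 35 (Put 38 4 b) s1) 38 a = if a == v then b else arr s1 38 a by [].
have -> : arr (if arr s 39 v then exec 35 (Put 38 4 true) s1 else exec 35 (Put 38 4 false) s1) 38 a =
   if a == v then arr s 39 v else arr s1 38 a.
  by case: (arr s 39 v); rewrite E.
by rewrite h1' ltnS [a <= v]leq_eqVlt; case: eqP => [->|].
Qed.

Lemma at_tuple_ext E E' a : (forall r t, valid 11 n r -> valid 11 n t -> E r t = E' r t) ->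
  at_tuple E a = at_tuple E' a.
Proof.
move=> h; have al := digits_lt 22 a n0; have sz := size_digits n 22 a.
move: al; rewrite -{1}(cat_take_drop 11 (digits n 22 a)) all_cat => /andP[al1 al2].
by apply: h; rewrite /valid ?al1 ?al2 andbT; [rewrite size_takel ?sz | rewrite size_drop sz].
Qed.

Lemma round_correct v s : holds v s -> holds v.+1 (exec 35 round s).
Proof.
move=> [bs h38 h39]; rewrite /round exec_seq.
have [|b1 e1 h1] := @step_all_correct (wl 11 n eG eH v) s bs.
  by move=> r t vr vt; rewrite h38 horner_bound // at_tuple_horner.
move: (exec 35 (all_tuples step_tuple) s) b1 e1 h1 => s1 b1 e1 h1.
have c1 : ctr s1 1 = cap by case: b1.
rewrite exec_for c1; have [b2 e2 h2] := copy_correct (leqnn cap) b1.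
split; first exact: base_set.
(* Between n ^ 22 and the cap the value copied is false; beyond the cap nothing is copied and the
   old value is false. *)
- move=> a; rewrite [LHS]h2 h1 e1 h38; case: (ltnP a cap) => ac.
    by case: ifP => // an; rewrite h39 // leqNgt an.
  by rewrite ltnNge (leq_trans (ltnW cap22) ac).
by move=> a an; rewrite [LHS](congr1 (@^~ a) e2) h1 ltnNge an /= h39.
Qed.

Lemma main_correct s : base s -> (forall a, arr s 38 a = false) -> (forall a, arr s 39 a = false) ->
  arr s 43 0 = false ->
  arr (exec 35 main s) 43 0 <-> exists2 a, a < n ^ 22 & at_tuple (wl 11 n eG eH cap) a.
Proof.
move=> bs h38 h39 h43; rewrite /main 2!exec_seq.
have [b1 h1] := init_all_correct bs.
have hold0 : holds 0 (exec 35 (all_tuples init_tuple) s).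
  split=> // [a|a _]; first by rewrite h1 h38; case: ifP.
  have /and3P[_ _ n39] := init_frame; by rewrite (arr_frame 35 s n39).
have k43 : arr (exec 35 (all_tuples init_tuple) s) 43 0 = false.
  have n43 : 43 \notin puts (all_tuples init_tuple) by vm_compute.
  by rewrite (arr_frame 35 s n43).
move: (exec 35 (all_tuples init_tuple) s) hold0 k43 => s1 hold0 k43.
have lp v : holds v (loop 35 10 round s1 v).
  elim: v => // v [b2 h2 h2']; rewrite loopS; apply: round_correct.
  by split=> //; apply: base_set.
have c1 : ctr s1 1 = cap by case: hold0 => -[].
have hold1 : holds cap (exec 35 (For 10 1 round) s1).
  by rewrite exec_for c1; have [b2 h2 h2'] := lp cap; split=> //; apply: base_set.
have k43' : arr (exec 35 (For 10 1 round) s1) 43 0 = false.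
  have n43 : 43 \notin puts (For 10 1 round) by vm_compute.
  by rewrite (arr_frame 35 s1 n43).
move: (exec 35 (For 10 1 round) s1) hold1 k43' => s2 [b2 h2 _] k43'.
have c2 : ctr s2 1 = cap by case: b2.
rewrite exec_for c2 -[arr (set_ctr _ _ _)]/(arr (loop 35 4 (If 4 38 (Put 43 0 true) Skip) s2 cap)).
have fin v : let s3 := loop 35 4 (If 4 38 (Put 43 0 true) Skip) s2 v in
    [/\ base s3, arr s3 38 = arr s2 38 & arr s3 43 0 = has (arr s2 38) (iota 0 v)].
  elim: v => [|v [b3 e3 f3]]; first by split.
  rewrite loopS; set s3 := set_ctr _ 4 v; have b4 : base s3 by apply: base_set.
  split; [exact: base_exec | by rewrite arr_frame |].
  rewrite -[v.+1]addn1 iotaD has_cat -f3 [has _ (iota _ 1)]/= orbF exec_if track_arr //.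
  have -> : arr s3 38 (ctr s3 4) = arr s2 38 v by rewrite -e3.
  have z4 : ctr s3 0 = 0 by case: b4.
  by rewrite add0n; case: (arr s2 38 v); rewrite ?orbT ?orbF // [exec 35 _ _]/(put s3 43 (ctr s3 0) true) z4.
have [_ _ ->] := fin cap; split.
  by case/hasP => a _; rewrite h2 => /andP[an aw]; exists a.
by case=> a an aw; apply/hasP; exists a; rewrite ?mem_iota ?h2 ?an // (ltn_trans an).
Qed.

End Main.

Local Opaque addr init_tuple step_tuple expn main.

(** * Decoding the input, and the theorem *)

Lemma nth_allpairs (S T R : Type) (f : S -> T -> R) x0 y0 z0 s t i j : i < size s -> j < size t ->
  nth z0 [seq f x y | x <- s, y <- t] (i * size t + j) = f (nth x0 s i) (nth y0 t j).
Proof.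
elim: s i => // x s IH [|i] /= lt jt; rewrite nth_cat size_map.
  by rewrite mul0n add0n jt (nth_map y0).
by rewrite mulSn -addnA ltnNge leq_addr /= addKn IH.
Qed.

Lemma size_enc G : size (enc_graph G) = nv G * nv G.
Proof. by rewrite size_allpairs size_enum_ord. Qed.

Lemma nth_enc G i j : i < nv G -> j < nv G -> nth Sep (enc_graph G) (i * nv G + j) = bit (nadj G i j).
Proof.
move=> iG jG; have := @nth_allpairs _ _ _ (fun i j => bit (adj G i j)) (Ordinal iG) (Ordinal iG) Sep
  (enum 'I_(nv G)) (enum 'I_(nv G)) i j; rewrite size_enum_ord => -> //.
by rewrite -nadj_val -!(nth_map _ 0) ?size_enum_ord // val_enum_ord !nth_iota.
Qed.

Lemma enc_bit G i : i < nv G * nv G -> exists b, nth Sep (enc_graph G) i = bit b.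
Proof.
move=> lt; have n0 : 0 < nv G by case: (nv G) lt.
by exists (nadj G (i %/ nv G) (i %% nv G)); rewrite -nth_enc ?ltn_mod ?ltn_divLR // -divn_eq.
Qed.

Lemma track_bit b : (36 == in_track 35 (bit b)) = b.
Proof. by case: b. Qed.

Section Decide.
Variables (s : store) (cap m n n' : nat) (eG eH : rel nat).
Hypotheses (c0 : ctr s 0 = 0) (c1 : ctr s 1 = cap) (c2 : ctr s 2 = m).
Hypotheses (size_w : m = n * n + 1 + n' * n') (cap_m : m.+1 * m.+1 <= cap).
Hypothesis read_sep : forall i, arr s 37 i = (i == n * n).
Hypothesis readG : forall i j, i < n -> j < n -> arr s 36 (i * n + j) = eG i j.
Hypothesis readH : forall i j, n' = n -> i < n -> j < n -> arr s 36 (n * n + 1 + (i * n + j)) = eH i j.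
Hypothesis other_arrays : forall a i, a \notin [:: 35; 36; 37] -> arr s a i = false.

Let nn_m : n * n < m.
Proof. by rewrite size_w addn1 addSn ltnS leq_addr. Qed.

Let n_m : n < m.
Proof. by apply: leq_ltn_trans nn_m; case: (n) => // k; rewrite leq_pmulr. Qed.

Let n2 : n * n + 1 + n * n <= cap.
Proof. by apply: leq_trans cap_m; rewrite mulSn mulnS; move: nn_m; lia. Qed.

Definition find_n := Seq (mul_to 6 12 12) (If 6 37 (set_to 3 12) Skip).

Lemma find_n_correct : let s' := exec 35 (For 12 2 find_n) s in
  [/\ ctr s' 0 = 0, ctr s' 1 = cap, ctr s' 2 = m, ctr s' 3 = n & arr s' = arr s].
Proof.
move=> s'.
have fr x : x \notin asg (For 12 2 find_n) -> ctr s' x = ctr s x by apply: ctr_frame.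
have ar : arr s' = arr s by apply: funext => a; rewrite /s' arr_frame.
split; [by rewrite fr | by rewrite fr | by rewrite fr | | exact: ar].
rewrite /s' exec_for c2 ctr_set [3 == 12]/=.
(* Only round n meets the separator, since a number is determined by its square; later rounds leave
   counter 3 alone. Round n takes place because n < m. *)
suff h : forall v, v <= m -> n < v -> ctr (loop 35 12 find_n s v) 3 = n by apply: h.
have lfr x v : x \notin asg (For 12 2 find_n) -> ctr (loop 35 12 find_n s v) x = ctr s x.
  move=> nx; elim: v => // v IH; rewrite loopS ctr_frame ?ctr_set; last first.
    by apply: contra nx => xb; rewrite inE xb orbT.
  by case: eqP => // xE; move: nx; rewrite xE mem_head.
have lar v : arr (loop 35 12 find_n s v) = arr s.
  by elim: v => // v IH; apply: funext => a; rewrite loopS arr_frame // -IH.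
elim=> // v IH vm; rewrite ltnS leq_eqVlt loopS => nv.
set s1 := set_ctr _ 12 v; have a1 : arr s1 = arr s by apply: lar.
have e1 : ctr s1 1 = cap by rewrite ctr_set lfr.
have vv : v * v <= cap by apply: leq_trans cap_m; apply: leq_mul; lia.
rewrite /find_n exec_seq; set s2 := exec 35 (mul_to _ _ _) s1.
have e6 : ctr s2 6 = v * v.
  by rewrite /s2 /mul_to exec_seq for_add_correct // !ctr_set /= lfr // c1.
have e12 : ctr s2 12 = v by rewrite /s2 ctr_frame.
have e21 : ctr s2 1 = cap by rewrite /s2 ctr_frame.
have a2 : arr s2 37 = arr s 37 by rewrite /s2 arr_frame // a1.
have eq_n : v = n -> ctr (exec 35 (set_to 3 12) s2) 3 = n.
  move=> vn; rewrite set_to_correct ?e12 // e21; apply: leq_trans vv.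
  by case: (v) => // u; rewrite leq_pmulr.
have ne_n : v <> n -> ctr s2 3 = n.
  move=> ne; have nv' : n < v by case/orP: nv => // /eqP E; case: ne.
  by rewrite /s2 ctr_frame // ctr_set [3 == 12]/=; apply: IH (ltnW vm) nv'.
by rewrite exec_if track_arr // a2 e6 read_sep !mulnn eqn_sqr; case: (v =P n) => [/eq_n|/ne_n].
Qed.

Definition verdict := If 7 2 (If 3 0 (Put 43 0 true) main) Skip.

Lemma decide_prefix : exists s4, [/\ exec 35 decide s = exec 35 verdict s4, arr s4 = arr s,
  ctr s4 7 = n * n + 1 + n * n, base n cap (arr s 36) s4 & ctr s4 2 = m].
Proof.
have [] := find_n_correct; rewrite /decide exec_seq -/find_n.
move: (exec 35 (For 12 2 find_n) s) => s1 d0 d1 d2 d3 ar.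
rewrite exec_seq; set s2 := exec 35 (mul_to _ _ _) s1.
have le1 : ctr (set_ctr s1 11 0) 11 + ctr (set_ctr s1 11 0) 3 * ctr (set_ctr s1 11 0) 3 <=
    ctr (set_ctr s1 11 0) 1.
  by change (0 + ctr s1 3 * ctr s1 3 <= ctr s1 1); rewrite d1 d3; lia.
have e11 : ctr s2 11 = n * n.
  rewrite /s2 /mul_to exec_seq (@for_add_correct 35 11 3 3 (set_ctr s1 11 0) isT isT isT le1).
  by change (0 + ctr s1 3 * ctr s1 3 = n * n); rewrite d3.
have k2 x : x \notin [:: 4; 5; 11] -> ctr s2 x = ctr s1 x.
  by move=> nx; rewrite /s2 ctr_frame //; apply: contra nx; rewrite /= !inE; do 4?case: eqP.
have ar2 : arr s2 = arr s by apply: funext => a; rewrite /s2 arr_frame // ar.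
clearbody s2; rewrite 3!exec_seq exec_inc; set s3 := exec 35 (set_to 7 11) s2.
have k3 x : x \notin [:: 5; 7] -> ctr s3 x = ctr s2 x.
  by move=> nx; rewrite /s3 ctr_frame //; apply: contra nx; rewrite /= !inE; do 3?case: eqP.
have le11 : ctr s2 11 <= ctr s2 1 by rewrite e11 (k2 1) // d1; lia.
have e7 : ctr s3 7 = n * n by rewrite /s3 (@set_to_correct 35 7 11 s2 isT isT isT isT le11).
have ar3 : arr s3 = arr s by apply: funext => a; rewrite /s3 arr_frame // ar2.
clearbody s3; rewrite (k3 1) // (k2 1) // d1 e7 ifF; last by apply/eqP; lia.
set s4 := exec 35 (add 7 11) _.
have k4 x : x \notin [:: 5; 7] -> ctr s4 x = ctr s3 x.
  move=> nx; rewrite /s4 ctr_frame ?ctr_set; last by apply: contra nx; rewrite /= !inE => ->.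
  by case: eqP nx => // ->.
have f7 : ctr s4 7 = n * n + 1 + n * n.
  have [q1 q11] : ctr s3 1 = cap /\ ctr s3 11 = n * n by rewrite !k3 // k2.
  have r7 v : ctr (set_ctr s3 7 v) 7 = v by [].
  have r x v : x != 7 -> ctr (set_ctr s3 7 v) x = ctr s3 x by move=> /negbTE x7; rewrite ctr_set x7.
  by rewrite /s4 add_correct // r7 !r // q11 ?q1; lia.
have ar4 : arr s4 = arr s by apply: funext => a; rewrite /s4 arr_frame // -ar3.
clearbody s4.
have g0 : ctr s4 0 = 0 by rewrite k4 // k3 // k2.
have g1 : ctr s4 1 = cap by rewrite k4 // k3 // k2.
have g2 : ctr s4 2 = m by rewrite k4 // k3 // k2.
have g3 : ctr s4 3 = n by rewrite k4 // k3 // k2.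
have g11 : ctr s4 11 = n * n by rewrite k4 // k3.
by exists s4; split=> //; split; rewrite ?ar4.
Qed.

Hypothesis cap22 : n ^ 22 < cap.

Theorem decide_correct : track 35 (exec 35 decide s) 43 0 <-> n' = n /\ (n = 0 \/
  exists2 a, a < n ^ 22 & at_tuple n (wl 11 n eG eH cap) a).
Proof.
have [s4 [-> ar4 f7 b4 g2]] := decide_prefix; rewrite track_arr //.
have [g0 _ g3 _ _] := b4.
have no a i : a \notin [:: 35; 36; 37] -> arr s4 a i = false by rewrite ar4; apply: other_arrays.
rewrite /verdict exec_if track_ctr // g2 f7; case: eqP => [mE|mE]; last first.
  by split=> [|[nn _]]; [rewrite [arr _ 43 0]no | case: mE; rewrite size_w nn].
(* The length is also n * n + 1 + n' * n', so the squares agree. *)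
have nn : n' = n by apply/eqP; rewrite -eqn_sqr -!mulnn; move: mE; rewrite size_w => /addnI ->.
rewrite exec_if track_ctr // g0 g3; case: eqP => [n0|/eqP n0].
  by rewrite [arr _ 43 0](_ : _ = true); [split=> // _; split=> //; left | rewrite /= g0].
rewrite eq_sym -lt0n in n0.
have mc := main_correct n0 cap22 n2 readG (fun i j => @readH i j nn) b4 (fun a => no 38 a isT)
  (fun a => no 39 a isT) (no 43 0 isT).
split=> [/mc h|[_ [n0'|/mc //]]]; first by split=> //; right.
by rewrite n0' in n0.
Qed.

End Decide.

Lemma nv_enc G H : nv G < (size (enc_pair G H)).+1.
Proof.
rewrite ltnS size_cat size_enc; apply: leq_trans (leq_addr _ _).
by case: (nv G) => // n; rewrite leq_pmulr.
Qed.

Section Encoding.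
Variables G H : graph.
Let n := nv G.
Let n' := nv H.
Let w := enc_pair G H.
Let m := size w.
(** A pair of 11-tuples has 22 coordinates, so n ^ 22 addresses fit below this cap; [cap_cmd 21]
    produces the exponent 22. *)
Let cap := m.+1 ^ 22.
Let s := exec 35 (cap_cmd 21) (input_store 35 w).

Let size_w : m = n * n + 1 + n' * n'.
Proof. by rewrite /m /w size_cat /= !size_enc addn1 addSnnS. Qed.

Let arr_s z i : arr s z i = (i < m) && (z == in_track 35 (nth Sep w i)).
Proof.
have b0 : bounded 35 (ctr (input_store 35 w) 2) (input_store 35 w) by move=> y _ /=; case: eqP.
by have [_ [_ -> _ _]] := cap_cmd_correct (isT : 35 <= 43) isT 21 (erefl : ctr (input_store 35 w) 1 = 0) b0.
Qed.

Let ctr_s : [/\ ctr s 0 = 0, ctr s 1 = cap & ctr s 2 = m].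
Proof.
have b0 : bounded 35 (ctr (input_store 35 w) 2) (input_store 35 w) by move=> y _ /=; case: eqP.
have [_ [_ _ c1 d1]] := cap_cmd_correct (isT : 35 <= 43) isT 21 (erefl : ctr (input_store 35 w) 1 = 0) b0.
by split; [rewrite d1 | | rewrite d1].
Qed.

Let readG i j : i < n -> j < n -> arr s 36 (i * n + j) = nadj G i j.
Proof.
move=> iG jG; have lt : i * n + j < n * n.
  by apply: (@leq_trans (i.+1 * n)); [rewrite mulSn addnC ltn_add2r | rewrite leq_mul2r iG orbT].
rewrite arr_s (_ : _ < m); last by rewrite size_w; lia.
by rewrite /w nth_cat size_enc lt nth_enc // track_bit.
Qed.

Let readH i j : n' = n -> i < n -> j < n -> arr s 36 (n * n + 1 + (i * n + j)) = nadj H i j.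
Proof.
move=> nn iG jG; have lt : i * n + j < n * n.
  by apply: (@leq_trans (i.+1 * n)); [rewrite mulSn addnC ltn_add2r | rewrite leq_mul2r iG orbT].
rewrite arr_s (_ : _ < m); last by rewrite size_w nn; lia.
rewrite /w nth_cat size_enc ltnNge -addnA leq_addr /= addKn add1n /= -nn.
by rewrite nth_enc -/n' ?nn // track_bit.
Qed.

Let read_sep i : arr s 37 i = (i == n * n).
Proof.
rewrite arr_s /w nth_cat size_enc -/n; case: (ltngtP i (n * n)) => [lt|gt|->].
- by have [b ->] := enc_bit lt; case: b; rewrite andbF.
- case: (ltnP i m) => //= im; have lt : i - n * n - 1 < nv H * nv H by move: im; rewrite size_w -/n'; lia.
  rewrite -[i - n * n](@subnK 1); last by lia.
  by rewrite addn1 /=; have [b ->] := enc_bit lt; case: b.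
by rewrite subnn /= andbT size_w; lia.
Qed.

Let cap_m : m.+1 * m.+1 <= cap.
Proof. by rewrite mulnn leq_pexp2l. Qed.


Lemma decide_encoding : track 35 (exec 35 decide s) 43 0 <-> n' = n /\ (n = 0 \/
  exists2 a, a < n ^ 22 & at_tuple n (wl 11 n (nadj G) (nadj H) cap) a).
Proof.
have [z0 z1 z2] := ctr_s; apply: (decide_correct z0 z1 z2 size_w cap_m read_sep readG readH); last first.
  by rewrite ltn_exp2r // nv_enc.
move=> a i; rewrite arr_s !inE => /norP[/negbTE h1 /norP[/negbTE h2 /negbTE h3]].
by case: (nth Sep w i) => /=; rewrite ?h1 ?h2 ?h3 andbF.
Qed.

End Encoding.

Theorem theorem3 :
  GI_poly_time_on (fun G => simple G /\ free2 co_2P1_P3 (path_graph 5) G).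
Proof.
have /andP[wf_d gr_d] := decide_wf.
have [Q [Gam [M [c [k hM]]]]] := cmd_machine (isT : 35 <= 43) isT isT 21 wf_d gr_d (isT : 43 <= 43).
exists Q, Gam, M, c, k => G H [sG fG] [sH fH].
have [t [tl [ht ha]]] := hM (enc_pair G H).
exists t; split; [exact: tl | split; [exact: ht |]].
apply: (iff_trans ha); apply: (iff_trans (decide_encoding G H)).
clear t tl ht ha; have lt := nv_enc G H.
have c22 : nv G ^ 22 < (size (enc_pair G H)).+1 ^ 22 by rewrite (@ltn_exp2r _ _ 22 isT).
move: c22; set cap := _.+1 ^ 22 => c22; clearbody cap.
split=> [[nn [n0|[a an aw]]]|iso].
- have noG (x : 'I_(nv G)) : False by case: x => x; rewrite n0.
  have noH (x : 'I_(nv H)) : False by case: x => x; rewrite nn n0.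
  exists (fun x => False_rect _ (noG x)); split=> [|x]; last by case: (noG x).
  by exists (fun x => False_rect _ (noH x)) => x; [case: (noG x) | case: (noH x)].
(* The cap, which is the number of rounds, exceeds the number of pairs of tuples, so the surviving
   pair encoded by [a] belongs to a stable relation. *)
- apply: (wl_decides sG sH fG nn c22); have n0 : 0 < nv G by case: (nv G) an => //; rewrite exp0n.
  have sz := size_digits (nv G) 22 a; have := digits_lt 22 a n0.
  rewrite -(cat_take_drop 11 (digits _ _ _)) all_cat => /andP[al1 al2].
  exists (take 11 (digits (nv G) 22 a)), (drop 11 (digits (nv G) 22 a)); split; last exact: aw.
    by rewrite /valid al1 andbT size_takel ?sz.
  by rewrite /valid al2 andbT size_drop sz.
have nn : nv H = nv G by case: iso => f [fb _]; rewrite -[LHS]card_ord -(bij_eq_card fb) card_ord.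
split=> //; case: (posnP (nv G)) => [|n0]; [by left | right].
have [_ [r [s [vr vs e]]]] := isomorphic_wl 11 cap iso n0.
by exists (horner (nv G) (r ++ s)); [apply: horner_bound | rewrite at_tuple_horner].
Qed.
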